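(* Let $\lambda=(\lambda_1,\lambda_2,\lambda_3)\in\mathbb C^3$ with $\lambda_1+\lambda_2+\lambda_3=0$ and with $\mathrm{Re}(\lambda_1-\lambda_2)$, $\mathrm{Re}(\lambda_2-\lambda_3)$ sufficiently large, let $m_1,m_2\in\mathbb Z$, $\psi(n(x,y,z))=e^{2\pi i(m_1x+m_2y)}$, and let $w=\left(\begin{pmatrix}0&0&-1\\-1&0&0\\0&1&0\end{pmatrix},1\right)\in\widetilde G$. Let $f=\begin{pmatrix}f_1\\ f_2\end{pmatrix}\in\widetilde V^\infty_{-\lambda,{}^\intercal\phi^{-1}}$. If $m_1\ne0$, then $\big\langle f(\tilde g),\int_{\Gamma_\infty\backslash N}\tilde E_{w_{\alpha_2}}(n\tilde g)\psi(n)\,dn\big\rangle_{\lambda,\phi}=0$. If $m_1=0$, then $$\begin{aligned}&\Big\langle f(\tilde g),\int_{\Gamma_\infty\backslash N}\tilde E_{w_{\alpha_2}}(n\tilde g)\psi(n)\,dn\Big\rangle_{\lambda,\phi}\\ &=i\Big(\sum_{B_1\in\mathbb Z_{>0}}(4B_1)^{-1-\lambda_1+\lambda_2}\,\frac{K_1(m_2;4B_1)+K_{-1}(m_2;4B_1)}2\Big)\int_{\mathbb R}f_1(n(0,y,0)w)\psi^{-1}(n(0,y,0))\,dy\\ &\quad+(-i)\Big(\sum_{B_1\in\mathbb Z_{>0}}(4B_1)^{-1-\lambda_1+\lambda_2}\,\frac{K_1(m_2;4B_1)-K_{-1}(m_2;4B_1)}2\Big)\int_{\mathbb R}f_2(n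(0,y,0)w)\psi^{-1}(n(0,y,0))\,dy.\end{aligned}$$
   Context: **Kloosterman-type sums.** $(\frac{\cdot}{\cdot})$ is the Kronecker symbol. For $c\in\mathbb Z_{>0}$, $K_\kappa(n;4c)=\sum_{d\in\mathbb Z/4c\mathbb Z}\varepsilon_d^{-\kappa}(\frac{4c}{d})e^{2\pi ind/4c}$, where $\varepsilon_d=1$ if $d\equiv1$ mod $4$, $\varepsilon_d=i$ if $d\equiv-1$ mod $4$, and terms with $d$ even are $0$. **Groups.** $G=\mathrm{SL}(3,\mathbb R)$; $B$ is its upper triangular subgroup; $N=\{n(x,y,z)\}$ with $n(x,y,z)=\begin{pmatrix}1&x&z\\0&1&y\\0&0&1\end{pmatrix}$; $A$ is the group of diagonal matrices with positive entries; $\mathrm t(a,b,c)=\mathrm{diag}(a,b,c)$. $w_{\alpha_1}=\begin{pmatrix}0&-1&0\\1&0&0\\0&0&1\end{pmatrix}$, $w_{\alpha_2}=\begin{pmatrix}1&0&0\\0&0&-1\\0&1&0\end{pmatrix}$, $w_\ell=w_{\alpha_1}w_{\alpha_2}w_{\alpha_1}=\begin{pmatrix}0&0&1\\0&-1&0\\1&0&0\end{pmatrix}$. For nonzero reals $(x,y)_{\mathbb R}=-1$ if $x,y<0$ and $1$ otherwise. The Plücker coordinates of a matrix with second row $(d,e,f)$ and third row $(g,h,i)$ are $(A_1',B_1',C_1',A_2',B_2',C_2')=(-g,-h,-i,-(dh-eg),di-fg,-(ei-fh))$. **Double cover.** Let $X_1(g)=\det g$, let $X_2(g)$ be the first nonzero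 entry of $-A_2',B_2',-C_2'$, let $X_3(g)$ be the first nonzero entry of $-A_1',-B_1',-C_1'$, and $\Delta(g)=\mathrm t(X_1/X_2,X_2/X_3,X_3)$. The Banks–Levy–Sepanski cocycle $\sigma:G\times G\to\{\pm1\}$ is computed by: $\sigma(\mathrm t(a_1,a_2,a_3),\mathrm t(b_1,b_2,b_3))=(a_1,b_2)_{\mathbb R}(a_1,b_3)_{\mathbb R}(a_2,b_3)_{\mathbb R}$ (for diagonal matrices of any determinant); $\sigma(a,h)=\sigma(a,\Delta(h))$ for $a$ diagonal; $\sigma(w_\alpha,h)=\sigma(\Delta(w_\alpha h)\Delta(h),-\Delta(h))$ for $w_\alpha\in\{w_{\alpha_1},w_{\alpha_2}\}$; and if $g_1=naw_1\cdots w_kn'$ is the Bruhat decomposition ($n,n'\in N$, $a$ diagonal, $w_1\cdots w_k$ a reduced word in $w_{\alpha_1},w_{\alpha_2}$) then $\sigma(g_1,g_2)=\sigma(a,w_1\cdots w_kn'g_2)\sigma(w_1,w_2\cdots w_kn'g_2)\cdots\sigma(w_k,n'g_2)$. $\widetilde G=G\times\{\pm1\}$ with $(g_1,\epsilon_1)(g_2,\epsilon_2)=(g_1g_2,\epsilon_1\epsilon_2\sigma(g_1,g_2))$. $N$ and $A$ are regarded as subgroups $\widetilde N,\widetilde A$ of $\widetilde G$ via $g\mapsto(g,1)$. $\widetilde N_-=(w_\ell,1)^{-1}\widetilde N(w_\ell,1)$; $\widetilde M=\{(\mathrm t(\epsilon_1,\epsilon_2,\epsilon_1\epsilon_2),\pm1):\epsilon_i=\pm1\}$.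 **Principal series.** $\phi:\widetilde M\to \mathrm{SL}(2,\mathbb C)$ is the representation $\phi((\mathrm t(\epsilon_1,\epsilon_2,\epsilon_1\epsilon_2),\pm1))=\pm\begin{pmatrix}0&-1\\1&0\end{pmatrix}^{(1-\epsilon_1)/2}\begin{pmatrix}-i&0\\0&i\end{pmatrix}^{(1-\epsilon_2)/2}$. $\rho=(1,0,-1)$. For $\mu\in\mathbb C^3$ with coordinate sum $0$ and a two-dimensional representation $\eta$ of $\widetilde M$, $\widetilde V^{\infty}_{\mu,\eta}$ (resp. $\widetilde V^{-\infty}_{\mu,\eta}$) is the space of smooth (resp. distributional) $f:\widetilde G\to\mathbb C^2$ with $f(\tilde g\tilde m an_-)=\prod_i a_i^{-(\mu_i-\rho_i)}\,\eta(\tilde m^{-1})f(\tilde g)$ for $\tilde m\in\widetilde M$, $a=\mathrm t(a_1,a_2,a_3)\in\widetilde A$, $n_-\in\widetilde N_-$; $\widetilde G$ acts by $(\pi(h)f)(g)=f(h^{-1}g)$. The $\widetilde G$-invariant pairing $\widetilde V^\infty_{-\lambda,{}^\intercal\phi^{-1}}\times\widetilde V^{-\infty}_{\lambda,\phi}\to\mathbb C$ is the extension to distributions of $\langle f,h\rangle_{\lambda,\phi}=\int_{N}(f_1h_1+f_2h_2)((w',1)n)\,dn$ ($w'$ any Weyl representative, $dn=dx\,dy\,dz$). $\tilde\tau\in\widetilde V^{-\infty}_{\lambda,\phi}$ is the element whose restriction to $(w_\ell,1)n(x,y,z)$ is $\begin{pmatrix}\delta_{(0,0,0)}(x,y,z)\\0\end{pmatrix}$,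 i.e. $\langle f,\tilde\tau\rangle_{\lambda,\phi}=f_1((w_\ell,1))$; it is left $\widetilde N$-invariant. **Eisenstein distribution, $w_{\alpha_2}$-cell.** $\Gamma=\Gamma_1(4)$ is the group of $\gamma\in\mathrm{SL}(3,\mathbb Z)$ congruent mod $4$ to an upper triangular unipotent matrix; $\Gamma_\infty=N\cap\mathrm{SL}(3,\mathbb Z)$. Elements of $\Gamma\cap Nw_{\alpha_2}B$ have Plücker coordinates $(0,4B_1,C_1,0,0,-1)$ with $B_1\neq0$. $S:\Gamma\to\widetilde G$, $S(\gamma)=(\gamma,s(\gamma))$ is Miller's splitting homomorphism, with $s(\gamma)=(\frac{-B_1}{-C_1})$ on $\Gamma\cap Nw_{\alpha_2}B$. $\tilde E_{w_{\alpha_2}}(\tilde g)=\sum_{\gamma\in\Gamma_\infty\backslash(\Gamma\cap Nw_{\alpha_2}B)}\pi(S(\gamma)^{-1})\tilde\tau(\tilde g)\in\widetilde V^{-\infty}_{\lambda,\phi}$, convergent when $\mathrm{Re}(\lambda_1-\lambda_2)$, $\mathrm{Re}(\lambda_2-\lambda_3)$ are sufficiently large. The measure on $\Gamma_\infty\backslash N$ is induced by $dx\,dy\,dz$, and $\tilde E_{w_{\alpha_2}}(n\tilde g)$ means $\pi(n^{-1})\tilde E_{w_{\alpha_2}}$. *)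

(* Defs.v *)
From HB Require Import structures.
From mathcomp Require Import all_boot all_order all_algebra.
From mathcomp Require Import all_classical all_reals all_analysis.
From mathcomp Require Import complex ring.

Set Implicit Arguments.
Unset Strict Implicit.
Unset Printing Implicit Defensive.

Import Order.TTheory GRing.Theory Num.Theory.
Import numFieldNormedType.Exports.

Local Open Scope classical_set_scope.
Local Open Scope ring_scope.
Local Open Scope complex_scope.

Definition cis {R : realType} (t : R) : R[i] := cos t +i* sin t.

Definition e2pi {R : realType} (t : R) : R[i] := cis (2 * pi * t).

(* Principal value of a ^ s, meaningful for 0 < a. *)
Definition cpow {R : realType} (a : R) (s : R[i]) : R[i] :=
  (expR (complex.Re s * ln a))%:C * cis (complex.Im s * ln a).

Definition csummable {R : realType} {T : choiceType} (D : set T)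
    (f : T -> R[i]) : Prop :=
  summable D (fun x => (Normc.normc (f x))%:E).

(* Unconditional sums over D; they have their usual meaning on absolutely
   summable families. *)
Definition rsum {R : realType} {T : choiceType} (D : set T)
    (f : T -> R) : R :=
  fine (\esum_(x in D) (Num.max (f x) 0)%:E) -
  fine (\esum_(x in D) (Num.max (- f x) 0)%:E).

Definition csum {R : realType} {T : choiceType} (D : set T)
    (f : T -> R[i]) : R[i] :=
  rsum D (fun x => complex.Re (f x)) +i* rsum D (fun x => complex.Im (f x)).

Definition cintegrable {R : realType} {d : measure_display}
    {T : measurableType d} (mu : {measure set T -> \bar R}) (D : set T)
    (f : T -> R[i]) : Prop :=
  mu.-integrable D (fun x => (complex.Re (f x))%:E) /\
  mu.-integrable D (fun x => (complex.Im (f x))%:E).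

Definition cintegral {R : realType} {d : measure_display}
    {T : measurableType d} (mu : {measure set T -> \bar R}) (D : set T)
    (f : T -> R[i]) : R[i] :=
  (\int[mu]_(x in D) complex.Re (f x)) +i* (\int[mu]_(x in D) complex.Im (f x)).

Definition kronecker_prime (p : nat) (a : int) : int :=
  if p == 2%N then
    if (2 %| a)%Z then 0
    else if ((a %% 8)%Z == 1) || ((a %% 8)%Z == 7) then 1 else -1
  else
    if (p %| a)%Z then 0
    else if [exists x : 'I_p, ((x%:Z ^+ 2)%R == a %[mod p])%Z] then 1 else -1.

Definition kronecker (a n : int) : int :=
  if n == 0 then (`|a|%N == 1%N)%:Z
  else (if (n < 0) && (a < 0) then -1 else 1) *
       \prod_(pe <- prime_decomp `|n|%N) kronecker_prime pe.1 a ^+ pe.2.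

(* Meaningful for odd d. *)
Definition eps {R : realType} (d : nat) : R[i] :=
  if (d %% 4 == 1)%N then 1 else 0 +i* 1.

(* [kloosterman kappa n c] is K_kappa(n; 4c). *)
Definition kloosterman {R : realType} (kappa n : int) (c : nat) : R[i] :=
  \sum_(d < 4 * c | odd d)
     eps d ^ (- kappa) * (kronecker (4 * c)%N d)%:~R *
     e2pi (n%:~R * d%:R / (4 * c)%:R : R).

Definition mx3 {R : realType} (s : seq (seq R)) : 'M[R]_3 :=
  \matrix_(i, j) nth 0 (nth [::] s i) j.

Definition nmx {R : realType} (x y z : R) : 'M[R]_3 :=
  mx3 [:: [:: 1; x; z]; [:: 0; 1; y]; [:: 0; 0; 1]].
Definition tmx {R : realType} (a b c : R) : 'M[R]_3 :=
  mx3 [:: [:: a; 0; 0]; [:: 0; b; 0]; [:: 0; 0; c]].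
Definition walpha1 {R : realType} : 'M[R]_3 :=
  mx3 [:: [:: 0; -1; 0]; [:: 1; 0; 0]; [:: 0; 0; 1]].
Definition walpha2 {R : realType} : 'M[R]_3 :=
  mx3 [:: [:: 1; 0; 0]; [:: 0; 0; -1]; [:: 0; 1; 0]].
Definition wlmx {R : realType} : 'M[R]_3 := walpha1 *m walpha2 *m walpha1.
Definition wmx {R : realType} : 'M[R]_3 :=
  mx3 [:: [:: 0; 0; -1]; [:: -1; 0; 0]; [:: 0; 1; 0]].

Lemma det_mx3 (R : comNzRingType) (A : 'M[R]_3) :
  \det A = A 0 0 * (A 1 1 * A 2 2 - A 1 2 * A 2 1)
         - A 0 1 * (A 1 0 * A 2 2 - A 1 2 * A 2 0)
         + A 0 2 * (A 1 0 * A 2 1 - A 1 1 * A 2 0).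
Proof.
rewrite (expand_det_row _ 0) !big_ord_recl big_ord0 /cofactor.
rewrite !(expand_det_row _ ord0) !big_ord_recl !big_ord0 /cofactor.
rewrite !det_mx11 !mxE.
pose f (p q : nat) := A (inord p) (inord q).
have E i j : A i j = f i j by rewrite /f !inord_val.
rewrite !E /= /bump /= ?(addn0, add0n, addn1, add1n).
ring.
Qed.

Definition SL3 (R : realType) := {g : 'M[R]_3 | \det g == 1}.

Lemma SL3_det (R : realType) (g : SL3 R) : \det (val g) = 1.
Proof. exact/eqP/(valP g). Qed.

Lemma sl_mul_subproof (R : realType) (g h : SL3 R) :
  \det (val g *m val h) == 1.
Proof. by rewrite det_mulmx !SL3_det mulr1. Qed.

Lemma sl_inv_subproof (R : realType) (g : SL3 R) : \det (invmx (val g)) == 1.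
Proof. by rewrite det_inv SL3_det invr1. Qed.

Lemma nSL_subproof (R : realType) (x y z : R) : \det (nmx x y z) == 1.
Proof. by apply/eqP; rewrite det_mx3 !mxE /=; ring. Qed.

Lemma wlSL_subproof (R : realType) : \det (wlmx : 'M[R]_3) == 1.
Proof. by apply/eqP; rewrite !det_mulmx !det_mx3 !mxE /=; ring. Qed.

Lemma wSL_subproof (R : realType) : \det (wmx : 'M[R]_3) == 1.
Proof. by apply/eqP; rewrite det_mx3 !mxE /=; ring. Qed.

Lemma aSL_subproof (R : realType) (s t : R) :
  \det (tmx (expR s) (expR t) (expR (- s - t))) == 1.
Proof.
apply/eqP; rewrite det_mx3 !mxE /= !(mulr0, mul0r, subr0, addr0).
by rewrite -!expRD -[RHS]expR0; congr expR; ring.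
Qed.

Definition sl_mul {R : realType} (g h : SL3 R) : SL3 R :=
  Sub (val g *m val h) (sl_mul_subproof g h).
Definition sl_inv {R : realType} (g : SL3 R) : SL3 R :=
  Sub (invmx (val g)) (sl_inv_subproof g).
Definition nSL {R : realType} (x y z : R) : SL3 R :=
  Sub (nmx x y z) (nSL_subproof x y z).
Definition aSL {R : realType} (s t : R) : SL3 R :=
  Sub (tmx (expR s) (expR t) (expR (- s - t))) (aSL_subproof s t).
Definition wlSL {R : realType} : SL3 R := Sub wlmx (wlSL_subproof R).
Definition wSL {R : realType} : SL3 R := Sub wmx (wSL_subproof R).

Definition unip {R : realType} : set 'M[R]_3 :=
  [set g | exists x y z, g = nmx x y z].
Definition upper {R : realType} : set 'M[R]_3 :=
  [set g | forall i j : 'I_3, (j < i)%N -> g i j = 0].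

(* Plucker coordinates (A1', B1', C1', A2', B2', C2'). *)
Definition plA1 {R : realType} (g : 'M[R]_3) : R := - g 2 0.
Definition plB1 {R : realType} (g : 'M[R]_3) : R := - g 2 1.
Definition plC1 {R : realType} (g : 'M[R]_3) : R := - g 2 2.
Definition plA2 {R : realType} (g : 'M[R]_3) : R :=
  - (g 1 0 * g 2 1 - g 1 1 * g 2 0).
Definition plB2 {R : realType} (g : 'M[R]_3) : R :=
  g 1 0 * g 2 2 - g 1 2 * g 2 0.
Definition plC2 {R : realType} (g : 'M[R]_3) : R :=
  - (g 1 1 * g 2 2 - g 1 2 * g 2 1).

(* Throughout, the sign group {1, -1} is encoded as bool under addb, with
   [true] standing for -1. *)

Definition hilbert {R : realType} (x y : R) : bool := (x < 0) && (y < 0).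

Definition first_nonzero {R : realType} (s : seq R) : R :=
  head 0 [seq x <- s | x != 0].

Definition Delta {R : realType} (g : 'M[R]_3) : 'M[R]_3 :=
  let X1 := \det g in
  let X2 := first_nonzero [:: - plA2 g; plB2 g; - plC2 g] in
  let X3 := first_nonzero [:: - plA1 g; - plB1 g; - plC1 g] in
  tmx (X1 / X2) (X2 / X3) X3.

Definition sigma_diag {R : realType} (a b : 'M[R]_3) : bool :=
  hilbert (a 0 0) (b 1 1) (+) hilbert (a 0 0) (b 2 2) (+)
  hilbert (a 1 1) (b 2 2).

Definition sigma_simple {R : realType} (w h : 'M[R]_3) : bool :=
  sigma_diag (Delta (w *m h) *m Delta h) (- Delta h).

Definition wprod {R : realType} (ws : seq 'M[R]_3) : 'M[R]_3 :=
  foldr mulmx 1%:M ws.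

(* sigma (w1, w2 .. wk h) sigma (w2, w3 .. wk h) .. sigma (wk, h). *)
Fixpoint sigma_word {R : realType} (ws : seq 'M[R]_3) (h : 'M[R]_3) : bool :=
  match ws with
  | [::] => false
  | w :: ws' => sigma_simple w (wprod ws' *m h) (+) sigma_word ws' h
  end.

(* One reduced word for each of the six Weyl group elements; the other reduced
   word walpha2 walpha1 walpha2 of wl leads to the same cocycle. *)
Definition reduced_words {R : realType} : seq (seq 'M[R]_3) :=
  [:: [::]; [:: walpha1]; [:: walpha2]; [:: walpha1; walpha2];
      [:: walpha2; walpha1]; [:: walpha1; walpha2; walpha1]].

(* Bruhat decompositions g = n a w n', with n' normalised to lie in
   N `&` w^-1 N_- w, so that (a, w, n') is unique. *)
Definition bruhat {R : realType} (g : 'M[R]_3) :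
    set ('M[R]_3 * seq 'M[R]_3 * 'M[R]_3) :=
  [set d | let: (a, ws, n') := d in
     [/\ is_diag_mx a, ws \in reduced_words, unip n',
         is_trig_mx (wprod ws *m n' *m invmx (wprod ws)) &
         exists2 n, unip n & g = n *m a *m wprod ws *m n']].

Definition sigma {R : realType} (g1 g2 : 'M[R]_3) : bool :=
  let: (a, ws, n') := xget (1%:M, [::], 1%:M) (bruhat g1) in
  sigma_diag a (Delta (wprod ws *m n' *m g2)) (+) sigma_word ws (n' *m g2).

Definition Gt (R : realType) := (SL3 R * bool)%type.

Definition gmul {R : realType} (p q : Gt R) : Gt R :=
  (sl_mul p.1 q.1, p.2 (+) q.2 (+) sigma (val p.1) (val q.1)).

Definition ginv {R : realType} (p : Gt R) : Gt R :=
  (sl_inv p.1, p.2 (+) sigma (val p.1) (val (sl_inv p.1))).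

Notation "p *t q" := (gmul p q) (at level 40, left associativity).

Definition nt {R : realType} (x y z : R) : Gt R := (nSL x y z, false).
Definition wl {R : realType} : Gt R := (wlSL, false).
Definition wt {R : realType} : Gt R := (wSL, false).
Definition nminus {R : realType} (x y z : R) : Gt R :=
  ginv wl *t nt x y z *t wl.

Definition Mt {R : realType} : set (Gt R) :=
  [set m | exists e1 e2 : R,
     [/\ e1 \in [:: 1; -1], e2 \in [:: 1; -1] &
         val m.1 = tmx e1 e2 (e1 * e2)]].

Definition At {R : realType} : set (Gt R) :=
  [set a | a.2 = false /\ exists a1 a2 a3 : R,
     [/\ 0 < a1, 0 < a2, 0 < a3 & val a.1 = tmx a1 a2 a3]].

Definition vfun (R : realType) := Gt R -> 'cV[R[i]]_2.

Definition pderiv {R : realType} {n : nat} (s : seq 'I_n.+1)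
    (F : 'rV[R]_n.+1 -> R) : 'rV[R]_n.+1 -> R :=
  foldr (fun i H x => 'D_(delta_mx 0 i) H x) F s.

Definition smooth {R : realType} {n : nat} (F : 'rV[R]_n.+1 -> R) : Prop :=
  forall s : seq 'I_n.+1, continuous (pderiv s F) /\
    forall i x, derivable (pderiv s F) x (delta_mx 0 i).

(* N, A and N_- lift to closed Lie subgroups of the double cover, and
   multiplication N x A x N_- -> Gt followed by left translation by g is a
   diffeomorphism onto an open neighbourhood of g.  These charts define the
   manifold structure of Gt (which is not the product structure on
   SL3 x {1, -1}, sigma being discontinuous). *)
Definition chart {R : realType} (g : Gt R) (u : 'rV[R]_8) : Gt R :=
  let c k := u 0 (inord k) in
  g *t nt (c 0%N) (c 1%N) (c 2%N) *t (aSL (c 3%N) (c 4%N), false)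
    *t nminus (c 5%N) (c 6%N) (c 7%N).

Definition re_chart {R : realType} (f : vfun R) (g : Gt R) (j : 'I_2)
    (u : 'rV[R]_8) : R := complex.Re (f (chart g u) j 0).
Definition im_chart {R : realType} (f : vfun R) (g : Gt R) (j : 'I_2)
    (u : 'rV[R]_8) : R := complex.Im (f (chart g u) j 0).

Definition smooth_Gt {R : realType} (f : vfun R) : Prop :=
  forall g j, smooth (re_chart f g j) /\ smooth (im_chart f g j).

(* All derivatives of f of order at most k are bounded by b on the compact set
   of those g whose matrix entries are at most r in absolute value; these
   bounds give the usual Frechet topology of smooth functions. *)
Definition seminorm_le {R : realType} (r : R) (k : nat) (f : vfun R)
    (b : R) : Prop :=
  forall g : Gt R, (forall i j, `|val g.1 i j| <= r) ->
  forall j (s : seq 'I_8), (size s <= k)%N ->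
    `|pderiv s (re_chart f g j) 0| <= b /\ `|pderiv s (im_chart f g j) 0| <= b.

(* A representation of Mt is given by a function on Gt of which only the
   values on Mt matter. *)
Definition mrep (R : realType) := Gt R -> 'M[R[i]]_2.

(* On Mt, the diagonal entry e_i = 1 or -1 gives (1 - e_i) / 2 = (e_i < 0). *)
Definition phi {R : realType} : mrep R := fun m =>
  let J : 'M[R[i]]_2 :=
    \matrix_(i, j) nth 0 (nth [::] [:: [:: 0; -1]; [:: 1; 0]] i) j in
  let D : 'M[R[i]]_2 :=
    \matrix_(i, j)
      nth 0 (nth [::] [:: [:: - (0 +i* 1); 0]; [:: 0; 0 +i* 1]] i) j in
  (-1) ^+ m.2 *: (J ^+ (val m.1 0 0 < 0)%R *m D ^+ (val m.1 1 1 < 0)%R).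

Definition contragredient {R : realType} (eta : mrep R) : mrep R :=
  fun m => (invmx (eta m))^T.

Definition rho {R : realType} : 'rV[R[i]]_3 :=
  \row_i nth 0 [:: 1; 0; -1] i.

Definition Vsmooth {R : realType} (mu : 'rV[R[i]]_3) (eta : mrep R) :
    set (vfun R) :=
  [set f | smooth_Gt f /\
     forall g m a x y z, Mt m -> At a ->
       f (g *t m *t a *t nminus x y z) =
       (\prod_(i < 3) cpow (val a.1 i i) (- (mu 0 i - rho 0 i))) *:
       (eta (ginv m) *m f g)].

Definition smooth_pairing {R : realType} (f h : vfun R) : R[i] :=
  cintegral ((lebesgue_measure \x lebesgue_measure) \x lebesgue_measure)%E
    [set: R * R * R]
    (fun v => let g := wl *t nt v.1.1 v.1.2 v.2 in
              f g 0 0 * h g 0 0 + f g 1 0 * h g 1 0).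

(* Distribution vectors.  V^-oo_(mu,eta) is the space of distributional
   sections of a vector bundle on the compact manifold Gt / Mt A N_-, i.e. of
   continuous linear functionals on the smooth sections V^oo of the dual
   bundle twisted by densities.  That bundle is the one of parameters
   (-mu, transpose of eta^-1), by means of the invariant pairing:
   a smooth h in V^oo_(mu,eta) is the functional [fun f => smooth_pairing f h].
   A functional is applied to arbitrary functions on Gt, but only its values on
   Vsmooth (- mu) (contragredient eta) are meaningful. *)
Definition dvec (R : realType) := vfun R -> R[i].

Definition Vdist {R : realType} (mu : 'rV[R[i]]_3) (eta : mrep R) :
    set (dvec R) :=
  let V := Vsmooth (- mu) (contragredient eta) in
  [set T | (forall (a : R[i]) (f h : vfun R), V f -> V h ->
              T (fun g => a *: f g + h g) = a * T f + T h) /\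
     exists (r : R) (k : nat) (C : R), forall f b, V f ->
       seminorm_le r k f b -> Normc.normc (T f) <= C * b].

Definition pairing {R : realType} (f : vfun R) (T : dvec R) : R[i] := T f.

Definition pi_fun {R : realType} (h : Gt R) (f : vfun R) : vfun R :=
  fun g => f (ginv h *t g).

(* The extension of pi_fun to distribution vectors for which the pairing is
   invariant. *)
Definition pi_dist {R : realType} (h : Gt R) (T : dvec R) : dvec R :=
  fun f => T (pi_fun (ginv h) f).

(* The distribution vector with restriction (delta_0, 0) to wl N. *)
Definition tau {R : realType} : dvec R := fun f => f wl 0 0.

(* The element of Vdist mu eta which is the (weakly absolutely convergent) sum
   of the F x for x in D; 0 if there is none. *)
Definition dist_sum {R : realType} {I : choiceType} (mu : 'rV[R[i]]_3)
    (eta : mrep R) (D : set I) (F : I -> dvec R) : dvec R :=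
  xget (fun=> 0) [set T | Vdist mu eta T /\
    forall f, Vsmooth (- mu) (contragredient eta) f ->
      csummable D (fun x => pairing f (F x)) /\
      pairing f T = csum D (fun x => pairing f (F x))].

(* [0,1[ ^ 3 is a strict fundamental domain for the left action of Gamma_oo
   on N, n(a,b,c) n(x,y,z) = n(a + x, b + y, c + z + a y). *)
Definition unit_cube {R : realType} : set (R * R * R) :=
  [set v | [/\ 0 <= v.1.1 < 1, 0 <= v.1.2 < 1 & 0 <= v.2 < 1]].

(* The element of Vdist mu eta which is the weak integral over Gamma_oo \ N of
   the left Gamma_oo-invariant function F on N; 0 if there is none. *)
Definition dist_integral {R : realType} (mu : 'rV[R[i]]_3) (eta : mrep R)
    (F : SL3 R -> dvec R) : dvec R :=
  let dn := ((lebesgue_measure \x lebesgue_measure) \x lebesgue_measure)%E in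
  let Ff f (v : R * R * R) := pairing f (F (nSL v.1.1 v.1.2 v.2)) in
  xget (fun=> 0) [set T | Vdist mu eta T /\
    forall f, Vsmooth (- mu) (contragredient eta) f ->
      cintegrable dn unit_cube (Ff f) /\
      pairing f T = cintegral dn unit_cube (Ff f)].

Definition Gamma {R : realType} : set (SL3 R) :=
  [set g | exists A : 'M[int]_3, val g = map_mx intr A /\
     forall i j : 'I_3, (j <= i)%N -> (A i j = (i == j)%:Z %[mod 4])%Z].

Definition Gamma_oo {R : realType} : set (SL3 R) :=
  [set g | unip (val g) /\ exists A : 'M[int]_3, val g = map_mx intr A].

Definition cell2 {R : realType} : set (SL3 R) :=
  [set g | exists2 n, unip n &
           exists2 b, upper b & val g = n *m walpha2 *m b].

(* Miller's splitting on Gamma `&` cell2: the Plucker coordinates there are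
   (0, 4 B1, C1, 0, 0, -1) with B1, C1 integers, and s = (-B1 / -C1). *)
Definition splitting2 {R : realType} (g : SL3 R) : Gt R :=
  (g, kronecker (- Num.floor (plB1 (val g) / 4)) (- Num.floor (plC1 (val g)))
      == -1).

Definition cosets2 {R : realType} : set (set (SL3 R)) :=
  [set [set sl_mul u g | u in Gamma_oo] | g in Gamma `&` cell2].

Definition Eisenstein2 {R : realType} (lambda : 'rV[R[i]]_3) : dvec R :=
  dist_sum lambda phi cosets2
    (fun X => pi_dist (ginv (splitting2 (xget (nSL 0 0 0) X))) tau).

(* A character of N, read off the matrix entries. *)
Definition psi {R : realType} (m1 m2 : int) (n : SL3 R) : R[i] :=
  e2pi (m1%:~R * val n 0 1 + m2%:~R * val n 1 2).

Definition whittaker2 {R : realType} (lambda : 'rV[R[i]]_3) (m1 m2 : int) :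
    dvec R :=
  dist_integral lambda phi (fun n f =>
    psi m1 m2 n * pi_dist (ginv (n, false)) (Eisenstein2 lambda) f).

(* Main.v *)
(* Modulo Gamma_oo an element of the cell is determined by its bottom row, that
   is by a pair (B, j) with B > 0, j odd and prime to B: the row (0, -4B, j) if
   j = 1 mod 4 and (0, 4B, -j) if j = 3 mod 4.  Writing gamma^-1 wl in
   N w M A N_- and tracking the cocycle, the term of gamma, tested on f
   translated by n(x,y,z), is (4B)^(-1-lambda_1+lambda_2) (B/|j|) times a
   component of f(n(0, j/4B - y, 0) w), the first or the second according to
   j mod 4.  By homogeneity f(n(0,t,0) w) decays like t^-4, so the sum may be
   integrated over the unit cube term by term.  The x-integral vanishes unless
   m1 = 0.  Since (B/|j|) depends only on j mod 4B, the sum over each residue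
   class d mod 4B unfolds the y-integral to the real line and produces
   e(m2 d/4B) times a Fourier coefficient of f; the classes d = 1 and d = 3
   mod 4 assemble to (K_1 + K_-1)/2 and (K_1 - K_-1)/2. *)

Require Import Defs.
From HB Require Import structures.
From mathcomp Require Import all_boot all_order all_algebra.
From mathcomp Require Import all_classical all_reals all_analysis.
From mathcomp Require Import measurable_realfun.
From mathcomp Require Import complex zify ring lra.

Set Implicit Arguments.
Unset Strict Implicit.
Unset Printing Implicit Defensive.

Import Order.TTheory GRing.Theory Num.Theory.
Import numFieldNormedType.Exports.

(** [dist_sum] and [dist_integral] return 0 unless a distribution vector with the required values
    exists, so such vectors must be exhibited, with linearity and an explicit continuity constant.
    Hence bounds on f come in two kinds: linear in a seminorm of order 0, for continuity, and by
    compactness, for one given f. The threshold 3 makes Re(-1 - lambda_1 + lambda_2) <= -4. This one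
    inequality gives both the factor (4B)^-4 and the decay t^-4, and their product is dominated on
    the unit cube by a multiple of 1/(B j)^2, which is summable over all pairs. The symbol (B/|j|)
    must be periodic in j for every B, even or odd, and also where j changes sign; a lattice point
    count yields all cases at once. The signs become finite Boolean computations because on matrices
    of determinant 1 the cocycle sees only the two sign bits [s2] and [s3] of its right argument and
    of Weyl and unipotent translates of it. *)

Section Schering.

(** * Jacobi symbols by Schering's lemma, and their period in the lower argument *)

Local Open Scope nat_scope.

Definition half_parity (n : nat) (P : pred nat) : bool :=
  \big[addb/false]_(1 <= x < n./2.+1) P x.

(** Booleans stand for signs: this is chi(-x) = -chi(x) on nonzero residues. *)
Definition odd_mod (n : nat) (chi : pred nat) : Prop :=
  forall x, 0 < x < n -> chi (n - x) = ~~ chi x.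

Definition even_mod (n : nat) (P : pred nat) : Prop :=
  forall x, 0 < x < n -> P (n - x) = P x.

Definition upper_half (n : nat) : pred nat := fun x => n./2 < x.

Definition schering_with (chi : pred nat) (a n : nat) : bool :=
  half_parity n (fun x => chi (a * x %% n) (+) chi x).

(* Schering's form of Gauss' lemma: (-1) to this parity is the Jacobi symbol
   (a/n), also for composite n.  It yields the periodicity in n directly,
   without quadratic reciprocity. *)
Definition schering (a n : nat) : bool := schering_with (upper_half n) a n.

Lemma odd_bigD (I : Type) (r : seq I) (P : pred I) (F : I -> nat) :
  odd (\sum_(i <- r | P i) F i) = \big[addb/false]_(i <- r | P i) odd (F i).
Proof. exact: (big_morph odd oddD (erefl _)). Qed.

Lemma half_parityE n (P : pred nat) :
  half_parity n P = odd (\sum_(1 <= x < n./2.+1) P x).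
Proof. by rewrite odd_bigD; apply: eq_bigr => x _; rewrite oddb. Qed.

Lemma eq_half_parity n (P Q : pred nat) :
  (forall x, 0 < x <= n./2 -> P x = Q x) -> half_parity n P = half_parity n Q.
Proof. by move=> PQ; apply: eq_big_nat => x; rewrite ltnS; exact: PQ. Qed.

Lemma half_parityD n (P Q : pred nat) :
  half_parity n (fun x => P x (+) Q x) = half_parity n P (+) half_parity n Q.
Proof. exact: big_split. Qed.

Lemma even_mod_sum n (P : pred nat) : odd n -> even_mod n P ->
  \sum_(1 <= x < n) P x = (\sum_(1 <= x < n./2.+1) P x).*2.
Proof.
move=> on eP; have nE : n = (n./2).*2.+1 by lia.
rewrite (@big_cat_nat _ _ _ n./2.+1) //=; [|lia..].
rewrite -addnn; congr (_ + _).
rewrite big_nat_rev /=.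
rewrite (_ : n./2.+1 = n./2 + 1) ?addn1 //.
have -> : \sum_(n./2.+1 <= i < n) P (n./2.+1 + n - i.+1)
        = \sum_(1 + n./2 <= i < n./2.+1 + n./2) P (n./2.+1 + n - i.+1).
  by apply: congr_big => //; congr index_iota; lia.
rewrite big_addn addnK; apply: eq_big_nat => x xn.
by rewrite (_ : n./2.+1 + n - (x + n./2).+1 = n - x) ?eP //; lia.
Qed.

Lemma coprime_sum n a (P : pred nat) : 0 < n -> coprime a n ->
  \sum_(1 <= x < n) P (a * x %% n) = \sum_(1 <= x < n) P x.
Proof.
move=> n0 co.
suff : \sum_(0 <= x < n) P (a * x %% n) = \sum_(0 <= x < n) P x.
  by rewrite !(@big_ltn _ _ _ 0 n) // muln0 mod0n => /addnI.
rewrite !big_mkord.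
pose s (x : 'I_n) : 'I_n := Ordinal (ltn_pmod (a * x) n0).
have sI : injective s.
  move=> x y /(congr1 val) /= /eqP; rewrite -/(_ == _ %[mod n]) => xy.
  apply: val_inj => /=.
  wlog le : x y xy / x <= y => [H|].
    by case/orP: (leq_total x y) => le; [|symmetry]; apply: H => //; rewrite eq_sym.
  move: xy; rewrite eq_sym eqn_mod_dvd ?leq_mul2l ?le ?orbT // -mulnBr.
  rewrite Gauss_dvdr 1?coprime_sym // => /dvdn_leq; move: (ltn_ord y) => /=; lia.
by rewrite [RHS](reindex_inj sI).
Qed.

Lemma modn_comp n a x : 0 < x < n -> coprime a n ->
  a * (n - x) %% n = n - a * x %% n /\ 0 < a * x %% n < n.
Proof.
move=> xn co; have n0 : 0 < n by lia.
have r0 : 0 < a * x %% n.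
  rewrite lt0n; apply/negP; rewrite -/(dvdn _ _) Gauss_dvdr 1?coprime_sym //.
  by move/dvdn_leq; lia.
have rn : a * x %% n < n by rewrite ltn_mod.
split; last by rewrite r0.
rewrite mulnBr; apply/eqP.
rewrite -[X in _ == X](modn_small (m := n - _) (d := n)); last by lia.
have : a * x <= a * n by rewrite leq_mul2l; lia.
move=> le; rewrite -(eqn_modDr (a * x)) subnK //.
by rewrite modnMl -modnDmr subnK ?modnn // ltnW.
Qed.

Lemma even_mod_comp n a (P : pred nat) : coprime a n -> even_mod n P ->
  even_mod n (fun x => P (a * x %% n)).
Proof.
by move=> co eP x xn; have [-> r] := modn_comp xn co; rewrite eP.
Qed.

(** The count of an even predicate over a half system is half its count over all nonzero residues,
    and multiplication by a unit permutes the latter. *)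
Lemma half_parity_comp n a (P : pred nat) : odd n -> coprime a n ->
  even_mod n P -> half_parity n (fun x => P (a * x %% n)) = half_parity n P.
Proof.
move=> on co eP; rewrite !half_parityE; congr odd; apply: double_inj.
rewrite -!even_mod_sum //; last exact: even_mod_comp.
by apply: coprime_sum => //; lia.
Qed.

Lemma odd_upper_half n : odd n -> odd_mod n (upper_half n).
Proof. move=> on x xn; rewrite /upper_half; lia. Qed.

Lemma odd_mod_comp n a chi : coprime a n -> odd_mod n chi ->
  odd_mod n (fun x => chi (a * x %% n)).
Proof. by move=> co eP x xn; have [-> r] := modn_comp xn co; rewrite eP. Qed.

Lemma odd_modD n chi chi' : odd_mod n chi -> odd_mod n chi' ->
  even_mod n (fun x => chi x (+) chi' x).
Proof.
by move=> h h' x xn; rewrite h // h' //; case: (chi x); case: (chi' x).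
Qed.

(** Two odd sign functions differ by an even one, psi, and the parities differ by that of psi(a x)
    psi(x), which is trivial by [half_parity_comp]. The freedom in [chi] is what makes
    multiplicativity in n accessible. *)
Lemma schering_withE n a chi : odd n -> coprime a n -> odd_mod n chi ->
  schering_with chi a n = schering a n.
Proof.
move=> on co oc.
have ou := odd_upper_half on.
have := half_parity_comp on co (odd_modD oc ou).
rewrite /schering /schering_with !half_parityD.
by do 4 case: (half_parity _ _).
Qed.

Lemma coprime_dvdMn m a x : coprime a m -> (m %| a * x) = (m %| x).
Proof. by move=> co; rewrite Gauss_dvdr // coprime_sym. Qed.

Lemma modn_dvdm_mul m n x : x %% (m * n) %% m = x %% m.
Proof. by rewrite modn_dvdm // dvdn_mulr. Qed.

(* With this sign function in place of upper_half (m * n), the parity count for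
   m * n splits along blocks of length m. *)
Definition half_product (m n : nat) : pred nat :=
  fun x => if m %| x then upper_half n (x %/ m) else upper_half m (x %% m).

Lemma odd_half_product m n : odd m -> odd n ->
  odd_mod (m * n) (half_product m n).
Proof.
move=> om on x /andP[x0 xmn]; rewrite /half_product.
have m0 : 0 < m by lia.
rewrite dvdn_subr ?dvdn_mulr 1?ltnW //.
case: ifP => dx.
  have [y xE] := dvdnP dx; move: x0 xmn; rewrite xE mulnC -mulnBr !mulKn //.
  rewrite ltn_pmul2l // => y0 yn; apply: odd_upper_half => //.
  by rewrite yn andbT; lia.
have r0 : 0 < x %% m by rewrite lt0n; apply/negbT.
have rm : x %% m < m by rewrite ltn_mod.
rewrite -odd_upper_half // ?r0 //; congr (upper_half m _).
apply/eqP; rewrite -[X in _ == X](modn_small (m := m - _) (d := m)); last by lia.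
rewrite -(eqn_modDr x) subnK 1?ltnW // modnMr.
by rewrite -modnDmr subnK ?modnn // ltnW.
Qed.

(** Over a full period, the multiples of m reproduce the count for n, and in each of the n blocks of
    length m the other residues reproduce the count for m. All three predicates are even, so the
    identity may be halved, and n is odd. *)
Lemma scheringM m n a : odd m -> odd n -> coprime a (m * n) ->
  schering a (m * n) = schering a m (+) schering a n.
Proof.
move=> om on; rewrite coprimeMr => /andP[com con].
have omn : odd (m * n) by rewrite oddM om.
have comn : coprime a (m * n) by rewrite coprimeMr com.
have m0 : 0 < m by lia.
have n0 : 0 < n by lia.
pose P := fun x => half_product m n (a * x %% (m * n)) (+) half_product m n x.
pose Pm := fun x => upper_half m (a * x %% m) (+) upper_half m x.
pose Pn := fun x => upper_half n (a * x %% n) (+) upper_half n x.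
have eP : even_mod (m * n) P.
  by apply: odd_modD; [apply: odd_mod_comp => //|]; exact: odd_half_product.
have ePm : even_mod m Pm.
  by apply: odd_modD; [apply: odd_mod_comp => //|]; exact: odd_upper_half.
have ePn : even_mod n Pn.
  by apply: odd_modD; [apply: odd_mod_comp => //|]; exact: odd_upper_half.
rewrite -(schering_withE omn comn (odd_half_product om on)).
rewrite /schering /schering_with -/P -/Pm -/Pn !half_parityE.
(* On a multiple of m only the quotient matters, elsewhere only the residue. *)
have PE q r : r < m -> P (q * m + r) = if r == 0 then Pn q else Pm r.
  move=> rm; rewrite /P /half_product.
  rewrite /dvdn modn_dvdm_mul -/(dvdn _ _) coprime_dvdMn //.
  rewrite dvdn_addr ?dvdn_mull // -(modnMmr a _ m) modnMDl (modn_small rm).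
  case: (posnP r) => [->|r0].
    by rewrite dvdn0 addn0 mulnA (mulnC m) -muln_modl !mulnK.
  by rewrite gtnNdvd // eqn0Ngt r0.
have := even_mod_sum omn eP.
have E : \sum_(1 <= x < m * n) P x =
   \sum_(1 <= x < n) Pn x + n * \sum_(1 <= x < m) Pm x.
  have P00 : P 0 = false by rewrite (PE 0 0 m0) /= /Pn muln0 mod0n addbb.
  have Pn00 : Pn 0 = false by rewrite /Pn muln0 mod0n addbb.
  transitivity (\sum_(0 <= x < m * n) P x).
    by rewrite [RHS]big_ltn ?muln_gt0 ?m0 // P00.
  rewrite mulnC big_nat_mul.
  transitivity (\sum_(0 <= q < n) (Pn q + \sum_(1 <= x < m) Pm x)); last first.
    rewrite big_split /= sum_nat_const_nat subn0; congr (_ + _).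
    by rewrite big_ltn // Pn00.
  apply: eq_big_nat => q _.
  rewrite mulSn -{1}(add0n (q * m)) big_addn addnK big_ltn //.
  congr (_ + _); first by rewrite add0n -(addn0 (q * m)) PE.
  by apply: eq_big_nat => r /andP[r0 rm]; rewrite addnC PE // eqn0Ngt r0.
rewrite E (even_mod_sum on ePn) (even_mod_sum om ePm).
set A := \sum_(_ <= _ < _./2.+1) _; set B := \sum_(_ <= _ < _./2.+1) _.
set C := \sum_(_ <= _ < _./2.+1) _ => H.
have -> : C = A + n * B by lia.
by rewrite oddD oddM on addbC.
Qed.

(** chi(a b x) chi(x) is the product of chi(a b x) chi(b x) and chi(b x) chi(x); the first factor is
    an even function evaluated at b x. *)
Lemma schering_mul n a b : odd n -> coprime a n -> coprime b n ->
  schering (a * b) n = schering a n (+) schering b n.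
Proof.
move=> on co cob; have n0 : 0 < n by lia.
have ou := odd_upper_half on.
have H : even_mod n (fun x => upper_half n (a * x %% n) (+) upper_half n x).
  by apply: odd_modD => //; exact: odd_mod_comp.
rewrite /schering /schering_with -(half_parity_comp on cob H) -half_parityD.
apply: eq_half_parity => x _; rewrite modnMmr mulnA.
by case: (upper_half _ _); case: (upper_half _ _); case: (upper_half _ _).
Qed.

Lemma eq_schering n a b : a = b %[mod n] -> schering a n = schering b n.
Proof.
by move=> ab; apply: eq_half_parity => x _; rewrite -modnMml ab modnMml.
Qed.

Lemma schering_sqr n a : odd n -> coprime a n -> schering (a * a) n = false.
Proof. by move=> on co; rewrite schering_mul // addbb. Qed.

(** n - 1 acts as -1, sending every x <= n/2 to the upper half: the first supplementary law. *)
Lemma schering_pred n : odd n -> schering n.-1 n = odd n./2.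
Proof.
move=> on; rewrite /schering /schering_with.
rewrite (@eq_half_parity _ _ (fun=> true)) => [|x xn].
  by rewrite half_parityE sum_nat_const_nat subn1 muln1.
have -> : (n.-1 * x) %% n = n - x.
  have -> : n.-1 * x = x.-1 * n + (n - x) by nia.
  by rewrite modnMDl modn_small //; lia.
rewrite /upper_half; lia.
Qed.

(* Eisenstein's double count of the lattice points (x, t) with t n <= 2 a x. *)
Lemma scheringE n a : odd n -> 0 < a -> coprime a n ->
  schering a n =
  odd (a.-1 * n./2 + \sum_(1 <= t < a) (t * n - 1) %/ (2 * a)).
Proof.
move=> on a0 co; have n0 : 0 < n by lia.
transitivity (odd (\sum_(1 <= x < n./2.+1) (2 * a * x) %/ n)).
  rewrite odd_bigD; apply: eq_big_nat => x xn.
  rewrite /upper_half (_ : (n./2 < x) = false) ?addbF; last by lia.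
  (* The floor of 2 a x / n is odd exactly when the residue of a x exceeds n/2. *)
  have := divn_eq (a * x) n; have := ltn_pmod (a * x) n0.
  set r := _ %% _; set q := _ %/ _ => rn E.
  have -> : 2 * a * x = q.*2 * n + r.*2 by rewrite -mulnA E -!mul2n; ring.
  rewrite divnMDl // oddD odd_double /=.
  case: (ltnP n./2 r) => h.
    rewrite (_ : r.*2 = 1 * n + (r.*2 - n)); last by lia.
    by rewrite divnMDl // divn_small //; lia.
  by rewrite divn_small //; lia.
set L := \sum_(_ <= _ < _) _; set N := \sum_(_ <= _ < _) _.
(* [L] counts the points of the rectangle 0 < t < a, 0 < x <= n/2 with t n <= 2 a x, and [N] the
   complementary ones; the -1 in [N] makes 2 a x < t n strict. *)
suff E : L + N = a.-1 * n./2 by rewrite -E oddD oddD addbK.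
have -> : L = \sum_(1 <= x < n./2.+1) \sum_(1 <= t < a) (t * n <= 2 * a * x).
  apply: eq_big_nat => x xn.
  have le : (2 * a * x) %/ n < a by rewrite ltn_divLR //; nia.
  rewrite (@big_cat_nat _ _ _ ((2 * a * x) %/ n).+1) //=.
  rewrite [X in _ + X]big1_seq ?addn0; last first.
    move=> t; rewrite mem_index_iota => /= /andP[h _]; apply/eqP; rewrite eqb0.
    by rewrite -ltnNge -ltn_divLR.
  rewrite (eq_big_nat _ _ (F2 := fun=> 1)) ?sum_nat_const_nat ?muln1 ?subn1 //.
  by move=> t ht; rewrite -leq_divRL // -ltnS; case/andP: ht => _ ->.
rewrite exchange_big /= -big_split /=.
rewrite (eq_big_nat _ _ (F2 := fun=> n./2)) ?sum_nat_const_nat ?subn1 //.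
move=> t /andP[t0 ta].
have hN : (t * n - 1) %/ (2 * a) <= n./2.
  by rewrite -ltnS ltn_divLR; [nia|lia].
rewrite (@big_cat_nat _ _ _ ((t * n - 1) %/ (2 * a)).+1) //=.
rewrite [X in X + _ + _]big1_seq ?add0n; last first.
  move=> x; rewrite mem_index_iota => /= /andP[x0 h]; apply/eqP; rewrite eqb0.
  move: h; rewrite ltnS leq_divRL; last by lia.
  nia.
rewrite (eq_big_nat _ _ (F2 := fun=> 1)); last first.
  move=> x /andP[h _]; move: h; rewrite ltn_divLR; last by lia.
  by move=> h; apply/eqP; rewrite eqb1; nia.
by rewrite sum_nat_const_nat muln1 subSS subnK.
Qed.

(** In [scheringE] the half of n moves by 2 a m and each floor by 2 t m, both even. *)
Lemma schering_period n a m : odd n -> 0 < a -> coprime a n ->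
  schering a (n + 4 * a * m) = schering a n.
Proof.
move=> on a0 co.
have co' : coprime a (n + 4 * a * m).
  by rewrite addnC (mulnC 4) -mulnA mulnC /coprime gcdnMDl.
rewrite !scheringE //; last by lia.
have -> : (n + 4 * a * m)./2 = n./2 + (a * m).*2 by lia.
rewrite mulnDr -addnA !oddD; congr (_ (+) _).
rewrite -doubleMr odd_double /= !odd_bigD; apply: eq_big_nat => t ta.
have -> : t * (n + 4 * a * m) - 1 = (t * m).*2 * (2 * a) + (t * n - 1).
  by rewrite addnBA; [congr (_ - 1); rewrite -!mul2n; ring|nia].
by rewrite divnMDl ?oddD ?odd_double //; lia.
Qed.

(** The two floors at t add up to 2 t m - 1, because 2 a does not divide t n, and the two halves add
    up to 2 a m - 1. The resulting two contributions of a - 1 cancel modulo 2. *)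
Lemma schering_reflect n a m : odd n -> 0 < a -> coprime a n -> n < 4 * a * m ->
  schering a (4 * a * m - n) = schering a n.
Proof.
move=> on a0 co nm.
set k := _ - n; have kE : k + n = 4 * a * m by rewrite subnK // ltnW.
have co' : coprime a k.
  rewrite /coprime -dvdn1 -(eqP co) dvdn_gcd dvdn_gcdl /=.
  have -> : n = 4 * a * m - k by rewrite -kE addKn.
  rewrite dvdn_sub ?dvdn_gcdr //.
  by rewrite (dvdn_trans (dvdn_gcdl _ _)) // dvdn_mulr // dvdn_mull.
have ok : odd k by move: kE; lia.
rewrite !scheringE //.
have hk : k./2 + n./2 + 1 = (a * m).*2 by move: kE; lia.
pose N n t := (t * n - 1) %/ (2 * a).
have hN t : 0 < t < a -> N k t + N n t + 1 = (t * m).*2.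
  move=> /andP[t0 ta]; rewrite /N.
  have a20 : 0 < 2 * a by lia.
  have n0 : 0 < n by lia.
  have := divn_eq (t * n) (2 * a); have := ltn_pmod (t * n) a20.
  have : 0 < (t * n) %% (2 * a).
    rewrite lt0n; apply/negP; rewrite -/(dvdn _ _) => d.
    have : a %| t * n by rewrite (dvdn_trans _ d) // dvdn_mull.
    by rewrite Gauss_dvdl // => /dvdn_leq; lia.
  set r := _ %% _; set q := _ %/ _ => r0 ra E.
  have qt : q < (t * m).*2.
    have : t * n < t * (4 * a * m) by rewrite ltn_pmul2l // -kE; lia.
    by nia.
  have -> : t * k - 1 = ((t * m).*2 - q.+1) * (2 * a) + (2 * a - r - 1).
    by move: kE => /(congr1 (muln t)); rewrite mulnDr E mulnBl; nia.
  have -> : t * n - 1 = q * (2 * a) + (r - 1) by rewrite E; lia.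
  by rewrite !divnMDl // !divn_small; lia.
have SN : \sum_(1 <= t < a) N k t + \sum_(1 <= t < a) N n t + a.-1 =
          (\sum_(1 <= t < a) t * m).*2.
  rewrite -(subn1 a) -[a - 1]muln1 -sum_nat_const_nat -!big_split /=.
  by rewrite -mul2n big_distrr; apply: eq_big_nat => t /hN ->; exact/esym/mul2n.
move: SN hk; rewrite -/(N k) -/(N n).
set X := \sum_(_ <= _ < _) _; set Y := \sum_(_ <= _ < _) _.
set Z := \sum_(_ <= _ < _) _ => SN hk.
suff : a.-1 * k./2 + X + (a.-1 * n./2 + Y) = (Z + a.-1 * (a * m)).*2 - a.-1.*2.
  by move=> H; lia.
by nia.
Qed.

Section prime.
Variables (p : nat) (pp : prime p) (op : odd p).

Let Fp_eq (x y : nat) : (x%:R == y%:R :> 'F_p)%R = (x == y %[mod p]).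
Proof.
have ch : p \in [pchar 'F_p]%R by rewrite pchar_Fp.
wlog le : x y / x <= y => [H|].
  by case/orP: (leq_total x y) => h; [|rewrite eq_sym [RHS]eq_sym]; apply: H.
by rewrite eq_sym [RHS]eq_sym eqn_mod_dvd // (dvdn_pcharf ch) natrB // subr_eq0.
Qed.

Let Fp_eq0 (x : nat) : (x%:R == 0 :> 'F_p)%R = (p %| x).
Proof. by rewrite -[0%R]/(0%:R)%R Fp_eq mod0n. Qed.

Let p2 : 2 < p.
Proof. by have := prime_gt1 pp; move: op; case: p => [|[|[|]]]. Qed.

Let fold_half x := if upper_half p x then p - x else x.

(** The absolutely least residues of a x permute the half system 1, ..., p/2 up to sign; comparing
    the products gives the power of a. *)
Lemma gauss_lemma a : coprime a p ->
  (a%:R ^+ p./2 = (-1) ^+ schering a p :> 'F_p)%R.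
Proof.
move=> co.
pose s := iota 1 p./2.
pose g x := fold_half (a * x %% p).
have hs x : x \in s -> 0 < x < p /\ x <= p./2 by rewrite mem_iota; lia.
have gs : {subset map g s <= s}.
  move=> _ /mapP[x /hs[xp _] ->]; rewrite mem_iota /g /fold_half.
  have [_ r] := modn_comp xp co; rewrite /upper_half; case: ifP; lia.
have gI : {in s &, injective g}.
  move=> x y /hs[xp x2] /hs[yp y2]; rewrite /g /fold_half.
  have [xn rx] := modn_comp xp co; have [yn ry] := modn_comp yp co.
  have aI u v : u < p -> v < p -> (a * u) %% p = (a * v) %% p -> u = v.
    move=> up vp /eqP; rewrite -Fp_eq !natrM => /eqP.
    have a0 : (a%:R != 0 :> 'F_p)%R by rewrite Fp_eq0 -prime_coprime // coprime_sym.
    by move/(mulfI a0)/eqP; rewrite Fp_eq !modn_small // => /eqP.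
  case: ifP => _; case: ifP => _ e.
  - by apply: aI; lia.
  - have : x = p - y; last by lia.
    apply: aI; [lia..|]; rewrite yn; lia.
  - have : x = p - y; last by lia.
    apply: aI; [lia..|]; rewrite yn; lia.
  - by apply: aI; lia.
have sg : perm_eq (map g s) s.
  have us : uniq (map g s) by rewrite map_inj_in_uniq ?iota_uniq.
  have [] := uniq_min_size us gs; first by rewrite size_map.
  by move=> _ e; apply: uniq_perm; rewrite ?iota_uniq.
have P0 : (\prod_(x <- s) x%:R != 0 :> 'F_p)%R.
  rewrite prodf_seq_neq0; apply/allP => x /hs[xp _] /=.
  by rewrite Fp_eq0 gtnNdvd //; lia.
apply: (mulIf P0).
transitivity (\prod_(x <- s) (a * x)%:R : 'F_p)%R.
  rewrite [RHS](eq_bigr (fun x => a%:R * x%:R)%R) => [|x _]; last by rewrite natrM.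
  by rewrite big_split /= big_const_seq /= count_predT size_iota iter_mulr_1.
rewrite -[X in _ = (_ * X)%R](perm_big _ sg) big_map /=.
have -> : ((-1) ^+ schering a p = \prod_(x <- s) (-1) ^+ upper_half p (a * x %% p)%N
           :> 'F_p)%R.
  rewrite /schering /schering_with (@eq_half_parity _ _
    (fun x => upper_half p (a * x %% p))) => [|x xp]; last first.
    by rewrite /upper_half (_ : (_ < x) = false) ?addbF //; lia.
  rewrite /half_parity /index_iota subn1 /=.
  rewrite -/s; move: (s) => s0.
  by elim: s0 => [|x s' IH]; rewrite ?big_nil // !big_cons signr_addb IH.
rewrite -big_split /= !big_seq; apply: eq_bigr => x /hs[xp _].
have [xn rx] := modn_comp xp co.
rewrite /g /fold_half; case: ifP => _; rewrite ?expr1 ?expr0 ?mul1r ?mulN1r.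
  apply/eqP; rewrite -addr_eq0 -natrD Fp_eq0 /dvdn -modnDml subnKC ?modnn //; lia.
by apply/eqP; rewrite Fp_eq modn_mod.
Qed.

(** If a non-square had sign +1, Gauss' lemma would make it a root of X^((p-1)/2) - 1 in addition to
    the (p-1)/2 nonzero squares. *)
Lemma kronecker_prime_schering a : coprime a p ->
  kronecker_prime p a = ((-1) ^+ schering a p)%R.
Proof.
move=> co; rewrite /kronecker_prime (_ : p == 2 = false); last by lia.
rewrite (_ : (Posz p %| Posz a)%Z = (p %| a)) // -(negbK (p %| a)).
rewrite -prime_coprime // coprime_sym co /=.
case: ifPn => [/existsP[x /eqP xa]|].
  have xa' : a = x * x %[mod p].
    by apply/eqP; rewrite eq_sym; move: xa; rewrite expr2 -PoszM !modz_nat => /eqP.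
  rewrite (eq_schering xa') schering_sqr //.
  by move: co; rewrite -(coprime_modl a) xa' coprime_modl coprimeMl => /andP[].
rewrite negb_exists => /forallP nsq.
have /eqP := gauss_lemma co; case: (schering a p) => //.
rewrite expr0 => ah; exfalso.
pose rs : seq 'F_p := a%:R%R :: [seq (k * k)%:R%R | k <- iota 1 p./2].
have q0 : ('X^(p./2) - 1%:P != 0 :> {poly 'F_p})%R.
  by rewrite -size_poly_gt0 size_XnsubC //; lia.
have := max_poly_roots q0 (rs := rs); rewrite size_XnsubC; last by lia.
rewrite /= size_map size_iota ltnn.
have k1 k : 0 < k < p -> (k%:R ^+ (p./2).*2 = 1 :> 'F_p)%R.
  move=> kp; have k0 : (k%:R != 0 :> 'F_p)%R by rewrite Fp_eq0 gtnNdvd //; lia.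
  apply: (mulIf k0); rewrite mul1r -exprSr (_ : _.*2.+1 = p); last by lia.
  by apply/eqP; rewrite -natrX Fp_eq; apply/eqP; exact: fermat_little.
move=> H; suff : false by []; apply: H; apply/andP; split.
- by rewrite /root !hornerE (eqP ah) subrr.
- apply/allP => z /mapP[k]; rewrite mem_iota => kp ->.
  by rewrite /root !hornerE natrM -expr2 -exprM mul2n k1 ?subrr //; lia.
- apply/mapP => -[k]; rewrite mem_iota => kp /eqP; rewrite Fp_eq => /eqP ak.
  have kltp : k < p by lia.
  have /negP[] := nsq (Ordinal kltp) => /=.
  by rewrite expr2 -PoszM !modz_nat ak.
- rewrite map_inj_in_uniq ?iota_uniq // => k l; rewrite !mem_iota => kp lp.
  move/eqP; rewrite !natrM -!expr2 -subr_eq0 subr_sqr mulf_eq0 subr_eq0 -natrD.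
  rewrite Fp_eq Fp_eq0 !modn_small; [|lia..] => /orP[/eqP//|].
  by rewrite gtnNdvd //; lia.
Qed.
End prime.

Definition jacobi (a : int) (n : nat) : int :=
  (\prod_(pe <- prime_decomp n) kronecker_prime pe.1 a ^+ pe.2)%R.

Lemma jacobi_primes a n : jacobi a n =
  (\prod_(p <- primes n) kronecker_prime p a ^+ logn p n)%R.
Proof. by rewrite /jacobi prime_decompE big_map. Qed.

(** A common range of primes lets the exponents of m, n and m n be compared factor by factor. *)
Lemma jacobi_iota a n N : 0 < n -> n < N -> jacobi a n =
  (\prod_(p <- iota 0 N | prime p) kronecker_prime p a ^+ logn p n)%R.
Proof.
move=> n0 nN; rewrite jacobi_primes.
rewrite [RHS](bigID (mem (primes n))) /= [X in _ = (_ * X)%R]big1 ?mulr1; last first.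
  by move=> p /andP[_ h]; rewrite (_ : logn p n = 0) //; apply/eqP; rewrite -leqn0 leqNgt logn_gt0.
rewrite -[RHS]big_filter; apply: perm_big; apply: uniq_perm.
- exact: primes_uniq.
- by rewrite filter_uniq ?iota_uniq.
- move=> p; rewrite mem_filter mem_iota /= add0n; case: (boolP (p \in primes n)) => //=.
    rewrite mem_primes => /and3P[pp _ d]; rewrite pp /=.
    by rewrite (leq_ltn_trans (dvdn_leq n0 d)).
  by rewrite andbF.
Qed.

Lemma jacobi1 a : jacobi a 1 = 1%R.
Proof. by rewrite /jacobi big_nil. Qed.

Lemma jacobiMr a m n : 0 < m -> 0 < n ->
  jacobi a (m * n) = (jacobi a m * jacobi a n)%R.
Proof.
move=> m0 n0; have mn0 : 0 < m * n by rewrite muln_gt0 m0.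
have h1 : m < (m * n).+1 by nia.
have h2 : n < (m * n).+1 by nia.
rewrite (jacobi_iota a mn0 (ltnSn _)) (jacobi_iota a m0 h1) (jacobi_iota a n0 h2).
by rewrite -big_split; apply: eq_bigr => p _; rewrite lognM // exprD.
Qed.

Lemma jacobi_prime a p : prime p -> jacobi a p = kronecker_prime p a.
Proof. by move=> pp; rewrite jacobi_primes primes_prime // big_seq1 logn_prime // eqxx. Qed.

(** Both sides are multiplicative in n, so prime divisors can be removed one at a time. *)
Lemma jacobi_schering a n : odd n -> coprime a n ->
  jacobi a n = ((-1) ^+ schering a n)%R.
Proof.
elim/ltn_ind: n => n IH on co.
have [n1|n1] := leqP n 1.
  have -> : n = 1 by lia.
  by rewrite jacobi1 /schering /schering_with /half_parity big_geq.
have [m nE] := dvdnP (pdiv_dvd n); have pp := pdiv_prime n1.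
move: nE on co pp; set p := pdiv n => nE; rewrite nE => on co pp.
have op : odd p by move: on; rewrite oddM => /andP[].
have om : odd m by move: on; rewrite oddM => /andP[].
have p1 := prime_gt1 pp.
rewrite jacobiMr; [|lia..].
rewrite scheringM // signr_addb.
move: co; rewrite coprimeMr => /andP[com cop].
rewrite IH //; last by nia.
by rewrite jacobi_prime // kronecker_prime_schering.
Qed.

Lemma eq_kronecker_prime p a b : p != 2 -> (a = b %[mod p])%Z ->
  kronecker_prime p a = kronecker_prime p b.
Proof.
move=> /negbTE p2 ab; rewrite /kronecker_prime p2 ab.
suff -> : (Posz p %| a)%Z = (Posz p %| b)%Z by [].
by apply/dvdz_mod0P/dvdz_mod0P; rewrite ab.
Qed.

Lemma eq_jacobi n a b : odd n -> (a = b %[mod n])%Z -> jacobi a n = jacobi b n.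
Proof.
move=> on ab; rewrite !jacobi_primes !big_seq; apply: eq_bigr => p.
rewrite mem_primes => /and3P[pp n0 pn]; congr (_ ^+ _)%R.
apply: eq_kronecker_prime; first by apply: contraL on => /eqP p2; move: pn; rewrite p2 dvdn2.
have /dvdnP[k nE] := pn.
move/eqP: ab; rewrite eqz_mod_dvd => ab; apply/eqP; rewrite eqz_mod_dvd.
by apply: dvdz_trans ab; rewrite nE PoszM; apply: dvdz_mull.
Qed.

Lemma jacobi_eq0 a n : odd n -> ~~ coprime `|a|%N n -> jacobi a n = 0%R.
Proof.
move=> on nco; have n0 : 0 < n by lia.
have g1 : 1 < gcdn `|a| n by move: nco; rewrite /coprime; have := gcdn_gt0 `|a|%N n; lia.
have pp := pdiv_prime g1; set p := pdiv _ in pp.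
have := pdiv_dvd (gcdn `|a| n); rewrite -/p dvdn_gcd => /andP[pa pn].
rewrite jacobi_primes (big_rem p) ?mem_primes ?pp ?n0 ?pn //=.
rewrite /kronecker_prime (_ : p == 2 = false); last first.
  by apply/negbTE; apply: contraL on => /eqP p2; move: pn; rewrite p2 dvdn2.
by rewrite dvdzE /= pa expr0n gtn_eqF ?mul0r // logn_gt0 mem_primes pp n0.
Qed.

Lemma kronecker_jacobi (b : nat) (n : nat) : 0 < n ->
  kronecker b n = jacobi b n.
Proof.
by move=> n0; rewrite /kronecker -/(jacobi b n) ifN ?mul1r // -lt0n.
Qed.

Lemma kronecker_eq0 b n : odd n -> ~~ coprime b n -> kronecker b n = 0%R.
Proof. by move=> on co; rewrite kronecker_jacobi ?jacobi_eq0 //; lia. Qed.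

Lemma kronecker_schering b n : odd n -> coprime b n ->
  kronecker b n = ((-1) ^+ schering b n)%R.
Proof. by move=> on co; rewrite kronecker_jacobi ?jacobi_schering //; lia. Qed.

Lemma kronecker_4M b d : odd d -> kronecker (4 * b)%N d = kronecker b d.
Proof.
move=> od; have co4 : coprime 4 d by rewrite (coprimeXl 2 (n := d) (m := 2)) // coprime2n.
case: (boolP (coprime b d)) => co; last first.
  by rewrite !kronecker_eq0 // coprimeMl co4.
rewrite !kronecker_schering ?coprimeMl ?co4 // schering_mul //.
by rewrite (schering_sqr (a := 2)) // coprime2n.
Qed.

(* The class of j = 1 mod 4: negating both j and the numerator is harmless, the
   sign convention for negative moduli absorbing the first supplementary law. *)
Lemma kronecker_opp_num (b : nat) (j : int) : 0 < b -> (j = 1 %[mod 4])%Z ->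
  kronecker (- b%:Z)%R j = kronecker b `|j|%N.
Proof.
move=> b0 j4; have oj : odd `|j| by lia.
have n0 : 0 < `|j| by lia.
rewrite /kronecker -/(jacobi _ _) -/(jacobi b _) ifN; last by lia.
rewrite [RHS]ifN /= ?mul1r; last by lia.
have -> : ((- b%:Z < 0)%R) = true by lia.
rewrite andbT.
case: (boolP (coprime b `|j|)) => co; last first.
  rewrite (jacobi_eq0 (a := b)) // jacobi_eq0 ?mulr0 //.
  by rewrite abszN.
have E : (- b%:Z = (b * `|j|.-1)%N %[mod `|j|])%Z.
  apply/eqP; rewrite eqz_mod_dvd; apply/dvdzP; exists (- b%:Z)%R; nia.
have cop : coprime `|j|.-1 `|j| by rewrite -{2}(prednK n0) coprimenS.
rewrite (eq_jacobi oj E) !jacobi_schering ?coprimeMl ?co // schering_mul //.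
rewrite schering_pred // signr_addb mulrCA -[RHS]mulr1; congr (_ * _)%R.
case: (ltrP j 0%R) => h; first by have -> : odd (`|j|./2) = true by lia.
by have -> : odd (`|j|./2) = false by lia.
Qed.

(** Only the absolute value of d + 4 b k enters. For k < 0 this is a reflection of d when d < 4 b
    |k| and a translation otherwise, whence the two invariances above. *)
Lemma kronecker_period (b d : nat) (k : int) : 0 < b -> odd d ->
  kronecker b `|(d%:Z + (4 * b)%N%:Z * k)%R|%N = kronecker b d.
Proof.
move=> b0 od.
have od' : odd `|(d%:Z + (4 * b)%N%:Z * k)%R| by rewrite PoszM -mulrA; move: (b%:Z * k)%R => z; lia.
have E : coprime b `|(d%:Z + (4 * b)%N%:Z * k)%R| = coprime b d.
  rewrite -[LHS]/(coprimez b (d%:Z + (4 * b)%N%:Z * k)%R) -[RHS]/(coprimez b d).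
  rewrite (_ : (_ + _)%R = (4 * k * b%:Z + d%:Z)%R); last by rewrite PoszM; ring.
  by rewrite /coprimez gcdzMDl.
case: (boolP (coprime b d)) => co; last first.
  by rewrite !kronecker_eq0 ?E.
rewrite !kronecker_schering ?E //; congr (_ ^+ nat_of_bool _)%R.
case: k od' E => k od' E.
  rewrite -PoszM -PoszD absz_nat; exact: schering_period.
case: (ltnP d (4 * b * k.+1)) => h.
  by rewrite -(schering_reflect od b0 co h); congr (schering b _); lia.
set n := `|_| in od' E *; have dE : d = n + 4 * b * k.+1 by rewrite /n; lia.
by rewrite dE schering_period // E.
Qed.
End Schering.

Local Open Scope classical_set_scope.
Local Open Scope ring_scope.
Local Open Scope complex_scope.

Local Notation normc := Normc.normc.
Local Notation Re := complex.Re.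
Local Notation Im := complex.Im.
Local Notation Vphi mu := (Vsmooth mu (contragredient phi)).
Local Notation V lambda := (Vphi (- lambda)).
Local Notation converges lambda := (3 <= Re (lambda 0 0 - lambda 0 1)).

(** * Modulus of complex numbers *)

Section Normc.
Variable R : realType.
Local Notation C := R[i].

Lemma normc_le (a : C) : normc a <= `|Re a| + `|Im a|.
Proof.
case: a => a b; rewrite /normc /=.
rewrite -[leRHS]ger0_norm ?addr_ge0 // -sqrtr_sqr ler_wsqrtr //.
rewrite sqrrD -[a ^+ 2]real_normK ?num_real // -[b ^+ 2]real_normK ?num_real //.
by rewrite lerD2r lerDl mulrn_wge0 // mulr_ge0.
Qed.

Lemma le_Re_normc (a : C) : `|Re a| <= normc a.
Proof. by case: a => a b; rewrite /normc /= -sqrtr_sqr ler_wsqrtr // lerDl sqr_ge0. Qed.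

Lemma le_Im_normc (a : C) : `|Im a| <= normc a.
Proof. by case: a => a b; rewrite /normc /= -sqrtr_sqr ler_wsqrtr // lerDr sqr_ge0. Qed.

Lemma normc_ge0 (a : C) : 0 <= normc a.
Proof. by case: a => x y; exact: sqrtr_ge0. Qed.

Lemma normcD (x y : C) : normc (x + y) <= normc x + normc y.
Proof.
have := ler_normD x y; rewrite !normc_def; case: x => x x'; case: y => y y' /=.
by rewrite -rmorphD lecR.
Qed.

Lemma normc_sum_le (I : Type) (r : seq I) (P : pred I) (F : I -> C) :
  normc (\sum_(i <- r | P i) F i) <= \sum_(i <- r | P i) normc (F i).
Proof.
elim/big_ind2: _ => //; first by rewrite Normc.normc0.
by move=> x a y b xa yb; apply: le_trans (lerD xa yb); exact: normcD.
Qed.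

Lemma Re_mulE (a b : C) : Re (a * b) =
  Re a * Re b + (- Im a) * Im b.
Proof. by case: a => a a'; case: b => b b' /=; rewrite mulNr. Qed.

Lemma Im_mulE (a b : C) : Im (a * b) =
  Re a * Im b + Im a * Re b.
Proof. by case: a => a a'; case: b => b b'. Qed.
End Normc.

(** * Explicit 3 by 3 matrices *)

Ltac congr_mx3 := congr (mx3 [:: [:: _; _; _]; [:: _; _; _]; [:: _; _; _]]).

Lemma simp01 (R : pzRingType) (k : R) : (k * 0 = 0) * (0 * k = 0) * (k + 0 = k) * (0 + k = k) *
  (k * 1 = k) * (1 * k = k).
Proof. by rewrite !(mulr0, mul0r, addr0, add0r, mulr1, mul1r). Qed.

Lemma arith_signs (R : pzRingType) (k : R) : (k * 0 = 0) * (0 * k = 0) * (k + 0 = k) * (0 + k = k) *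
  (k * 1 = k) * (1 * k = k) * (- - k = k) * (k * -1 = - k) *
  (-1 * k = - k) * (k - 0 = k).
Proof.
by rewrite !(mulr0, mul0r, addr0, add0r, mulr1, mul1r, opprK, mulrN1, mulN1r, subr0).
Qed.

Section Matrices.
Variable R : realType.
Implicit Types (x y z : R) (g h : 'M[R]_3).

Lemma ord3P (P : 'I_3 -> Prop) : P 0 -> P 1 -> P 2 -> forall i, P i.
Proof.
move=> P0 P1 P2 [[|[|[|//]]] hi].
- by rewrite (_ : Ordinal hi = 0) //; apply: val_inj.
- by rewrite (_ : Ordinal hi = 1) //; apply: val_inj.
- by rewrite (_ : Ordinal hi = 2) //; apply: val_inj.
Qed.

Lemma mx3_eta g : g = mx3 [:: [:: g 0 0; g 0 1; g 0 2];
  [:: g 1 0; g 1 1; g 1 2]; [:: g 2 0; g 2 1; g 2 2]].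
Proof. by apply/matrixP; do 2 elim/ord3P; rewrite mxE. Qed.

Lemma mul_mx3 (a b c d e f g h i a' b' c' d' e' f' g' h' i' : R) :
  mx3 [:: [:: a; b; c]; [:: d; e; f]; [:: g; h; i]] *m
  mx3 [:: [:: a'; b'; c']; [:: d'; e'; f']; [:: g'; h'; i']] =
  mx3 [:: [:: a * a' + b * d' + c * g'; a * b' + b * e' + c * h';
              a * c' + b * f' + c * i'];
          [:: d * a' + e * d' + f * g'; d * b' + e * e' + f * h';
              d * c' + e * f' + f * i'];
          [:: g * a' + h * d' + i * g'; g * b' + h * e' + i * h';
              g * c' + h * f' + i * i']].
Proof.
by apply/matrixP; do 2 elim/ord3P;
  rewrite !mxE !big_ord_recl big_ord0 !mxE /= addr0 addrA.
Qed.

Lemma one_mx3 : 1%:M = mx3 [:: [:: 1; 0; 0]; [:: 0; 1; 0]; [:: 0; 0; 1]] :> 'M[R]_3.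
Proof. by apply/matrixP; do 2 elim/ord3P; rewrite !mxE. Qed.

Lemma eq_mx3 (a b c d e f g h i a' b' c' d' e' f' g' h' i' : R) :
  mx3 [:: [:: a; b; c]; [:: d; e; f]; [:: g; h; i]] =
  mx3 [:: [:: a'; b'; c']; [:: d'; e'; f']; [:: g'; h'; i']] ->
  [/\ a = a', b = b' & c = c'] /\ [/\ d = d', e = e' & f = f'] /\
  [/\ g = g', h = h' & i = i'].
Proof.
move/matrixP => E.
have := E 0 0; have := E 0 1; have := E 0 2.
have := E 1 0; have := E 1 1; have := E 1 2.
have := E 2 0; have := E 2 1; have := E 2 2.
by rewrite !mxE /=.
Qed.

Lemma invmx_eq (S : comUnitRingType) n (A B : 'M[S]_n) : A *m B = 1%:M -> invmx A = B.
Proof.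
move=> AB; have [uA _] := mulmx1_unit AB.
by rewrite -[invmx A]mulmx1 -AB mulmxA mulVmx // mul1mx.
Qed.

Lemma mulmx_nmx x y z x' y' z' :
  nmx x y z *m nmx x' y' z' = nmx (x + x') (y + y') (z + z' + x * y').
Proof.
by rewrite /nmx mul_mx3; congr_mx3; ring.
Qed.

Lemma nmx0 : nmx 0 0 0 = 1%:M :> 'M[R]_3.
Proof. by rewrite one_mx3. Qed.

Lemma nmxK x y z : nmx x y z *m nmx (- x) (- y) (x * y - z) = 1%:M.
Proof. by rewrite mulmx_nmx -nmx0; congr nmx; ring. Qed.

Lemma diag_tmx g : is_diag_mx g -> g = tmx (g 0 0) (g 1 1) (g 2 2).
Proof.
move=> /is_diag_mxP dg; rewrite [LHS]mx3_eta /tmx.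
by congr_mx3; apply: dg.
Qed.

Lemma tmx_diag x y z : is_diag_mx (tmx x y z).
Proof. by apply/is_diag_mxP; do 2 elim/ord3P; rewrite // !mxE. Qed.

Lemma det_tmx x y z : \det (tmx x y z) = x * y * z.
Proof. by rewrite det_mx3 !mxE /=; ring. Qed.

Lemma det_nmx x y z : \det (nmx x y z) = 1.
Proof. exact/eqP/nSL_subproof. Qed.

Lemma det_walpha1 : \det (walpha1 : 'M[R]_3) = 1.
Proof. by rewrite det_mx3 !mxE /=; ring. Qed.

Lemma det_walpha2 : \det (walpha2 : 'M[R]_3) = 1.
Proof. by rewrite det_mx3 !mxE /=; ring. Qed.
End Matrices.

(** * Bruhat cells *)

Section Bruhat.
Variable R : realType.
Implicit Types (x y z p q r : R) (g h : 'M[R]_3).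

Lemma wprodE :
  [/\ wprod [:: walpha1; walpha2] =
        mx3 [:: [:: 0; 0; 1]; [:: 1; 0; 0]; [:: 0; 1; 0]] :> 'M[R]_3,
      wprod [:: walpha2; walpha1] =
        mx3 [:: [:: 0; -1; 0]; [:: 0; 0; -1]; [:: 1; 0; 0]] :> 'M[R]_3 &
      wprod [:: walpha1; walpha2; walpha1] =
        mx3 [:: [:: 0; 0; 1]; [:: 0; -1; 0]; [:: 1; 0; 0]] :> 'M[R]_3].
Proof.
rewrite /wprod /= !mulmx1; split; rewrite /walpha1 /walpha2 !mul_mx3;
  by congr_mx3; ring.
Qed.

Lemma walpha2V :
  walpha2 *m mx3 [:: [:: 1; 0; 0]; [:: 0; 0; 1]; [:: 0; -1; 0]] = 1%:M :> 'M[R]_3.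
Proof. by rewrite /walpha2 mul_mx3 one_mx3; congr_mx3; ring. Qed.

Lemma wlmxE : wlmx = mx3 [:: [:: 0; 0; 1]; [:: 0; -1; 0]; [:: 1; 0; 0]] :> 'M[R]_3.
Proof. by have [_ _ <-] := wprodE; rewrite /wlmx /wprod /= mulmx1 mulmxA. Qed.

Lemma wlmxK : wlmx *m wlmx = 1%:M :> 'M[R]_3.
Proof.
rewrite wlmxE mul_mx3 one_mx3.
by congr_mx3; ring.
Qed.

(* The positions of the first nonzero entry in the last row and of the first
   nonzero minor of the last two rows determine the Bruhat cell. *)
Definition cell_word g : seq 'M[R]_3 :=
  if g 2 0 != 0 then
    if plA2 g != 0 then [:: walpha1; walpha2; walpha1]
    else [:: walpha2; walpha1]
  else if g 2 1 != 0 then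
    if plA2 g != 0 then [:: walpha1; walpha2] else [:: walpha2]
  else if plB2 g != 0 then [:: walpha1] else [::].

Lemma bruhat_word g d : \det g != 0 -> bruhat g d -> d.1.2 = cell_word g.
Proof.
case: d => [[a ws] n'] dg [da wsin [x' [y' [z' ->]]] _ [_ [x [y [z ->]]] gE]] /=.
move: dg; rewrite gE (diag_tmx da) !det_mulmx det_tmx !det_nmx mulr1 mul1r => dg.
have : a 0 0 * a 1 1 * a 2 2 != 0 by apply: contra dg => /eqP ->; rewrite mul0r.
rewrite !mulf_eq0 !negb_or => /andP[/andP[p0 q0] r0] {gE da dg}.
move: (a 0 0) (a 1 1) (a 2 2) p0 q0 r0 => p q r p0 q0 r0 {a}.
have [E12 E21 E121] := wprodE.
rewrite !inE in wsin.
have qr : q * r != 0 by rewrite mulf_neq0.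
case/or3P: wsin => [/eqP->|/eqP->|].
- rewrite /wprod /= mulmx1 /nmx /tmx !mul_mx3 /cell_word /plA2 /plB2 !mxE /=.
  by rewrite !simp01 !(subrr, eqxx, oppr0).
- rewrite /wprod /= mulmx1 /nmx /tmx /walpha1 !mul_mx3 /cell_word /plA2 /plB2 !mxE /=.
  by rewrite !simp01 !(oppr0, addr0, eqxx) /= qr.
case/orP=> [/eqP->|].
- rewrite /wprod /= mulmx1 /nmx /tmx /walpha2 !mul_mx3 /cell_word /plA2 /plB2 !mxE /=.
  by rewrite !simp01 !(subrr, eqxx, oppr0) /= r0.
case/or3P => /eqP->.
- rewrite E12 /nmx /tmx !mul_mx3 /cell_word /plA2 /plB2 !mxE /=.
  by rewrite !simp01 !(oppr0, addr0, eqxx) /= r0 oppr_eq0 qr.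
- rewrite E21 /nmx /tmx !mul_mx3 /cell_word /plA2 /plB2 !mxE /=.
  rewrite !simp01 r0 ifN // negbK oppr_eq0 subr_eq0; apply/eqP; ring.
- rewrite E121 /nmx /tmx !mul_mx3 /cell_word /plA2 /plB2 !mxE /=.
  rewrite !simp01 r0 ifT //; apply: contra qr => /eqP H; apply/eqP; rewrite -oppr0 -H; ring.
Qed.
End Bruhat.

(** * The cocycle in terms of sign bits *)

Section Sigma.
Variable R : realType.
Implicit Types (x y z p q r : R) (g h : 'M[R]_3).

Lemma unip_mul g h : unip g -> unip h -> unip (g *m h).
Proof.
by move=> [x [y [z ->]]] [x' [y' [z' ->]]]; rewrite mulmx_nmx; do 3 eexists.
Qed.

(** The left factor n of a decomposition is existentially quantified and absorbs any unipotent;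
    hence [sigma] is invariant under N on the left. *)
Lemma bruhat_nmx x y z g : bruhat (nmx x y z *m g) = bruhat g.
Proof.
have sub x1 y1 z1 g1 : bruhat g1 `<=` bruhat (nmx x1 y1 z1 *m g1).
  move=> [[a ws] n'] [da wi un ut [n nn gE]]; split => //.
  exists (nmx x1 y1 z1 *m n); last by rewrite gE !mulmxA.
  by apply: unip_mul => //; do 3 eexists.
apply/seteqP; split; last exact: sub.
rewrite -{2}(mul1mx g) -(mulmx1C (nmxK x y z)) -mulmxA; exact: sub.
Qed.

Lemma sigma_nmx x y z g h : sigma (nmx x y z *m g) h = sigma g h.
Proof. by rewrite /sigma bruhat_nmx. Qed.

Definition lead2 g : R := first_nonzero [:: - plA2 g; plB2 g; - plC2 g].
Definition lead3 g : R := first_nonzero [:: - plA1 g; - plB1 g; - plC1 g].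
(** For determinant 1 the diagonal of [Delta g] has sign bits s2, s2 + s3 and s3, and real Hilbert
    symbols see nothing else. *)
Definition s2 g : bool := lead2 g < 0.
Definition s3 g : bool := lead3 g < 0.

Lemma first_nonzero3 x y z : first_nonzero [:: x; y; z] =
  if x != 0 then x else if y != 0 then y else z.
Proof.
rewrite /first_nonzero /=; case: ifP => // _; case: ifP => // _.
by case: ifPn => //=; rewrite negbK => /eqP ->.
Qed.

Lemma lead3_neq0 g : \det g != 0 -> lead3 g != 0.
Proof.
rewrite /lead3 /plA1 /plB1 /plC1 !opprK first_nonzero3 det_mx3.
case: ifPn => // /negPn/eqP E0; case: ifPn => // /negPn/eqP E1 dg.
by apply: contra dg => /eqP E2; rewrite E0 E1 E2; apply/eqP; ring.
Qed.

Lemma lead2_neq0 g : \det g != 0 -> lead2 g != 0.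
Proof.
rewrite /lead2 /plA2 /plB2 /plC2 !opprK first_nonzero3 det_mx3.
case: ifPn => // /negPn/eqP E0; case: ifPn => // /negPn/eqP E1 dg.
apply: contra dg => /eqP E2; apply/eqP.
have -> : g 1 0 * g 2 1 - g 1 1 * g 2 0 = 0 by [].
rewrite E1 (_ : g 1 1 * g 2 2 - g 1 2 * g 2 1 = 0) //; ring.
Qed.

Lemma mulr_lt0_neq0 x y : x != 0 -> y != 0 -> (x * y < 0) = (x < 0) (+) (y < 0).
Proof. by move=> x0 y0; rewrite mulr_lt0 x0 y0. Qed.

Lemma oppr_lt0_neq0 x : x != 0 -> (- x < 0) = ~~ (x < 0).
Proof. by move=> x0; rewrite oppr_lt0 -leNgt le_eqVlt eq_sym (negbTE x0). Qed.

Lemma divr_lt0_neq0 x y : x != 0 -> y != 0 -> (x / y < 0) = (x < 0) (+) (y < 0).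
Proof. by move=> x0 y0; rewrite mulr_lt0_neq0 ?invr_eq0 // invr_lt0. Qed.

Lemma DeltaE g : \det g = 1 ->
  Delta g = tmx (1 / lead2 g) (lead2 g / lead3 g) (lead3 g).
Proof. by move=> dg; rewrite /Delta dg. Qed.

Lemma sigma_diag_Delta p q r g : \det g = 1 ->
  sigma_diag (tmx p q r) (Delta g) = (p < 0) && s2 g (+) (q < 0) && s3 g.
Proof.
move=> dg; have d0 : \det g != 0 by rewrite dg oner_neq0.
rewrite DeltaE // /sigma_diag /hilbert !mxE /= divr_lt0_neq0 ?lead2_neq0 ?lead3_neq0 //.
rewrite -/(s2 g) -/(s3 g).
by case: (p < 0); case: (q < 0); case: (s2 g); case: (s3 g).
Qed.

(** The symbol of Delta(w h) Delta(h) against -Delta(h), expanded bilinearly; b2, b3 are the bits of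
    h and c2, c3 those of w h. *)
Definition simple_bits (b2 b3 c2 c3 : bool) : bool :=
  ((c2 (+) b2) && b2) (+) ((c2 (+) c3 (+) b2 (+) b3) && ~~ b3).

Lemma sigma_simpleE w h : \det w = 1 -> \det h = 1 ->
  sigma_simple w h = simple_bits (s2 h) (s3 h) (s2 (w *m h)) (s3 (w *m h)).
Proof.
move=> dw dh; have dwh : \det (w *m h) = 1 by rewrite det_mulmx dw dh mul1r.
have d0 : \det h != 0 by rewrite dh oner_neq0.
have d0' : \det (w *m h) != 0 by rewrite dwh oner_neq0.
have n2 := lead2_neq0 d0; have n3 := lead3_neq0 d0.
have n2' := lead2_neq0 d0'; have n3' := lead3_neq0 d0'.
rewrite /sigma_simple !DeltaE // /tmx mul_mx3 /sigma_diag /hilbert !mxE /=.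
rewrite !(mul0r, mulr0, addr0, add0r).
have e2 : 1 / lead2 h != 0 by rewrite div1r invr_eq0.
have e2' : 1 / lead2 (w *m h) != 0 by rewrite div1r invr_eq0.
have e3 : lead2 h / lead3 h != 0 by rewrite mulf_neq0 ?invr_eq0.
have e3' : lead2 (w *m h) / lead3 (w *m h) != 0 by rewrite mulf_neq0 ?invr_eq0.
rewrite (mulr_lt0_neq0 e2' e2) (mulr_lt0_neq0 e3' e3).
rewrite !oppr_lt0_neq0 // !divr_lt0_neq0 ?oner_neq0 // ltr10.
rewrite -/(s2 h) -/(s3 h) -/(s2 (w *m h)) -/(s3 (w *m h)) /simple_bits.
by case: (s2 h); case: (s3 h); case: (s2 _); case: (s3 _).
Qed.

Lemma det_wprod (ws : seq 'M[R]_3) : ws \in reduced_words -> \det (wprod ws) = 1.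
Proof.
rewrite !inE => h.
do ?[case/orP: h => h]; rewrite (eqP h) /wprod /= ?mulmx1 ?det_mulmx
  ?det_walpha1 ?det_walpha2 ?det1 ?mulr1 //.
Qed.

(* No left argument of the cocycle met here lies in another cell. *)
Definition used_words : seq (seq 'M[R]_3) :=
  [:: [::]; [:: walpha2]; [:: walpha1; walpha2]; [:: walpha1; walpha2; walpha1]].

(** Comparison of entries; the triangularity conditions kill the coordinates of n' that could be
    moved across the Weyl element into n. *)
Lemma bruhat_uniq (ws : seq 'M[R]_3) p q r u v t x y z p' q' r' u' v' t' x' y' z' :
  ws \in used_words ->
  p * q * r != 0 ->
  is_trig_mx (wprod ws *m nmx u v t *m invmx (wprod ws)) ->
  is_trig_mx (wprod ws *m nmx u' v' t' *m invmx (wprod ws)) ->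
  nmx x y z *m tmx p q r *m wprod ws *m nmx u v t =
  nmx x' y' z' *m tmx p' q' r' *m wprod ws *m nmx u' v' t' ->
  tmx p q r = tmx p' q' r' /\ nmx u v t = nmx u' v' t'.
Proof.
have [E12 E21 E121] := wprodE R.
rewrite !mulf_eq0 !negb_or => wsi /andP[/andP[p0 q0] r0].
(* [is_trig_mx] means lower triangular, so the entries above the diagonal vanish; [invmx] gives way
   to an explicit inverse. *)
have tri (W W' : 'M[R]_3) n : W *m W' = 1%:M -> is_trig_mx (W *m n *m invmx W) ->
    forall i j : 'I_3, (i < j)%N -> (W *m n *m W') i j = 0.
  by move=> WW; rewrite (invmx_eq WW) => /is_trig_mxP.
rewrite !inE in wsi; case/or4P: wsi => /eqP ->.
- have W1 : 1%:M *m 1%:M = 1%:M :> 'M[R]_3 by rewrite mulmx1.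
  rewrite /wprod /= => /(tri _ _ _ W1) T /(tri _ _ _ W1) T'.
  move: (T 0 1 isT) (T 0 2 isT) (T 1 2 isT) (T' 0 1 isT) (T' 0 2 isT) (T' 1 2 isT).
  rewrite !mulmx1 !mul1mx !mxE /= => -> -> -> -> -> ->; rewrite nmx0 !mulmx1.
  rewrite /nmx /tmx !mul_mx3 => /eq_mx3; rewrite !simp01.
  by move=> [[-> _ _] [[_ -> _] [_ _ ->]]].
- rewrite /wprod /= mulmx1 => /(tri _ _ _ (walpha2V R)) T /(tri _ _ _ (walpha2V R)) T'.
  move: (T 0 1 isT) (T 0 2 isT) (T' 0 1 isT) (T' 0 2 isT).
  rewrite /nmx /walpha2 /tmx !mul_mx3 !mxE /= !simp01.
  move=> /eqP; rewrite mulrN1 oppr_eq0 => /eqP t0 u0.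
  move=> /eqP; rewrite mulrN1 oppr_eq0 => /eqP t0' u0'.
  rewrite t0 u0 t0' u0' => /eq_mx3; rewrite !simp01.
  move=> [[-> _ _] [[_ Ey Eq] [_ Er Ev]]].
  rewrite -Er in Ev; have vv := mulfI r0 Ev; subst v'.
  rewrite -Er in Ey; have yy := mulIf r0 Ey; subst y' r'.
  by have -> : q = q' by lra.
- have W1 : mx3 [:: [:: 0; 0; 1]; [:: 1; 0; 0]; [:: 0; 1; 0]] *m
      mx3 [:: [:: 0; 1; 0]; [:: 0; 0; 1]; [:: 1; 0; 0]] = 1%:M :> 'M[R]_3.
    rewrite mul_mx3 one_mx3.
    by congr_mx3; ring.
  rewrite E12 => /(tri _ _ _ W1) T /(tri _ _ _ W1) T'.
  move: (T 1 2 isT) (T' 1 2 isT); rewrite /nmx /tmx !mul_mx3 !mxE /= !simp01.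
  move=> u0 u0'; rewrite u0 u0' => /eq_mx3; rewrite !simp01.
  move=> [[Ex Ez Ep] [[Eq Ey Et] [_ Er Ev]]].
  subst r'; have vv := mulfI r0 Ev; subst v'.
  have yy := mulIf r0 Ey; subst y'; subst q'.
  have xx := mulIf q0 Ex; subst x'.
  have zz := mulIf r0 Ez; subst z'.
  have tt : t = t' by apply: (mulfI q0); lra.
  by subst t'; have -> : p = p' by lra.
- have W1 : mx3 [:: [:: 0; 0; 1]; [:: 0; -1; 0]; [:: 1; 0; 0]] *m
      mx3 [:: [:: 0; 0; 1]; [:: 0; -1; 0]; [:: 1; 0; 0]] = 1%:M :> 'M[R]_3.
    rewrite mul_mx3 one_mx3.
    by congr_mx3; ring.
  rewrite E121 => _ _; rewrite /nmx /tmx !mul_mx3 => /eq_mx3; rewrite !simp01.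
  move=> [[Ez Ex Ep] [[Ey Eq Ev] [Er Eu Et]]].
  subst r'; have uu := mulfI r0 Eu; have tt := mulfI r0 Et; subst u' t'.
  have yy := mulIf r0 Ey; subst y'.
  have zz := mulIf r0 Ez; subst z'.
  have qq : q = q' by lra.
  subst q'; have vv : v = v' by apply: (mulfI q0); lra.
  subst v'; have xx : x = x' by apply: (mulIf q0); lra.
  by subst x'; have -> : p = p' by lra.
Qed.

(** [sigma] picks a decomposition by choice. Its word is forced by [bruhat_word] and its other data
    by [bruhat_uniq], so any decomposition that can be written down computes it. *)
Lemma sigmaE (ws : seq 'M[R]_3) p q r u v t x y z g :
  ws \in used_words ->
  p * q * r != 0 ->
  is_trig_mx (wprod ws *m nmx u v t *m invmx (wprod ws)) ->
  sigma (nmx x y z *m tmx p q r *m wprod ws *m nmx u v t) g =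
  sigma_diag (tmx p q r) (Delta (wprod ws *m nmx u v t *m g)) (+)
  sigma_word ws (nmx u v t *m g).
Proof.
move=> wsi a0 tr; set g1 := _ *m nmx u v t.
have wsi' : ws \in reduced_words.
  by move: wsi; rewrite !inE => /or4P[] ->; rewrite ?orbT.
have B : bruhat g1 (tmx p q r, ws, nmx u v t).
  split=> //; [exact: tmx_diag|by do 3 eexists|].
  by exists (nmx x y z) => //; do 3 eexists.
have dg : \det g1 != 0.
  by rewrite /g1 !det_mulmx !det_nmx det_tmx det_wprod // mulr1 mul1r mulr1.
rewrite /sigma; case: xgetP => [[[a ws'] n'] dE B'|/(_ _ B)//].
have wE : ws' = ws by have := bruhat_word dg B; have := bruhat_word dg B' => /= -> ->.
subst ws'; case: B' => [da _ [u' [v' [t' n'E]]] tr' [_ [x' [y' [z' ->]]] g1E]].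
subst n'; rewrite (diag_tmx da) in g1E *.
by have [-> ->] := bruhat_uniq wsi a0 tr tr' g1E.
Qed.

Lemma sigma_nmxl x y z g : \det g = 1 -> sigma (nmx x y z) g = false.
Proof.
move=> dg; have := @sigmaE [::] 1 1 1 0 0 0 x y z g.
rewrite /wprod /= nmx0 !mul1mx !mulmx1.
have -> : tmx 1 1 1 = 1%:M :> 'M[R]_3 by rewrite one_mx3.
rewrite mulmx1 => ->; rewrite ?mulr1 ?oner_neq0 //.
  have -> : 1%:M = tmx 1 1 1 :> 'M[R]_3 by rewrite one_mx3.
  by rewrite sigma_diag_Delta // ltr10.
by rewrite invmx1 scalar_mx_is_trig.
Qed.

Lemma sigma_tmx p q r g : p * q * r != 0 -> \det g = 1 ->
  sigma (tmx p q r) g = (p < 0) && s2 g (+) (q < 0) && s3 g.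
Proof.
move=> a0 dg; have := @sigmaE [::] p q r 0 0 0 0 0 0 g.
rewrite /wprod /= nmx0 !mul1mx !mulmx1 => -> //.
  by rewrite sigma_diag_Delta // addbF.
by rewrite invmx1 scalar_mx_is_trig.
Qed.

Lemma sigma_cell2 p q r v x y z g : p * q * r != 0 -> \det g = 1 ->
  let h := nmx 0 v 0 *m g in
  sigma (nmx x y z *m tmx p q r *m walpha2 *m nmx 0 v 0) g =
  ((p < 0) && s2 (walpha2 *m h) (+) (q < 0) && s3 (walpha2 *m h)) (+)
  simple_bits (s2 h) (s3 h) (s2 (walpha2 *m h)) (s3 (walpha2 *m h)).
Proof.
move=> a0 dg h; have wsi : [:: walpha2] \in used_words by rewrite !inE !eqxx ?orbT.
have := @sigmaE [:: walpha2] p q r 0 v 0 x y z g wsi.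
have dh : \det h = 1 by rewrite det_mulmx det_nmx dg mulr1.
rewrite /wprod /= !mulmx1 => -> //.
  rewrite mul1mx -/h -(mulmxA walpha2) -/h sigma_diag_Delta; last first.
    by rewrite det_mulmx dh det_walpha2 mulr1.
  by rewrite sigma_simpleE ?det_walpha2 // addbF.
rewrite (invmx_eq (walpha2V R)) /walpha2 /nmx !mul_mx3; apply/is_trig_mxP.
by do 2 elim/ord3P; rewrite // !mxE /= => _; ring.
Qed.

Lemma sigma_cell12 p q r x y z g : p * q * r != 0 -> \det g = 1 ->
  let h := walpha2 *m g in
  sigma (nmx x y z *m tmx p q r *m (walpha1 *m walpha2)) g =
  ((p < 0) && s2 (walpha1 *m h) (+) (q < 0) && s3 (walpha1 *m h)) (+)
  (simple_bits (s2 h) (s3 h) (s2 (walpha1 *m h)) (s3 (walpha1 *m h)) (+)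
   simple_bits (s2 g) (s3 g) (s2 h) (s3 h)).
Proof.
move=> a0 dg h; have wsi : [:: walpha1; walpha2] \in used_words by rewrite !inE !eqxx ?orbT.
have := @sigmaE [:: walpha1; walpha2] p q r 0 0 0 x y z g wsi.
have dh : \det h = 1 by rewrite det_mulmx det_walpha2 dg mulr1.
rewrite /wprod /= nmx0 !mulmx1 => -> //.
  rewrite !mul1mx -(mulmxA walpha1) -/h sigma_diag_Delta; last first.
    by rewrite det_mulmx dh det_walpha1 mulr1.
  by rewrite !sigma_simpleE ?det_walpha1 ?det_walpha2 // addbF.
rewrite mulmxV ?unitmxE ?det_mulmx ?det_walpha1 ?det_walpha2 ?mulr1 ?unitr1 //.
Qed.

Lemma sigma_cell121 u v t g : \det g = 1 ->
  let h := nmx u v t *m g in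
  sigma (wlmx *m nmx u v t) g =
  simple_bits (s2 (walpha2 *m (walpha1 *m h))) (s3 (walpha2 *m (walpha1 *m h)))
    (s2 (wlmx *m h)) (s3 (wlmx *m h)) (+)
  (simple_bits (s2 (walpha1 *m h)) (s3 (walpha1 *m h))
    (s2 (walpha2 *m (walpha1 *m h))) (s3 (walpha2 *m (walpha1 *m h))) (+)
   simple_bits (s2 h) (s3 h) (s2 (walpha1 *m h)) (s3 (walpha1 *m h))).
Proof.
move=> dg h; have wsi : [:: walpha1; walpha2; walpha1] \in used_words by rewrite !inE !eqxx ?orbT.
have := @sigmaE [:: walpha1; walpha2; walpha1] 1 1 1 u v t 0 0 0 g wsi.
have wE : wprod [:: walpha1; walpha2; walpha1] = wlmx :> 'M[R]_3.
  by rewrite /wlmx /wprod /= mulmx1 mulmxA.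
rewrite wE nmx0.
have -> : tmx 1 1 1 = 1%:M :> 'M[R]_3 by rewrite one_mx3.
rewrite !mul1mx !mulr1 oner_neq0 => -> //.
  have dh : \det h = 1 by rewrite det_mulmx det_nmx dg mulr1.
  have dw : \det (wlmx : 'M[R]_3) = 1 by exact/eqP/wlSL_subproof.
  have -> : 1%:M = tmx 1 1 1 :> 'M[R]_3 by rewrite one_mx3.
  rewrite sigma_diag_Delta; last by rewrite 2!det_mulmx dw det_nmx dg !mulr1.
  rewrite ltr10 /= /wprod /= !mulmx1 mul1mx -/h -(mulmxA walpha2) addbF.
  have dh1 : \det (walpha1 *m h) = 1 by rewrite det_mulmx det_walpha1 dh mulr1.
  have dh2 : \det (walpha2 *m (walpha1 *m h)) = 1.
    by rewrite det_mulmx det_walpha2 dh1 mulr1.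
  by rewrite !sigma_simpleE ?det_walpha1 ?det_walpha2 // /wlmx -!mulmxA.
rewrite (invmx_eq (wlmxK R)) wlmxE /nmx !mul_mx3; apply/is_trig_mxP.
by do 2 elim/ord3P; rewrite // !mxE /= => _; ring.
Qed.
End Sigma.

(** * Signs carried by N_- in the cover *)

Section Signs.
Variable R : realType.
Implicit Types (x y z p q r : R).

Definition sgn3 x y z : bool :=
  if x != 0 then x < 0 else if y != 0 then y < 0 else z < 0.

Lemma s3_mx3 (a b c d e f g h i : R) :
  s3 (mx3 [:: [:: a; b; c]; [:: d; e; f]; [:: g; h; i]]) = sgn3 g h i.
Proof.
rewrite /s3 /lead3 /plA1 /plB1 /plC1 !opprK first_nonzero3 !mxE /= /sgn3.
by do 2 case: ifP => //.
Qed.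

Lemma s2_mx3 (a b c d e f g h i : R) :
  s2 (mx3 [:: [:: a; b; c]; [:: d; e; f]; [:: g; h; i]]) =
  sgn3 (d * h - e * g) (d * i - f * g) (e * i - f * h).
Proof.
rewrite /s2 /lead2 /plA2 /plB2 /plC2 !opprK first_nonzero3 !mxE /= /sgn3.
by do 2 case: ifP => //.
Qed.

Lemma walpha1_mx3 (a b c d e f g h i : R) :
  walpha1 *m mx3 [:: [:: a; b; c]; [:: d; e; f]; [:: g; h; i]] =
  mx3 [:: [:: - d; - e; - f]; [:: a; b; c]; [:: g; h; i]].
Proof.
rewrite /walpha1 mul_mx3.
by congr_mx3; ring.
Qed.

Lemma walpha2_mx3 (a b c d e f g h i : R) :
  walpha2 *m mx3 [:: [:: a; b; c]; [:: d; e; f]; [:: g; h; i]] =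
  mx3 [:: [:: a; b; c]; [:: - g; - h; - i]; [:: d; e; f]].
Proof.
rewrite /walpha2 mul_mx3.
by congr_mx3; ring.
Qed.

Lemma wlmx_mx3 (a b c d e f g h i : R) :
  wlmx *m mx3 [:: [:: a; b; c]; [:: d; e; f]; [:: g; h; i]] =
  mx3 [:: [:: g; h; i]; [:: - d; - e; - f]; [:: a; b; c]].
Proof.
rewrite wlmxE mul_mx3.
by congr_mx3; ring.
Qed.

Lemma sgn3_neq0 x y z : x != 0 -> sgn3 x y z = (x < 0).
Proof. by rewrite /sgn3 => ->. Qed.

Lemma sgn3_0 y z : sgn3 0 y z = if y != 0 then y < 0 else z < 0.
Proof. by rewrite /sgn3 eqxx. Qed.

Definition lower (a b c : R) : 'M[R]_3 :=
  mx3 [:: [:: 1; 0; 0]; [:: a; 1; 0]; [:: b; c; 1]].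

Lemma det_lower a b c : \det (lower a b c) = 1.
Proof. by rewrite det_mx3 !mxE /=; ring. Qed.

Lemma wlmx_nmx x y z : wlmx *m nmx x y z *m wlmx = lower (- y) z (- x).
Proof.
rewrite {1}wlmxE /nmx mul_mx3 wlmxE mul_mx3.
by congr_mx3; ring.
Qed.

Lemma det_wlmx : \det (wlmx : 'M[R]_3) = 1.
Proof. exact/eqP/wlSL_subproof. Qed.

Lemma sigma_wlmx u v t (g : 'M[R]_3) (a b c d e f g' h i : R) :
  nmx u v t *m g = mx3 [:: [:: a; b; c]; [:: d; e; f]; [:: g'; h; i]] ->
  \det g = 1 ->
  sigma (wlmx *m nmx u v t) g =
  let bh2 := sgn3 (d * h - e * g') (d * i - f * g') (e * i - f * h) in
  let bh3 := sgn3 g' h i in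
  let b12 := sgn3 (a * h - b * g') (a * i - c * g') (b * i - c * h) in
  let b22 := b12 in
  let b23 := sgn3 a b c in
  let b32 := sgn3 (a * e - b * d) (a * f - c * d) (b * f - c * e) in
  simple_bits b12 b23 b32 b23 (+)
  (simple_bits b12 bh3 b12 b23 (+) simple_bits bh2 bh3 b12 bh3).
Proof.
move=> gE dg; rewrite sigma_cell121 // gE wlmx_mx3 walpha1_mx3 walpha2_mx3.
rewrite !s2_mx3 !s3_mx3 /=.
have -> : - g' * b - - h * a = a * h - b * g' by ring.
have -> : - g' * c - - i * a = a * i - c * g' by ring.
have -> : - h * c - - i * b = b * i - c * h by ring.
have -> : - d * b - - e * a = a * e - b * d by ring.
have -> : - d * c - - f * a = a * f - c * d by ring.
have -> : - e * c - - f * b = b * f - c * e by ring.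
by [].
Qed.

(** The left side is the sign component of [nminus x y z]: N_- does not sit in the cover with
    constant sign component. *)
Lemma nminus_sign x y z :
  sigma wlmx (wlmx : 'M[R]_3) (+) sigma wlmx (nmx x y z) (+)
  sigma (wlmx *m nmx x y z) wlmx =
  let X := sgn3 x (-1) 0 in let k := sgn3 z (- x) 1 in
  let e2 := sgn3 (x * y - z) (- y) 1 in
  ~~ (X (+) k (+) ((X (+) e2) && (X (+) ~~ k))).
Proof.
have n1 : nmx 0 0 0 *m wlmx = mx3 [:: [:: 0; 0; 1]; [:: 0; -1; 0]; [:: 1; 0; 0]] :> 'M[R]_3.
  by rewrite nmx0 mul1mx wlmxE.
have n2 : nmx 0 0 0 *m nmx x y z = mx3 [:: [:: 1; x; z]; [:: 0; 1; y]; [:: 0; 0; 1]].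
  by rewrite nmx0 mul1mx.
have n3 : nmx x y z *m wlmx = mx3 [:: [:: z; - x; 1]; [:: y; -1; 0]; [:: 1; 0; 0]].
  rewrite wlmxE /nmx mul_mx3.
  by congr_mx3; ring.
have A1 := sigma_wlmx n1 det_wlmx.
have A2 := sigma_wlmx n2 (det_nmx x y z).
have A3 := sigma_wlmx n3 det_wlmx.
rewrite nmx0 mulmx1 in A1 A2; rewrite A1 A2 A3 {A1 A2 A3 n1 n2 n3} /=.
have -> : z * -1 - - x * y = x * y - z by ring.
rewrite !(oppr0, arith_signs) !sgn3_0 eqxx oppr_eq0 oner_eq0 /= ltr10 ltrN10.
rewrite !(sgn3_neq0 _ _ (oner_neq0 R)) ltr10 /simple_bits /=.
by case: (sgn3 x _ _); case: (sgn3 z _ _); case: (sgn3 (_ - _) _ _).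
Qed.

(** Among the sign patterns of a, b, c and a c - b, those that would violate the identity are
    inconsistent over the reals. *)
Lemma sgn3_sign_rule a b c :
  let e := sgn3 (a * c - b) a 1 in let k := sgn3 b c 1 in
  let X := sgn3 (- c) (-1) 0 in
  ~~ (X (+) k (+) ((X (+) e) && (X (+) ~~ k))) =
  (e && sgn3 a 1 0) (+) (sgn3 a 1 0 && ~~ k).
Proof.
rewrite /sgn3 !oppr_eq0 oner_eq0 /= !oppr_lt0 !ltr10 ltr01.
move dE : (a * c - b) => d.
case: (ltrgt0P a) => a0; case: (ltrgt0P b) => b0; case: (ltrgt0P c) => c0;
  case: (ltrgt0P d) => d0 //=; exfalso; nra.
Qed.

(** Right multiplication by a lower unipotent costs a cocycle value and the sign of its lift. Both
    involve the signs of b and a c - b, which cancel between them. *)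
Lemma nminus_transport p q r x y z a b c : p * q * r != 0 ->
  sigma (nmx x y z *m tmx p q r *m (walpha1 *m walpha2)) (lower a b c) (+)
  (sigma wlmx (wlmx : 'M[R]_3) (+) sigma wlmx (nmx (- c) (- a) b) (+)
   sigma (wlmx *m nmx (- c) (- a) b) wlmx) = (q < 0) && (a < 0).
Proof.
move=> a0; rewrite sigma_cell12 ?det_lower // nminus_sign /=.
rewrite /lower walpha2_mx3 walpha1_mx3 !s2_mx3 !s3_mx3.
have -> : - b * 1 - - c * a = a * c - b by ring.
have -> : - c * - a - b = a * c - b by ring.
have -> : - b * 0 - -1 * a = a by ring.
have -> : - c * 0 - -1 * 1 = 1 :> R by ring.
rewrite !(oppr0, arith_signs) !(sgn3_neq0 _ _ (oner_neq0 R)) ltr10 sgn3_sign_rule.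
rewrite /simple_bits.
have -> : (a < 0) = sgn3 a 1 0.
  by rewrite /sgn3; case: eqVneq => [->|//]; rewrite oner_eq0 ltxx ltr10.
by case: (q < 0); case: (p < 0); case: (sgn3 a _ _); case: (sgn3 b _ _); case: (sgn3 (_ - _) _ _).
Qed.
End Signs.

(** * Evaluation of sections on N w M A N_- *)

Section Transport.
Variable R : realType.
Implicit Types (x y z p q r t : R) (P Q : Gt R).

Lemma Gt_eq P Q : val P.1 = val Q.1 -> P.2 = Q.2 -> P = Q.
Proof. by case: P Q => [g b] [h c] /= /val_inj -> ->. Qed.

Lemma val_gmul P Q : val (P *t Q).1 = val P.1 *m val Q.1.
Proof. by []. Qed.

Lemma sign_gmul P Q : (P *t Q).2 = P.2 (+) Q.2 (+) sigma (val P.1) (val Q.1).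
Proof. by []. Qed.

Lemma val_sl_inv (g : SL3 R) h : val g *m h = 1%:M -> val (sl_inv g) = h.
Proof. exact: invmx_eq. Qed.

Lemma val_nminus x y z : val (nminus x y z).1 = lower (- y) z (- x).
Proof. by rewrite !val_gmul /= (invmx_eq (wlmxK R)) wlmx_nmx. Qed.

Lemma sign_nminus x y z : (nminus x y z).2 =
  sigma wlmx (wlmx : 'M[R]_3) (+) sigma wlmx (nmx x y z) (+)
  sigma (wlmx *m nmx x y z) wlmx.
Proof. by rewrite !sign_gmul /= (invmx_eq (wlmxK R)) !addbF. Qed.

(** Carries the torus to the left of the Weyl element, the form in which [sigma_cell12] applies. *)
Lemma wmx_tmx p q r :
  wmx *m tmx p q r = tmx (- r) (- p) q *m (walpha1 *m walpha2).
Proof.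
have [E _ _] := wprodE R; move: E; rewrite /wprod /= mulmx1 => ->.
rewrite /wmx /tmx !mul_mx3.
by congr_mx3; ring.
Qed.

Lemma tmx1 : tmx 1 1 1 = 1%:M :> 'M[R]_3.
Proof. by rewrite one_mx3. Qed.

Lemma tmxM p q r p' q' r' : tmx p q r *m tmx p' q' r' = tmx (p * p') (q * q') (r * r').
Proof.
rewrite /tmx mul_mx3.
by congr_mx3; ring.
Qed.

Lemma wmxE : wmx = tmx (-1) (-1) 1 *m (walpha1 *m walpha2) :> 'M[R]_3.
Proof. by rewrite -wmx_tmx tmx1 mulmx1. Qed.

Lemma pm1P (e : R) : e \in [:: 1; -1] -> e = 1 \/ e = -1.
Proof. by rewrite !inE => /orP[] /eqP; [left|right]. Qed.

Lemma sigma_wmx_sign m1 m2 x y z : m1 \in [:: 1; -1] -> m2 \in [:: 1; -1] ->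
  sigma (nmx x y z *m wmx) (tmx m1 m2 (m1 * m2) : 'M[R]_3) = (m1 < 0).
Proof.
move=> h1 h2; rewrite wmxE mulmxA sigma_cell12; last first.
- by rewrite det_tmx; case: (pm1P h1) => ->; case: (pm1P h2) => ->; ring.
- by rewrite !mulf_neq0 ?oppr_eq0 ?oner_eq0.
rewrite /= /tmx walpha2_mx3 walpha1_mx3 !s2_mx3 !s3_mx3.
by case: (pm1P h1) => ->; case: (pm1P h2) => ->;
  rewrite !(oppr0, arith_signs) /sgn3 !(eqxx, oppr_eq0, oner_eq0) /= !(oppr_lt0, ltr01, ltr10) //.
Qed.

Lemma sigma_wmx_pos p q r a1 a2 a3 x y z : p * q * r != 0 ->
  0 < a1 -> 0 < a2 -> 0 < a3 -> a1 * a2 * a3 = 1 ->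
  sigma (nmx x y z *m tmx p q r *m (walpha1 *m walpha2)) (tmx a1 a2 a3) = false.
Proof.
move=> a0 h1 h2 h3 a1E; rewrite sigma_cell12 ?det_tmx //.
rewrite /= /tmx walpha2_mx3 walpha1_mx3 !s2_mx3 !s3_mx3.
rewrite !(oppr0, arith_signs, mulNr, mulrN, opprK) /sgn3 !(eqxx, oppr_eq0, mulf_eq0).
rewrite !(gt_eqF h1, gt_eqF h2, gt_eqF h3) /=.
rewrite !(pmulr_rlt0 _ h1) !(pmulr_rlt0 _ h2) (pmulr_rlt0 _ h3) !(lt_gtF h2) !(lt_gtF h3).
by rewrite !andbF.
Qed.

Lemma sigma_nw x y z : sigma (nmx x y z) wmx = false :> bool.
Proof. by apply: sigma_nmxl; exact/eqP/wSL_subproof. Qed.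

(* The lift of m is normalised by the cover element it carries, so that the
   total sign below can be matched by choosing m.2. *)
Lemma transport_eq x y z m1 m2 a1 a2 a3 l21 l31 l32 (m a P : Gt R) :
  m1 \in [:: 1; -1] -> m2 \in [:: 1; -1] -> val m.1 = tmx m1 m2 (m1 * m2) ->
  0 < a1 -> 0 < a2 -> 0 < a3 -> val a.1 = tmx a1 a2 a3 -> a.2 = false ->
  val P.1 = nmx x y z *m wmx *m tmx (m1 * a1) (m2 * a2) (m1 * m2 * a3) *m
            lower l21 l31 l32 ->
  P.2 = m.2 (+) (m1 < 0) (+) ((0 < m1) && (l21 < 0)) ->
  P = nt x y z *t wt *t m *t a *t nminus (- l32) (- l21) l31.
Proof.
move=> h1 h2 mE p1 p2 p3 aE a0 PE Ps.
have da : a1 * a2 * a3 = 1 by rewrite -det_tmx -aE SL3_det.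
have n1 : m1 != 0 by case: (pm1P h1) => ->; rewrite ?oppr_eq0 oner_eq0.
have n2 : m2 != 0 by case: (pm1P h2) => ->; rewrite ?oppr_eq0 oner_eq0.
have := sign_nminus (- l32) (- l21) l31; have := val_nminus (- l32) (- l21) l31.
move: (nminus _ _ _) => N Nv Ns.
apply: Gt_eq.
  by rewrite PE !val_gmul Nv aE mE /= !opprK -!mulmxA; congr (_ *m (_ *m _));
     rewrite mulmxA tmxM.
rewrite Ps !sign_gmul Ns !val_gmul Nv aE mE a0 /= !opprK.
rewrite sigma_nw sigma_wmx_sign // addbF.
have E1 : nmx x y z *m wmx *m tmx m1 m2 (m1 * m2) = nmx x y z *m
    tmx (- (m1 * m2)) (- m1) m2 *m (walpha1 *m walpha2).
  by rewrite -mulmxA wmx_tmx mulmxA.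
have E2 : nmx x y z *m wmx *m tmx m1 m2 (m1 * m2) *m tmx a1 a2 a3 = nmx x y z *m
    tmx (- (m1 * m2 * a3)) (- (m1 * a1)) (m2 * a2) *m (walpha1 *m walpha2).
  by rewrite -mulmxA tmxM -mulmxA wmx_tmx mulmxA.
rewrite E2 E1 sigma_wmx_pos //; last by rewrite !mulf_neq0 ?oppr_eq0 ?mulf_neq0.
rewrite !addbF.
have := @nminus_transport R (- (m1 * m2 * a3)) (- (m1 * a1)) (m2 * a2) x y z l21 l31 l32.
rewrite oppr_lt0 pmulr_lgt0 // => <-; last first.
  by rewrite !mulf_neq0 ?oppr_eq0 ?mulf_neq0 // gt_eqF.
by case: (m.2); case: (m1 < 0); do 4 case: (sigma _ _).
Qed.

Lemma prod_ord3 (S : comPzRingType) (F : 'I_3 -> S) :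
  \prod_(i < 3) F i = F 0 * F 1 * F 2.
Proof.
rewrite !big_ord_recl big_ord0 mulr1 mulrA.
by congr (_ * _ * _); congr F; apply: val_inj.
Qed.

(** Reduces the value at P to a factorisation of its matrix and one Boolean equation; the products
    in the cover stay hidden in [transport_eq]. The exponents are those of mu - rho. *)
Lemma V_transport mu eta f x y z m1 m2 a1 a2 a3 l21 l31 l32 (m P : Gt R) :
  Vsmooth mu eta f ->
  m1 \in [:: 1; -1] -> m2 \in [:: 1; -1] -> val m.1 = tmx m1 m2 (m1 * m2) ->
  0 < a1 -> 0 < a2 -> 0 < a3 -> a1 * a2 * a3 = 1 ->
  val P.1 = nmx x y z *m wmx *m tmx (m1 * a1) (m2 * a2) (m1 * m2 * a3) *m
            lower l21 l31 l32 ->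
  P.2 = m.2 (+) (m1 < 0) (+) ((0 < m1) && (l21 < 0)) ->
  f P = (cpow a1 (- (mu 0 0 - 1)) * cpow a2 (- mu 0 1) *
         cpow a3 (- (mu 0 2 + 1))) *: (eta (ginv m) *m f (nt x y z *t wt)).
Proof.
move=> [_ fV] h1 h2 mE p1 p2 p3 da PE Ps.
have dt : \det (tmx a1 a2 a3) == 1 by rewrite det_tmx da.
pose a : Gt R := (Sub (tmx a1 a2 a3) dt, false).
rewrite (@transport_eq x y z m1 m2 a1 a2 a3 l21 l31 l32 m a P) //.
rewrite fV; last 2 first.
- by exists m1, m2.
- by split => //; exists a1, a2, a3.
congr (_ *: _); rewrite prod_ord3 /rho !mxE /=.
by rewrite subr0 opprK.
Qed.
End Transport.

(** * Complex powers *)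

Section Cpow.
Variable R : realType.
Implicit Types (a x y t : R) (s : R[i]).

Lemma cisD x y : cis (x + y) = cis x * cis y :> R[i].
Proof.
by apply/eqP; rewrite /cis sinD cosD eq_complex /=; apply/andP; split; apply/eqP; ring.
Qed.

Lemma cis0 : cis 0 = 1 :> R[i].
Proof. by rewrite /cis sin0 cos0. Qed.

Lemma cisN x : cis (- x) = (cis x)^-1 :> R[i].
Proof. by apply/esym/mulr1_eq; rewrite -cisD subrr cis0. Qed.

Lemma cpowD a s s' : cpow a (s + s') = cpow a s * cpow a s'.
Proof.
rewrite /cpow !raddfD /= !mulrDl expRD cisD rmorphM /=; ring.
Qed.

Lemma cpow1 s : cpow 1 s = 1 :> R[i].
Proof. by rewrite /cpow ln1 !mulr0 expR0 cis0 mulr1. Qed.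

Lemma cpowV a s : 0 < a -> cpow a^-1 s = cpow a (- s).
Proof. by move=> a0; rewrite /cpow lnV ?posrE // !raddfN /= !mulNr !mulrN. Qed.

Lemma normc_cis t : normc (cis t : R[i]) = 1.
Proof. by rewrite /normc /cis cos2Dsin2 sqrtr1. Qed.

Lemma normc_cpow a s : normc (cpow a s) = expR (Re s * ln a).
Proof.
rewrite /cpow Normc.normcM normc_cis mulr1 /normc /=.
by rewrite expr0n /= addr0 sqrtr_sqr ger0_norm // expR_ge0.
Qed.
End Cpow.

(** * The dual of phi on M *)

Section Eta.
Variable R : realType.
Local Notation C := R[i].

Definition mx2 (a b c d : C) : 'M[C]_2 :=
  \matrix_(i, j) nth 0 (nth [::] [:: [:: a; b]; [:: c; d]] i) j.

Lemma ord2P (P : 'I_2 -> Prop) : P 0 -> P 1 -> forall i, P i.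
Proof.
move=> P0 P1 [[|[|//]] hi].
- by rewrite (_ : Ordinal hi = 0) //; apply: val_inj.
- by rewrite (_ : Ordinal hi = 1) //; apply: val_inj.
Qed.

Lemma mul_mx2 a b c d a' b' c' d' : mx2 a b c d *m mx2 a' b' c' d' =
  mx2 (a * a' + b * c') (a * b' + b * d') (c * a' + d * c') (c * b' + d * d').
Proof.
by apply/matrixP; do 2 elim/ord2P; rewrite !mxE !big_ord_recl big_ord0 !mxE /= addr0.
Qed.

Lemma one_mx2 : 1%:M = mx2 1 0 0 1.
Proof. by apply/matrixP; do 2 elim/ord2P; rewrite !mxE. Qed.

Lemma scale_mx2 k a b c d : k *: mx2 a b c d = mx2 (k * a) (k * b) (k * c) (k * d).
Proof. by apply/matrixP; do 2 elim/ord2P; rewrite !mxE. Qed.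

Lemma tr_mx2 a b c d : (mx2 a b c d)^T = mx2 a c b d.
Proof. by apply/matrixP; do 2 elim/ord2P; rewrite !mxE. Qed.

Lemma mul_mx2_cV a b c d (v : 'cV[C]_2) :
  (mx2 a b c d *m v) 0 0 = a * v 0 0 + b * v 1 0 /\
  (mx2 a b c d *m v) 1 0 = c * v 0 0 + d * v 1 0.
Proof.
rewrite !mxE !big_ord_recl !big_ord0 !mxE /= !addr0.
by split; congr (_ + _ * v _ _); apply: val_inj.
Qed.

Let J := mx2 0 (-1) 1 0.
Let D := mx2 (- 'i) 0 0 'i.

Lemma phiE (m : Gt R) :
  phi m = (-1) ^+ m.2 *: (J ^+ (val m.1 0 0 < 0)%R *m D ^+ (val m.1 1 1 < 0)%R).
Proof. by []. Qed.

Lemma sqr_sign (b : bool) : (-1) ^+ b * (-1) ^+ b = 1 :> C.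
Proof. by rewrite -signr_addb addbb. Qed.

Lemma invmx_sign (b : bool) (A B : 'M[C]_2) : A *m B = 1%:M ->
  invmx ((-1) ^+ b *: A) = (-1) ^+ b *: B.
Proof.
move=> AB; apply: invmx_eq.
by rewrite -scalemxAl -scalemxAr AB scalerA sqr_sign scale1r.
Qed.

Lemma ii : 'i * 'i = -1 :> C.
Proof. by rewrite -expr2 sqr_i. Qed.

Lemma sign_ginv (m : Gt R) :
  (ginv m).2 = m.2 (+) sigma (val m.1) (val (ginv m).1).
Proof. by []. Qed.

Lemma contra_phi1 (m : Gt R) : val m.1 = tmx 1 1 (1 * 1) ->
  contragredient phi (ginv m) = (-1) ^+ m.2 *: 1%:M.
Proof.
move=> mE; have vE : val (ginv m).1 = tmx 1 1 (1 * 1).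
  by apply: val_sl_inv; rewrite mE tmxM !mulr1 tmx1.
have sE : (ginv m).2 = m.2.
  by rewrite sign_ginv vE mE sigma_tmx ?det_tmx ?mulr1 ?oner_eq0 // ltr10 addbF.
rewrite /contragredient phiE vE sE !mxE /= ltr10 !expr0 mulmx1.
by rewrite (invmx_sign _ (mulmx1 _)) linearZ /= trmx1.
Qed.

(** The lifts of t(-1,1,-1) have order four in the cover, so inversion flips the sign component. *)
Lemma contra_phi2 (m : Gt R) : val m.1 = tmx (-1) 1 (-1 * 1) ->
  contragredient phi (ginv m) = (-1) ^+ m.2 *: mx2 0 1 (-1) 0.
Proof.
move=> mE; have vE : val (ginv m).1 = tmx (-1) 1 (-1 * 1).
  by apply: val_sl_inv; rewrite mE tmxM !mulr1 mulrNN mulr1 tmx1.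
have sE : (ginv m).2 = ~~ m.2.
  have d1 : -1 * 1 * (-1 * 1) = 1 :> R by ring.
  rewrite sign_ginv vE mE sigma_tmx ?det_tmx ?d1 ?oner_eq0 // ltr10 ltrN10 /=.
  rewrite /tmx s2_mx3 !(mul0r, mulr0, subr0, sgn3_0, eqxx) /= !mulr1 mul1r.
  by rewrite ltrN10 !addbT ?addbF.
rewrite /contragredient phiE vE sE !mxE /= ltr10 ltrN10 expr0 expr1 mulmx1.
have JJ : J *m mx2 0 1 (-1) 0 = 1%:M by rewrite /J mul_mx2 one_mx2; congr mx2; ring.
rewrite (invmx_sign _ JJ) linearZ /= tr_mx2 signrN !scale_mx2.
by congr mx2; ring.
Qed.

Lemma contra_phi3 (m : Gt R) : val m.1 = tmx 1 (-1) (1 * -1) ->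
  contragredient phi (ginv m) = (-1) ^+ m.2 *: mx2 (- 'i) 0 0 'i.
Proof.
move=> mE; have vE : val (ginv m).1 = tmx 1 (-1) (1 * -1).
  by apply: val_sl_inv; rewrite mE tmxM !mulr1 !mul1r mulrNN mulr1 tmx1.
have sE : (ginv m).2 = ~~ m.2.
  have d1 : 1 * -1 * (1 * -1) = 1 :> R by ring.
  rewrite sign_ginv vE mE sigma_tmx ?det_tmx ?d1 ?oner_eq0 // ltr10 ltrN10 /=.
  by rewrite /tmx s3_mx3 !sgn3_0 eqxx /= mul1r ltrN10 addbT.
rewrite /contragredient phiE vE sE !mxE /= ltr10 ltrN10 expr0 expr1 mul1mx.
have DD : D *m mx2 'i 0 0 (- 'i) = 1%:M.
  rewrite /D mul_mx2 one_mx2.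
  by congr mx2; [rewrite mulNr ii|..|rewrite mulrN ii]; ring.
rewrite (invmx_sign _ DD) linearZ /= tr_mx2 signrN !scale_mx2.
  by congr mx2; rewrite ?(mulr0, mul0r, addr0, add0r, mulNr, mulrN, ii, opprK).
Qed.
End Eta.

(** * The value contributed by one coset *)

Section Coset.
Variable R : realType.
Local Notation C := R[i].
Implicit Types (x y z t : R) (f : vfun R) (lambda : 'rV[C]_3).

Definition wval f (j : 'I_2) t : C := f (nt 0 t 0 *t wt) j 0.

Lemma val_nwt x y z : val (nt x y z *t wt : Gt R).1 = nmx x y z *m wmx.
Proof. by []. Qed.

(** w^-1 n(x,0,z) w lies in N_-, and the Boolean equation shows that its lift introduces no sign. *)
Lemma wval_nt mu f x y z : Vphi mu f ->
  f (nt x y z *t wt) = f (nt 0 y 0 *t wt).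
Proof.
move=> Vf; have d1 : \det (tmx 1 1 (1 * 1) : 'M[R]_3) == 1 by rewrite det_tmx !mulr1.
pose m : Gt R := (Sub (tmx 1 1 (1 * 1)) d1, false).
have mE : val m.1 = tmx 1 1 (1 * 1) by [].
rewrite (@V_transport _ mu (contragredient phi) f 0 y 0 1 1 1 1 1 0 x (- z) m) //; first last.
- by rewrite sign_gmul /= sigma_nw ltxx ltr10 andbF.
- rewrite val_nwt !mulr1 tmx1 mulmx1 /nmx /wmx /lower !mul_mx3.
  by congr_mx3; ring.
- by rewrite !mulr1.
- by rewrite inE eqxx.
- by rewrite inE eqxx.
by rewrite (contra_phi1 mE) !cpow1 !mulr1 !scale1r mul1mx.
Qed.

(** This element of M exchanges the two components: it is how the second component of f enters,
    although [tau] reads only the first. *)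
Lemma contra_phi2_app (m : Gt R) (v : 'cV[C]_2) : val m.1 = tmx (-1) 1 (-1 * 1) ->
  (contragredient phi (ginv m) *m v) 0 0 = (-1) ^+ m.2 * v 1 0.
Proof.
move=> mE; rewrite (contra_phi2 mE) -scalemxAl mxE.
by have [-> _] := mul_mx2_cV 0 1 (-1) 0 v; rewrite mul0r add0r mul1r.
Qed.

Lemma contra_phi3_app (m : Gt R) (v : 'cV[C]_2) : val m.1 = tmx 1 (-1) (1 * -1) ->
  (contragredient phi (ginv m) *m v) 0 0 = (-1) ^+ m.2 * (- 'i * v 0 0).
Proof.
move=> mE; rewrite (contra_phi3 mE) -scalemxAl mxE.
by have [-> _] := mul_mx2_cV (- 'i) 0 0 'i v; rewrite mul0r addr0.
Qed.

Lemma ginv_nt x y z : ginv (nt x y z) = nt (- x) (- y) (x * y - z) :> Gt R.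
Proof.
have vE : val (ginv (nt x y z)).1 = nmx (- x) (- y) (x * y - z).
  by apply: val_sl_inv; exact: nmxK.
by apply: Gt_eq => //; rewrite sign_ginv vE sigma_nmxl ?det_nmx.
Qed.

Lemma ginvK_nt x y z : ginv (ginv (nt x y z)) = nt x y z :> Gt R.
Proof. by rewrite !ginv_nt; congr nt; ring. Qed.

Lemma sign_nt_mul x y z (P : Gt R) : (nt x y z *t P).2 = P.2.
Proof. by rewrite sign_gmul /= sigma_nmxl ?addbF // SL3_det. Qed.

(** Holds because the cocycle is trivial when its left argument lies in N and unchanged when that
    argument is multiplied by N on the left. *)
Lemma nt_mulA x y z (P Q : Gt R) : nt x y z *t (P *t Q) = nt x y z *t P *t Q.
Proof.
apply: Gt_eq; first by rewrite !val_gmul mulmxA.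
by rewrite sign_nt_mul !sign_gmul !val_gmul sigma_nmx sigma_nmxl ?SL3_det ?addbF.
Qed.

Section Block.
Variables (g : SL3 R) (b : bool) (u v e k h i : R).
Hypothesis (gE : val g = mx3 [:: [:: 1; u; v]; [:: 0; e; k]; [:: 0; h; i]]).
Hypothesis h0 : h != 0.

Let dE : e * i - k * h = 1.
Proof. by have := SL3_det g; rewrite gE det_mx3 !mxE /= => <-; ring. Qed.

Let gi : 'M[R]_3 := mx3 [:: [:: 1; v * h - u * i; u * k - v * e];
  [:: 0; i; - k]; [:: 0; - h; e]].

Lemma val_block_inv : val (sl_inv g) = gi.
Proof.
apply: val_sl_inv; rewrite gE mul_mx3 one_mx3.
congr_mx3; try ring; rewrite -dE; ring.
Qed.

Let gi_cell : gi = nmx (h * (u * k - v * e) + (v * h - u * i) * e) (- i / h)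
    (- (v * h - u * i) / h) *m tmx 1 (- h^-1) (- h) *m walpha2 *m nmx 0 (- e / h) 0.
Proof.
rewrite /gi /nmx /tmx /walpha2 !mul_mx3.
congr_mx3; try by field.
have -> : k = (e * i - 1) / h by rewrite -dE; field.
by field.
Qed.

Let d0 : 1 * - h^-1 * - h != 0.
Proof. by rewrite mul1r mulrNN mulVf // oner_eq0. Qed.

(** In the sign of [coset_point] the value at (g, g^-1) occurs twice and cancels, while the value at
    (g^-1, g) occurs once and has to be known. *)
Lemma sigma_block_inv : sigma gi (val g) = false.
Proof.
rewrite gi_cell sigma_cell2 ?SL3_det //.
have -> : nmx 0 (- e / h) 0 *m val g = mx3 [:: [:: 1; u; v]; [:: 0; 0; - h^-1]; [:: 0; h; i]].
  rewrite gE /nmx mul_mx3.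
  congr_mx3; try by field.
  have -> : k = (e * i - 1) / h by rewrite -dE; field.
  by field.
rewrite walpha2_mx3 !s2_mx3 !s3_mx3.
have -> : 0 * i - - h^-1 * h = 1 by field.
have -> : - h * - h^-1 - - i * 0 = 1 by field.
rewrite !(oppr0, arith_signs) ltr10 !sgn3_0 eqxx /= ltr10.
rewrite !oppr_lt0 !invr_gt0 h0 /simple_bits /=.
by case: ltrgt0P h0.
Qed.

Lemma sigma_block_wl : sigma gi wlmx = (h < 0) && (e <= 0).
Proof.
rewrite gi_cell sigma_cell2 ?det_wlmx //.
have -> : nmx 0 (- e / h) 0 *m wlmx =
    mx3 [:: [:: 0; 0; 1]; [:: - e / h; - 1; 0]; [:: 1; 0; 0]].
  rewrite wlmxE /nmx mul_mx3.
  by congr_mx3; ring.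
rewrite walpha2_mx3 !s2_mx3 !s3_mx3 !(oppr0, arith_signs).
rewrite ltr10 !(sgn3_neq0 _ _ (oner_neq0 R)) ltr10 /=.
have eE : e = - (- e / h) * h by field.
rewrite {3}eE; move: (- e / h) => w.
rewrite oppr_lt0 invr_gt0 /sgn3 oppr_eq0 oner_eq0 /= ltrN10 /simple_bits mulNr oppr_le0.
have [hp|hn|he] := ltrgt0P h; last by move: h0; rewrite he eqxx.
  by case: ifP => _; rewrite ?andbT /=; case: (w < 0).
rewrite nmulr_lge0 //= !(addFb, andbT, andbF).
by case: (ltrgt0P w).
Qed.

(** Unfolding [pi_dist (ginv (g, b)) tau f] leaves three formal inverses before [wl]: the inverse of
    the splitting, the one in the dual action, and the one in [pi_fun]. They are evaluated as they
    stand. *)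
Definition coset_point : Gt R := ginv (ginv (ginv (g, b))) *t wl.

Lemma val_coset_point : val coset_point.1 = gi *m wlmx.
Proof.
rewrite val_gmul; congr (_ *m _); rewrite -val_block_inv.
by rewrite /= !invmxK.
Qed.

Lemma sign_coset_point : coset_point.2 = b (+) ((h < 0) && (e <= 0)).
Proof.
pose Q1 := ginv (g, b); pose Q2 := ginv Q1; pose Q3 := ginv Q2.
have v1 : val Q1.1 = gi := val_block_inv.
have v2 : val Q2.1 = val g by rewrite /= invmxK.
have v3 : val Q3.1 = gi by rewrite -val_block_inv /= invmxK.
rewrite /coset_point -/Q1 -/Q2 -/Q3 sign_gmul v3 sigma_block_wl.
rewrite [Q3.2]sign_ginv v3 v2 [Q2.2]sign_ginv v1 v2 [Q1.2]sign_ginv v1 /=.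
by rewrite sigma_block_inv !addbF addbK.
Qed.

(** The matrix factors through w with torus part t(-1/h, h, -1), so the sign of h selects the
    element of M: t(-1,1,-1) for h > 0, which exchanges the components, and t(1,-1,-1) for h < 0,
    which multiplies the first by -i. *)
Lemma coset_value mu f x y z : Vphi mu f ->
  f (nt x y z *t coset_point) 0 0 =
  cpow `|h| (mu 0 0 - 1 - mu 0 1) * (-1) ^+ b *
  (if h < 0 then 'i * wval f 0 (y - i / h) else - wval f 1 (y - i / h)).
Proof.
move=> Vf; set P := _ *t coset_point.
have PE (m1 m2 a1 a2 : R) : m1 * m2 = -1 -> m1 * a1 = - h^-1 -> m2 * a2 = h ->
  val P.1 = nmx x (y - i / h) (z - x * i / h) *m wmx *m
    tmx (m1 * a1) (m2 * a2) (m1 * m2 * 1) *m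
    lower (e / h) (u * k - v * e) (u * i - v * h).
  move=> -> -> ->; rewrite mulr1 val_gmul val_coset_point wlmxE.
  rewrite /gi /= /nmx /wmx /tmx /lower !mul_mx3.
  congr_mx3; try by field.
  - have -> : k = (e * i - 1) / h by rewrite -dE; field.
    by field.
  - have -> : k = (e * i - 1) / h by rewrite -dE; field.
    by field.
have Ps : P.2 = b (+) ((h < 0) && (e <= 0)).
  by rewrite sign_nt_mul sign_coset_point.
have cE a1 : a1 = `|h| -> cpow a1^-1 (- (mu 0 0 - 1)) * cpow a1 (- mu 0 1) *
    cpow 1 (- (mu 0 2 + 1)) = cpow `|h| (mu 0 0 - 1 - mu 0 1).
  move=> ->; rewrite cpow1 mulr1 cpowV ?normr_gt0 // opprK -cpowD //.
have [hp|hn|he] := ltrgt0P h; last by move: h0; rewrite he eqxx.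
- have d1 : \det (tmx (-1) 1 (-1 * 1) : 'M[R]_3) == 1.
    by rewrite det_tmx; apply/eqP; ring.
  (* [~~ b] compensates the bit [m1 < 0] in the sign equation. *)
  pose m : Gt R := (Sub (tmx (-1) 1 (-1 * 1)) d1, ~~ b).
  rewrite (@V_transport _ mu (contragredient phi) f x (y - i / h) (z - x * i / h)
    (-1) 1 h^-1 h 1 (e / h) (u * k - v * e) (u * i - v * h) m) //; first last.
  - by rewrite Ps (lt_gtF hp) /= ltrN10 addbF oppr_gt0 ltr10 addbF addbT negbK.
  - by apply: PE; rewrite ?mulr1 ?mulN1r ?mul1r.
  - by rewrite mulr1 mulVf.
  - by rewrite invr_gt0.
  - by rewrite !inE eqxx.
  - by rewrite !inE eqxx orbT.
  rewrite mxE contra_phi2_app // cE ?gtr0_norm // (wval_nt _ _ _ Vf) -/(wval f 1 _).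
  by rewrite signrN; ring.
- have d1 : \det (tmx 1 (-1) (1 * -1) : 'M[R]_3) == 1.
    by rewrite det_tmx; apply/eqP; ring.
  (* [~~ b] turns the bit [e <= 0] of the point into the required bit e / h < 0, that is e > 0. *)
  pose m : Gt R := (Sub (tmx 1 (-1) (1 * -1)) d1, ~~ b).
  rewrite (@V_transport _ mu (contragredient phi) f x (y - i / h) (z - x * i / h)
    1 (-1) (- h)^-1 (- h) 1 (e / h) (u * k - v * e) (u * i - v * h) m) //; first last.
  - rewrite Ps hn ltr10 ltr01 /= addbF nmulr_llt0 ?invr_lt0 // ltNge.
    by case: b; case: (e <= 0).
  - by apply: PE; rewrite ?mulr1 ?mulN1r ?mul1r ?opprK // invrN.
  - by rewrite mulr1 mulVf // oppr_eq0.
  - by rewrite oppr_gt0.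
  - by rewrite invr_gt0 oppr_gt0.
  - by rewrite !inE eqxx orbT.
  - by rewrite !inE eqxx.
  rewrite mxE contra_phi3_app // cE ?ltr0_norm // (wval_nt _ _ _ Vf) -/(wval f 0 _).
  by rewrite signrN; ring.
Qed.
End Block.
End Coset.

(** * Cosets and bottom rows *)

Section Cosets.
Variable R : realType.
Implicit Types (g : SL3 R) (h i : int).

Definition block_mx3 (u v e k h i : int) : 'M[R]_3 :=
  mx3 [:: [:: 1; u%:~R; v%:~R]; [:: 0; e%:~R; k%:~R]; [:: 0; h%:~R; i%:~R]].

Definition bottom_row h i : set (SL3 R) :=
  [set g | exists u v e k : int, val g = block_mx3 u v e k h i].

Definition good_row h i : Prop :=
  [/\ h != 0, (4 %| h)%Z, (i = 1 %[mod 4])%Z & coprimez h i].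

Lemma det_block u v e k h i (g : SL3 R) :
  val g = block_mx3 u v e k h i -> e * i - k * h = 1.
Proof.
move=> gE; have := SL3_det g; rewrite gE det_mx3 !mxE /= => E.
have E1 : e%:~R * i%:~R - k%:~R * h%:~R = 1 :> R by rewrite -[RHS]E; ring.
by apply/eqP; rewrite -(eqr_int R) !(rmorphB, rmorphM) /= E1.
Qed.

(** In this cell the first column is (a,0,0); the integer a divides the determinant 1, and a = 1 mod
    4 excludes a = -1. *)
Lemma Gamma_cell2_row g : Gamma g -> cell2 g ->
  exists h i, good_row h i /\ bottom_row h i g.
Proof.
move=> [A [gE Am]] [n [x [y [z ->]]] [b ub gE2]].
have gA (r s : 'I_3) : val g r s = (A r s)%:~R by rewrite gE mxE.
have [b10 b20 b21] : [/\ b 1 0 = 0, b 2 0 = 0 & b 2 1 = 0] by split; apply: ub.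
have E : val g = mx3 [:: [:: b 0 0; b 0 1 + z * b 1 1; b 0 2 - x * b 2 2 + z * b 1 2];
   [:: 0; y * b 1 1; y * b 1 2 - b 2 2]; [:: 0; b 1 1; b 1 2]].
  rewrite gE2 [b in LHS]mx3_eta b10 b20 b21 /nmx /walpha2 !mul_mx3.
  by congr_mx3; ring.
have E10 : A 1 0 = 0 by apply/eqP; rewrite -(intr_eq0 R) -gA E mxE.
have E20 : A 2 0 = 0 by apply/eqP; rewrite -(intr_eq0 R) -gA E mxE.
have dA : A 0 0 * (A 1 1 * A 2 2 - A 1 2 * A 2 1) = 1.
  have := SL3_det g; rewrite det_mx3 !gA E10 E20 => d.
  have d' : (A 0 0)%:~R * ((A 1 1)%:~R * (A 2 2)%:~R - (A 1 2)%:~R * (A 2 1)%:~R) = 1 :> R.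
    by rewrite -[RHS]d; ring.
  by apply/eqP; rewrite -(eqr_int R) !(rmorphB, rmorphM) /= d'.
have m00 := Am 0 0 isT; have m21 := Am 2 1 isT; have m22 := Am 2 2 isT.
have A00 : A 0 0 = 1.
  move: dA m00; set a := A 0 0 => dA m00; have : (a %| 1)%Z.
    by apply/dvdzP; exists (A 1 1 * A 2 2 - A 1 2 * A 2 1); rewrite mulrC dA.
  rewrite dvdz1; move: m00 => /=; lia.
rewrite A00 mul1r in dA.
have h0 : A 2 1 != 0.
  apply/eqP => h0; have : val g 2 1 = 0 by rewrite gA h0.
  rewrite E mxE /= => b11; have := SL3_det g; rewrite E det_mx3 !mxE /= b11.
  by move/eqP; rewrite eq_sym !(mulr0, mul0r, subr0, addr0) oner_eq0.
exists (A 2 1), (A 2 2); split.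
  split=> //; first by apply/dvdz_mod0P; rewrite m21.
  apply/coprimezP; exists (- A 1 2, A 1 1) => /=; rewrite -dA; ring.
exists (A 0 1), (A 0 2), (A 1 1), (A 1 2).
by rewrite [LHS]mx3_eta !gA E10 E20 A00.
Qed.

Lemma Gamma_ooP (w : SL3 R) : Gamma_oo w <->
  exists a b c : int, val w = nmx a%:~R b%:~R c%:~R.
Proof.
split=> [[[x [y [z wE]]] [A AE]]|[a [b [c wE]]]].
  exists (A 0 1), (A 1 2), (A 0 2); rewrite wE; congr nmx.
  - by have := congr1 (fun M : 'M[R]_3 => M 0 1) AE; rewrite wE !mxE.
  - by have := congr1 (fun M : 'M[R]_3 => M 1 2) AE; rewrite wE !mxE.
  - by have := congr1 (fun M : 'M[R]_3 => M 0 2) AE; rewrite wE !mxE.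
split; first by do 3 eexists; exact: wE.
exists (\matrix_(r, s) nth 0 (nth [::] [:: [:: 1; a; c]; [:: 0; 1; b]; [:: 0; 0; 1]] r) s).
by rewrite wE; apply/matrixP; do 2 elim/ord3P; rewrite !mxE.
Qed.

Lemma bottom_row_mul h i (w g : SL3 R) :
  Gamma_oo w -> bottom_row h i g -> bottom_row h i (sl_mul w g).
Proof.
move=> /Gamma_ooP[a [b [c wE]]] [u [v [e [k gE]]]].
exists (u + a * e + c * h), (v + a * k + c * i), (e + b * h), (k + b * i).
rewrite /= wE gE /nmx /block_mx3 mul_mx3 !(rmorphD, rmorphM) /=.
by congr_mx3; ring.
Qed.

Lemma bottom_row_coset h i (g g' : SL3 R) : bottom_row h i g -> bottom_row h i g' ->
  exists2 w, Gamma_oo w & g' = sl_mul w g.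
Proof.
move=> [u [v [e [k gE]]]] [u' [v' [e' [k' gE']]]].
have d := det_block gE; have d' := det_block gE'.
(* a, b and c are the entries above the diagonal of g' g^-1. *)
pose a := (u' - u) * i - (v' - v) * h; pose c := (v' - v) * e - (u' - u) * k.
pose b := k' * e - e' * k.
exists (nSL a%:~R b%:~R c%:~R); first by apply/Gamma_ooP; exists a, b, c.
apply: val_inj; rewrite /= gE gE' /nmx /block_mx3 mul_mx3.
have eE : e' = e + b * h.
  transitivity (e + b * h + (e' * (1 - (e * i - k * h)) - e * (1 - (e' * i - k' * h)))).
    by rewrite /b; ring.
  by rewrite d d'; ring.
have kE : k' = k + b * i.
  transitivity (k + b * i + (k' * (1 - (e * i - k * h)) - k * (1 - (e' * i - k' * h)))).
    by rewrite /b; ring.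
  by rewrite d d'; ring.
have uE : u' = u + a * e + c * h.
  transitivity (u + a * e + c * h + (u' - u) * (1 - (e * i - k * h))).
    by rewrite /a /c; ring.
  by rewrite d; ring.
have vE : v' = v + a * k + c * i.
  transitivity (v + a * k + c * i + (v' - v) * (1 - (e * i - k * h))).
    by rewrite /a /c; ring.
  by rewrite d; ring.
rewrite [in LHS]eE [in LHS]kE [in LHS]uE [in LHS]vE !(rmorphD, rmorphM) /=.
by congr_mx3; ring.
Qed.

Lemma good_row_rep h i : good_row h i ->
  exists2 g, (Gamma `&` cell2) g & bottom_row h i g.
Proof.
move=> [h0 h4 i4 /coprimezP[[c e] /= ce]].
have dE : e * i - (- c) * h = 1 by rewrite -ce; ring.
have dt : \det (block_mx3 0 0 e (- c) h i) == 1.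
  by rewrite det_mx3 !mxE /= !(mulr0, mul0r, subr0, addr0) mul1r -!rmorphM -rmorphB dE.
pose g : SL3 R := Sub (block_mx3 0 0 e (- c) h i) dt.
exists g; last by exists 0, 0, e, (- c).
have hR : (h%:~R : R) != 0 by rewrite intr_eq0.
split.
  exists (\matrix_(r, s) nth 0 (nth [::] [:: [:: 1; 0; 0]; [:: 0; e; - c]; [:: 0; h; i]] r) s).
  split; first by apply/matrixP; do 2 elim/ord3P; rewrite !mxE.
  (* As 4 divides h and i = 1 mod 4, the Bezout identity forces e = 1 mod 4. *)
  have e4 : (e = 1 %[mod 4])%Z by move: dE => /eqP; case/dvdzP: h4 => q ->; move: i4; nia.
  have h40 : (h = 0 %[mod 4])%Z by move/dvdz_mod0P: h4 => ->.
  by do 2 elim/ord3P; rewrite // !mxE.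
exists (nmx 0 (e%:~R / h%:~R) 0); first by do 3 eexists.
exists (mx3 [:: [:: 1; 0; 0]; [:: 0; h%:~R; i%:~R]; [:: 0; 0; h%:~R^-1]]).
  by do 2 elim/ord3P; rewrite // mxE.
rewrite /= /block_mx3 /nmx /walpha2 !mul_mx3.
congr_mx3; try by field.
have -> : (- c)%:~R = (e%:~R * i%:~R - 1) / h%:~R :> R.
  have E1 : e%:~R * i%:~R - (- c)%:~R * h%:~R = 1 :> R by rewrite -!rmorphM -rmorphB dE.
  by apply: (mulIf hR); rewrite divfK // -[X in _ = _ - X]E1; ring.
by field.
Qed.

(** The sign of h is not lost in this encoding: i = 1 mod 4 makes it readable from the second
    component mod 4. *)
Definition row_key (g : SL3 R) : nat * int :=
  let h := Num.floor (val g 2 1) in let i := Num.floor (val g 2 2) in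
  ((`|h| %/ 4)%N, if h < 0 then i else - i).

Definition coset_rep (X : set (SL3 R)) : SL3 R := xget (nSL 0 0 0) X.

Definition index_set : set (nat * int) :=
  [set p | [/\ (0 < p.1)%N, odd `|p.2|%N & coprime p.1 `|p.2|%N]].

Lemma row_keyE h i g : bottom_row h i g ->
  row_key g = ((`|h| %/ 4)%N, if h < 0 then i else - i).
Proof.
by move=> [u [v [e [k gE]]]]; rewrite /row_key gE !mxE /= !intrKfloor.
Qed.

Lemma row_of_key h i : good_row h i ->
  let p := ((`|h| %/ 4)%N, if h < 0 then i else - i) in
  index_set p /\ h = (if (p.2 %% 4)%Z == 1 then - (4 * p.1)%N%:Z else (4 * p.1)%N%:Z) /\
    i = (if (p.2 %% 4)%Z == 1 then p.2 else - p.2).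
Proof.
move=> [h0 /dvdzP[q hE] i4 co] /=.
have co' : coprime `|q| `|i|.
  by move: co; rewrite coprimezE hE abszM coprimeMl => /andP[].
have qE : (`|h| %/ 4)%N = `|q|%N by rewrite hE abszM mulnK.
rewrite qE; case: (ltrP h 0) => hs.
  have m : ((i %% 4)%Z == 1) by rewrite i4.
  rewrite m; split; last by split=> //; lia.
  by split=> //=; lia.
have m : (((- i) %% 4)%Z == 1) = false by lia.
rewrite m; split; last by split; lia.
by split=> /=; rewrite ?abszN //; lia.
Qed.

Lemma key_row p : index_set p -> exists h i, [/\ good_row h i,
  (`|h| %/ 4)%N = p.1 & (if h < 0 then i else - i) = p.2].
Proof.
move: p => [B j] [/= B0 oj co]; case: (boolP ((j %% 4)%Z == 1)) => j4.
  exists (- (4 * B)%N%:Z), j; split; last by rewrite ifT //; lia.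
  - split; [lia| |exact/eqP|].
    + by apply/dvdzP; exists (- B%:Z); lia.
    + rewrite coprimezE ?abszN absz_nat.
      by rewrite coprimeMl co (coprimeXl 2 (m := 2)) ?coprime2n.
  - by rewrite abszN absz_nat mulKn.
exists (4 * B)%N%:Z, (- j); split; last by rewrite /= opprK.
- split; [lia| |lia|].
  + by apply/dvdzP; exists B%:Z; lia.
  + rewrite coprimezE ?abszN absz_nat.
    by rewrite coprimeMl co (coprimeXl 2 (m := 2)) ?coprime2n.
- by rewrite absz_nat mulKn.
Qed.

(** A coset consists of all matrices of block shape with one bottom row, so it does not matter which
    representative [xget] returns. *)
Lemma coset_rep_row X : cosets2 X -> exists h i, good_row h i /\
  bottom_row h i (coset_rep X) /\ X = [set g | bottom_row h i g].
Proof.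
move=> [g [Gg cg] <-]; have [h [i [hi gr]]] := Gamma_cell2_row Gg cg.
exists h, i; split=> //.
have XE : [set sl_mul u g | u in Gamma_oo] = [set g' | bottom_row h i g'].
  apply/seteqP; split => g' /=; first by move=> [w Gw <-]; exact: bottom_row_mul.
  by move=> /(bottom_row_coset gr)[w Gw ->]; exists w.
split=> //; rewrite /coset_rep XE; case: xgetP => // /(_ g) /=.
by move=> /(_ gr).
Qed.

Lemma coset_key_bij :
  set_bij (@cosets2 R) index_set (fun X => row_key (coset_rep X)).
Proof.
split.
- move=> X /coset_rep_row[h [i [hi [gr _]]]] /=; rewrite (row_keyE gr).
  by have [] := row_of_key hi.
- move=> X Y /set_mem/coset_rep_row[h [i [hi [gr XE]]]]
    /set_mem/coset_rep_row[h' [i' [hi' [gr' YE]]]].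
  rewrite (row_keyE gr) (row_keyE gr') => E.
  have [_ [hE iE]] := row_of_key hi; have [_ [hE' iE']] := row_of_key hi'.
  rewrite XE YE; congr [set g | bottom_row _ _ g].
    by rewrite hE hE' E.
  by rewrite iE iE' E.
- move=> p /key_row[h [i [hi p1 p2]]].
  have [g [Gg cg] gr] := good_row_rep hi.
  have cX : cosets2 [set sl_mul u g | u in Gamma_oo] by exists g.
  exists [set sl_mul u g | u in Gamma_oo] => //=.
  have [h' [i' [hi' [gr' XE]]]] := coset_rep_row cX.
  have gg : bottom_row h' i' g.
    have : [set g | bottom_row h' i' g] g.
      rewrite -XE; exists (nSL 0 0 0); first by apply/Gamma_ooP; exists 0, 0, 0.
      by apply: val_inj; rewrite /= nmx0 mul1mx.
    by [].
  rewrite (row_keyE gr') -(row_keyE gg) (row_keyE gr) p1 p2.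
  by case: (p).
Qed.
End Cosets.

(** * Terms of the Eisenstein series *)

Section Terms.
Variable R : realType.
Local Notation C := R[i].
Implicit Types (f : vfun R) (lambda : 'rV[C]_3) (x y z t : R).

(* The value of the dual vector at n(0,t,0) w that a coset contributes depends
   on the sign of its lower left entry, i.e. on j mod 4. *)
Definition twist f (j : int) t : C :=
  if (j %% 4)%Z == 1 then 'i * wval f 0 t else - wval f 1 t.

Definition eis_coef lambda (p : nat * int) : C :=
  cpow (4 * p.1)%:R (- 1 - lambda 0 0 + lambda 0 1) *
  (kronecker p.1 `|p.2|%N)%:~R.

Definition eis_term lambda f (p : nat * int) y : C :=
  eis_coef lambda p * twist f p.2 (p.2%:~R / (4 * p.1)%:R + y).

Lemma kronecker_abs (b : nat) (n : int) : n != 0 -> kronecker b n = kronecker b `|n|%N.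
Proof.
move=> n0; rewrite /kronecker (negbTE n0) andbF mul1r absz_nat.
by have -> : ((`|n|%N : int) == 0) = false by lia.
Qed.

Lemma kronecker_sign (b n : nat) : odd n -> coprime b n ->
  (-1) ^+ (kronecker b n == -1) = (kronecker b n)%:~R :> C.
Proof.
move=> on co; rewrite kronecker_schering //.
by case: (schering b n); rewrite ?expr1 ?expr0 /= ?mulrN1z.
Qed.

(** The Boolean test against -1 recovers the symbol itself, since coprimality keeps it from being
    0. *)
Lemma splitting_row h i (g : SL3 R) : good_row h i -> bottom_row h i g ->
  exists2 b : bool, splitting2 g = (g, b) &
  (-1) ^+ b = (kronecker (row_key g).1 `|(row_key g).2|%N)%:~R :> C.
Proof.
move=> hi gr; have [] := row_of_key hi; rewrite -(row_keyE gr).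
move: (row_key g) => [B j] [/= B0 oj co] [hE iE].
rewrite /splitting2; eexists; first by [].
have [u [v [e [k gE]]]] := gr.
have j0 : j != 0 by apply/eqP => j0; move: oj; rewrite j0.
have -> : - Num.floor (plC1 (val g)) = i.
  by rewrite /plC1 gE mxE /= -mulrNz intrKfloor opprK.
have -> : - Num.floor (plB1 (val g) / 4) = if (j %% 4)%Z == 1 then - B%:Z else B%:Z.
  have -> : plB1 (val g) / 4 = (if (j %% 4)%Z == 1 then B%:Z else - B%:Z)%:~R.
    rewrite /plB1 gE mxE /= hE; case: ifP => _;
      rewrite ?(rmorphN, opprK) /= PoszM rmorphM /=; by field.
  by rewrite intrKfloor; case: ifP => _; rewrite ?opprK.
rewrite iE; case: ifP => [/eqP j4|_].
  by rewrite kronecker_opp_num // kronecker_sign.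
by rewrite kronecker_abs ?oppr_eq0 // abszN kronecker_sign.
Qed.

Lemma coset_rep_term lambda f X x y z : cosets2 X -> V lambda f ->
  f (nt x y z *t (ginv (ginv (ginv (splitting2 (coset_rep X)))) *t wl)) 0 0 =
  eis_term lambda f (row_key (coset_rep X)) y.
Proof.
move=> /coset_rep_row[h [i [hi [gr _]]]] Vf.
have [b -> bE] := splitting_row hi gr.
have [] := row_of_key hi; rewrite -(row_keyE gr) => -[].
have [u [v [e [k gE]]]] := gr.
have [h0 _ _ _] := hi.
have hR : (h%:~R : R) != 0 by rewrite intr_eq0.
rewrite -/(coset_point _ b) (coset_value b gE hR x y z Vf) bE.
move: (row_key _) => [B j] /= B0 oj co [hE iE].
have -> : cpow `|h%:~R| ((- lambda) 0 0 - 1 - (- lambda) 0 1) =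
          cpow (4 * B)%:R (- 1 - lambda 0 0 + lambda 0 1).
  have -> : `|h%:~R| = (4 * B)%:R :> R.
    by rewrite hE; case: ifP => _; rewrite ?rmorphN ?normrN /= ger0_norm.
  by congr (cpow _ _); rewrite !mxE; ring.
rewrite /eis_term /eis_coef /twist /=; congr (_ * _).
have hs : (h%:~R < 0 :> R) = ((j %% 4)%Z == 1).
  by rewrite ltrz0 hE; case: ifP => _; lia.
have tE : y - i%:~R / h%:~R = j%:~R / (4 * B)%:R + y.
  rewrite hE iE; case: ifP => _; rewrite ?rmorphN /= addrC -pmulrn.
    by rewrite invrN mulrN opprK.
  by rewrite mulNr opprK.
by rewrite hs tE.
Qed.

Lemma nt0_mul (P : Gt R) : nt 0 0 0 *t P = P.
Proof.
by apply: Gt_eq; rewrite ?val_gmul ?sign_nt_mul //= nmx0 mul1mx.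
Qed.

Lemma tau_coset lambda f X : cosets2 X -> V lambda f ->
  pi_dist (ginv (splitting2 (coset_rep X))) tau f =
  eis_term lambda f (row_key (coset_rep X)) 0.
Proof.
move=> cX Vf; rewrite -(coset_rep_term 0 0 0 cX Vf) /pi_dist /tau /pi_fun.
by rewrite nt0_mul.
Qed.

Lemma tau_coset_translate lambda f X x y z : cosets2 X -> V lambda f ->
  pi_dist (ginv (splitting2 (coset_rep X))) tau (pi_fun (nt x y z) f) =
  eis_term lambda f (row_key (coset_rep X)) (- y).
Proof.
move=> cX Vf; rewrite -(coset_rep_term (- x) (- y) (x * y - z) cX Vf).
by rewrite /pi_dist /tau /pi_fun ginv_nt.
Qed.

(** Charts are built by left multiplication, so translating f by N only moves their base points. *)
Lemma Vsmooth_translate mu eta f x y z : Vsmooth mu eta f ->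
  Vsmooth mu eta (pi_fun (nt x y z) f).
Proof.
move=> [sf Vf]; split=> [g j|g m a u v w Mm Aa]; last first.
  by rewrite /pi_fun ginv_nt !nt_mulA Vf.
have E u : ginv (nt x y z) *t chart g u = chart (ginv (nt x y z) *t g) u.
  by rewrite /chart ginv_nt !nt_mulA.
have [sr si] := sf (ginv (nt x y z) *t g) j.
have -> : re_chart (pi_fun (nt x y z) f) g j =
          re_chart f (ginv (nt x y z) *t g) j.
  by apply/funext => u; rewrite /re_chart /pi_fun E.
have -> : im_chart (pi_fun (nt x y z) f) g j =
          im_chart f (ginv (nt x y z) *t g) j.
  by apply/funext => u; rewrite /im_chart /pi_fun E.
by split.
Qed.
End Terms.

(** * Bounds on sections and on terms *)

Section Bounds.
Variable R : realType.
Local Notation C := R[i].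
Implicit Types (f : vfun R) (lambda : 'rV[C]_3) (x y z t : R).

Lemma det_tmx11 : \det (tmx 1 1 (1 * 1) : 'M[R]_3) == 1.
Proof. by rewrite det_tmx !mulr1. Qed.

(** The two lifts of the identity to M; [mone true] acts by -1 through phi. *)
Definition mone (b : bool) : Gt R := (Sub (tmx 1 1 (1 * 1)) det_tmx11, b).

Lemma Mt_mone b : Mt (mone b).
Proof. by exists 1, 1; rewrite !inE !eqxx. Qed.

Lemma At_mone : At (mone false).
Proof. by split => //; exists 1, 1, 1; split => //; rewrite /= mulr1. Qed.

Lemma val_mone b : val (mone b).1 = 1%:M.
Proof. by rewrite /= mulr1 tmx1. Qed.

Lemma V_mone mu f g b : Vphi mu f ->
  f (g *t mone b *t mone false *t nminus 0 0 0) = (-1) ^+ b *: f g.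
Proof.
move=> [_ Vf]; rewrite Vf; [|exact: Mt_mone|exact: At_mone].
rewrite (@contra_phi1 R (mone b)) // -scalemxAl mul1mx.
rewrite (_ : \prod_(i < 3) _ = 1) ?scale1r // prod_ord3 !mxE /=.
by rewrite !mulr1 !cpow1 !mulr1.
Qed.

Lemma lower0 : lower 0 0 0 = 1%:M :> 'M[R]_3.
Proof. by rewrite one_mx3. Qed.

(** P and Q lie over g on opposite sheets, with values -f g and f g. Whichever of them is g itself,
    the two equations give the claim. *)
Lemma V_flip mu f (g : Gt R) : Vphi mu f ->
  f (g.1, ~~ g.2) = - f g.
Proof.
move=> Vf; have := V_mone g false Vf; have := V_mone g true Vf.
set P := _ *t nminus 0 0 0; set Q := (g *t mone false *t _ *t nminus 0 0 0).
have Pv : val P.1 = val g.1 by rewrite 3!val_gmul val_nminus oppr0 lower0 !val_mone !mulmx1.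
have Qv : val Q.1 = val g.1 by rewrite 3!val_gmul val_nminus oppr0 lower0 !val_mone !mulmx1.
have PQ : P.2 = ~~ Q.2.
  by rewrite /P /Q /gmul /= addbT !addbF !addNb.
have PE : P = (g.1, P.2) by apply: Gt_eq.
have QE : Q = (g.1, Q.2) by apply: Gt_eq.
rewrite PE QE PQ expr1 expr0 scaleN1r scale1r.
case: g {P Q Pv Qv PQ PE QE} (Q.2) => [g b] c /=.
by case: b; case: c => /=; move: (f (g, true)) (f (g, false)) => A B e1 e2;
  rewrite -?e1 -?e2 ?opprK.
Qed.

(** The chart at g may return the other lift of g at 0, which costs only a sign; 2 b adds the bounds
    on real and imaginary parts. *)
Lemma V_bound mu f b (g : Gt R) j : Vphi mu f ->
  seminorm_le 2 0 f b -> (forall k l, `|val g.1 k l| <= 2) ->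
  normc (f g j 0) <= 2 * b.
Proof.
move=> Vf sb g2; have [] := sb g g2 j [::] isT; rewrite /= /re_chart /im_chart.
set P := chart g 0 => Pre Pim.
have Pv : val P.1 = val g.1.
  rewrite 3!val_gmul val_nminus !mxE oppr0 lower0 /= nmx0 !mulmx1.
  by rewrite oppr0 addr0 expR0 tmx1 mulmx1.
have : normc (f P j 0) <= 2 * b.
  by rewrite (le_trans (normc_le _)) // mulr_natl lerD.
have : P = g \/ P = (g.1, ~~ g.2).
  case: P Pv {Pre Pim} => [P c] /= /val_inj ->; case: g {g2} => [g c'] /=.
  by case: c; case: c'; [left|right|right|left].
by case=> -> //; rewrite (V_flip _ Vf) mxE normcN.
Qed.

Lemma V_normc mu f (P Q : Gt R) j : Vphi mu f ->
  val P.1 = val Q.1 -> normc (f P j 0) = normc (f Q j 0).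
Proof.
move=> Vf PQ; have : P = Q \/ P = (Q.1, ~~ Q.2).
  case: P Q PQ => [P c] [Q c'] /= /val_inj ->.
  by case: c; case: c'; [left|right|right|left].
by case=> -> //; rewrite (V_flip _ Vf) mxE normcN.
Qed.

Lemma expR_ln_le (s t : R) : 1 <= t -> s <= - 4 -> expR (s * ln t) <= t ^- 4.
Proof.
move=> t1 s4; have t0 : 0 < t by exact: lt_le_trans t1.
rewrite -{2}(lnK t0) -expRM_natl -expRN ler_expR -mulNr.
by rewrite ler_wpM2r // ln_ge0.
Qed.

(** For |t| > 1 the matrix n(0,t,0) w is [curve2 (t/|t|) (1/|t|)] times t(1/|t|, |t|, 1) times an
    element of N_-. *)
Definition curve2 (s u : R) : 'M[R]_3 :=
  mx3 [:: [:: 0; 0; -1]; [:: 0; s; 0]; [:: s; u; 0]].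

(* The two arcs on which the homogeneity of f determines all its values
   [wval f j t]: t in [-1, 1], and a neighbourhood of t = oo. *)
Definition arcs : set 'M[R]_3 :=
  [set A | (exists2 t, `|t| <= 1 & A = nmx 0 t 0 *m wmx) \/
           (exists s u, [/\ `|s| = 1, `|u| <= 1 & A = curve2 s u])].

(** Isolates what the estimates use of f. It is supplied by [seminorm_arc_bound], linearly in b as
    continuity of distributions requires, and by [exists_arc_bound] for a single f. *)
Definition arc_bound f (K : R) : Prop :=
  forall (P : Gt R) j, arcs (val P.1) -> normc (f P j 0) <= K.

Lemma nwmxE t : nmx 0 t 0 *m wmx = mx3 [:: [:: 0; 0; -1]; [:: -1; t; 0]; [:: 0; 1; 0]].
Proof.
rewrite /nmx /wmx mul_mx3.
by congr_mx3; ring.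
Qed.

Lemma seminorm_arc_bound mu f b : Vphi mu f ->
  seminorm_le 2 0 f b -> arc_bound f (2 * b).
Proof.
move=> Vf sb P j [[t t1 PE]|[s [u [s1 u1 PE]]]]; apply: (V_bound j Vf sb).
  rewrite PE nwmxE; do 2 elim/ord3P; rewrite !mxE /= ?normrN ?normr0 ?normr1 //; try lra.
rewrite PE; do 2 elim/ord3P; rewrite !mxE /= ?normrN ?normr0 ?normr1 ?s1 //; try lra.
Qed.

(** For |t| <= 1 the first arc applies. Beyond it the factor t(1/|t|, |t|, 1) acts by |t| to the
    power -1 - lambda_1 + lambda_2, of real part at most -4. *)
Lemma wval_bound lambda f K j t : V lambda f -> converges lambda -> arc_bound f K -> normc (wval f j t) <= K * Num.max 1 `|t| ^- 4.
Proof.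
move=> Vf l3 sb; rewrite /wval.
have nwE : val (nt 0 t 0 *t wt : Gt R).1 = mx3 [:: [:: 0; 0; -1]; [:: -1; t; 0]; [:: 0; 1; 0]].
  by rewrite val_nwt nwmxE.
have [t1|t1] := leP `|t| 1.
  rewrite expr1n divr1.
  by apply: sb; left; exists t => //; rewrite val_nwt.
have t0 : 0 < `|t| by exact: lt_trans t1.
have tn0 : t != 0 by rewrite -normr_gt0.
pose s := t / `|t|.
have ss : s * s = 1.
  rewrite /s -[LHS]/(t / `|t| * (t / `|t|)) mulrACA -invfM -!expr2 real_normK ?num_real //.
  by rewrite divff // sqrf_eq0.
have s1 : `|s| = 1.
  by rewrite /s normrM normfV normr_id divff // gt_eqF.
pose M := curve2 s `|t|^-1.
have dM : \det M == 1.
  by apply/eqP; rewrite det_mx3 !mxE /= -[RHS]ss; ring.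
have da : \det (tmx `|t|^-1 `|t| 1) == 1.
  by rewrite det_tmx mulr1 mulVf // gt_eqF.
pose Q0 : Gt R := (Sub M dM, false).
pose a : Gt R := (Sub (tmx `|t|^-1 `|t| 1) da, false).
have aA : At a.
  by split => //; exists `|t|^-1, `|t|, 1; rewrite invr_gt0; split.
(* The sheet on which Q lies is immaterial, as only a modulus is estimated. *)
pose Q := Q0 *t mone false *t a *t nminus 0 t^-1 0.
have QE : val Q.1 = val (nt 0 t 0 *t wt : Gt R).1.
  rewrite nwE 3!val_gmul val_nminus val_mone mulmx1 oppr0 /= /M /curve2 /tmx /lower !mul_mx3.
  have sE : s * `|t| = t by rewrite /s divfK // gt_eqF.
  congr_mx3; try ring.
  - by rewrite !(mulr0, mul0r, addr0, add0r, mulr1, mul1r) sE mulrN divff.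
  - by rewrite !(mulr0, mul0r, addr0, add0r, mulr1, mul1r) sE.
  - rewrite !(mulr0, mul0r, addr0, add0r, mulr1, mul1r) mulVf ?gt_eqF // mul1r.
    have -> : s / `|t| = t^-1; last by rewrite subrr.
    by apply: (mulfI tn0); rewrite divff // mulrCA.
  - by rewrite !(mulr0, mul0r, addr0, add0r, mulr1, mul1r) mulVf ?gt_eqF.
rewrite -(V_normc j Vf QE).
have [_ fV] := Vf; rewrite fV; [|exact: Mt_mone|exact: aA].
rewrite (@contra_phi1 R (mone false)) // expr0 scale1r mul1mx mxE Normc.normcM mulrC.
have Qb : normc (f Q0 j 0) <= K.
  apply: sb; right; exists s, `|t|^-1; split => //.
  by rewrite normfV normr_id invf_le1 // ltW.
apply: ler_pM => //; [by case: (f Q0 j 0) => ? ?; exact: sqrtr_ge0|by case: (\prod_(i < 3) _) => ? ?; exact: sqrtr_ge0|].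
have -> : \prod_(i < 3) cpow (val a.1 i i) (- ((- lambda) 0 i - rho 0 i)) =
    cpow `|t| (- (lambda 0 0 + 1) + lambda 0 1).
  rewrite prod_ord3 !mxE /= cpow1 mulr1 cpowV // -cpowD.
  by congr (cpow _ _); ring.
rewrite normc_cpow.
apply: expR_ln_le; first exact: ltW.
move: l3; case: (lambda 0 0) => l0 l0'; case: (lambda 0 1) => l1 l1' /=; lra.
Qed.

Lemma normc_intr (n : int) : normc (n%:~R : C) = `|n|%:~R.
Proof.
rewrite (_ : (n%:~R : C) = (n%:~R)%:C); last by rewrite rmorph_int.
by rewrite /normc /= expr0n addr0 sqrtr_sqr intr_norm.
Qed.

Lemma normc_kronecker (b n : nat) : odd n -> normc ((kronecker b n)%:~R : C) <= 1.
Proof.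
move=> on; rewrite normc_intr; case: (boolP (coprime b n)) => co.
  by rewrite kronecker_schering // normrX normrN1 expr1n.
by rewrite kronecker_eq0.
Qed.

Lemma eis_coef_bound lambda p : (0 < p.1)%N -> odd `|p.2|%N ->
  converges lambda -> normc (eis_coef lambda p) <= (4 * p.1)%:R ^- 4.
Proof.
move=> p0 op l3; rewrite Normc.normcM -[leRHS]mulr1.
apply: ler_pM; rewrite ?normc_ge0 ?normc_kronecker // normc_cpow.
apply: expR_ln_le; first by rewrite ler1n; lia.
move: l3; case: (lambda 0 0) => l0 l0'; case: (lambda 0 1) => l1 l1' /=; lra.
Qed.

Lemma twist_bound lambda f K j t : V lambda f -> converges lambda -> arc_bound f K -> normc (twist f j t) <= K * Num.max 1 `|t| ^- 4.
Proof.
move=> Vf l3 sb; rewrite /twist; case: ifP => _.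
  rewrite Normc.normcM (_ : normc 'i = 1) ?mul1r; first exact: wval_bound Vf l3 sb.
  by rewrite /normc /= expr0n expr1n add0r sqrtr1.
by rewrite normcN; exact: wval_bound Vf l3 sb.
Qed.

Lemma seminorm_ge0 f b : seminorm_le 2 0 f b -> 0 <= b.
Proof.
move=> sb; have [] := sb (nt 0 0 0) _ 0 [::] isT.
  by do 2 elim/ord3P; rewrite !mxE /= ?normr0 ?normr1; lra.
by move=> h _; exact: le_trans h.
Qed.

Definition eis_weight (p : nat * int) : R := (p.1%:R ^+ 2 * p.2%:~R ^+ 2)^-1.

Lemma arc_bound_ge0 f K : arc_bound f K -> 0 <= K.
Proof.
move=> sb; apply: le_trans (normc_ge0 _) (sb (nt 0 0 0 *t wt) 0 _).
by left; exists 0; rewrite ?normr0.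
Qed.

(** With q = 4B and m = max(1,|t|), coefficient and section together give K (q m)^-4. Since B <= q m
    and |j| = q |t - y| <= 2 q m, two of the four powers are spent on B and two on j/2. *)
Lemma eis_term_bound lambda f K p y : index_set p -> V lambda f -> converges lambda -> arc_bound f K -> `|y| <= 1 ->
  normc (eis_term lambda f p y) <= 4 * K * eis_weight p.
Proof.
move=> [p0 op co] Vf l3 sb y1; have b0 := arc_bound_ge0 sb.
rewrite Normc.normcM.
set q : R := (4 * p.1)%:R; set t := p.2%:~R / q + y.
have q1 : 1 <= q by rewrite ler1n; lia.
have q0 : 0 < q by lra.
set m := Num.max 1 `|t|.
have m1 : 1 <= m by rewrite le_max lexx.
have m0 : 0 < m by exact: lt_le_trans ltr01 m1.
have mt : `|t| <= m by rewrite le_max lexx orbT.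
have := ler_pM (normc_ge0 _) (normc_ge0 _) (eis_coef_bound p0 op l3) (twist_bound p.2 t Vf l3 sb).
rewrite -/q -/m => /le_trans; apply.
have j0 : 0 < `|p.2%:~R| :> R by rewrite normr_gt0 intr_eq0; lia.
have qB : p.1%:R <= q by rewrite ler_nat; lia.
have B0 : 0 < p.1%:R :> R by rewrite ltr0n.
have qm1 : q <= q * m by rewrite ler_peMr // ltW.
have qm2 : `|p.2%:~R| <= 2 * (q * m).
  have -> : p.2%:~R = q * (t - y) by rewrite /t addrK mulrCA divff ?mulr1 // gt_eqF.
  rewrite normrM (gtr0_norm q0) (mulrCA 2); apply: ler_wpM2l; first exact: ltW.
  by apply: le_trans (ler_normB _ _) _; lra.
have -> : q ^- 4 * (K * m ^- 4) = K * ((q * m) ^+ 2 * (q * m) ^+ 2)^-1.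
  by field; rewrite !gt_eqF.
have -> : 4 * K * eis_weight p = K * (p.1%:R ^+ 2 * (`|p.2%:~R| / 2) ^+ 2)^-1.
  rewrite /eis_weight -[p.2%:~R ^+ 2]real_normK ?num_real //; field.
  by rewrite !gt_eqF.
have qm0 : 0 < q * m by rewrite mulr_gt0.
have j20 : 0 < `|p.2%:~R| / 2 :> R by rewrite divr_gt0.
apply: ler_wpM2l; first exact: b0.
rewrite lef_pV2 ?posrE ?mulr_gt0 ?exprn_gt0 //.
apply: ler_pM; [exact: exprn_ge0 (ltW B0)|exact: exprn_ge0 (ltW j20)|..];
  rewrite lerXn2r ?nnegrE ?(ltW B0) ?(ltW j20) ?(ltW qm0) //; lra.
Qed.

(** Exhibits n(0,t,0) w as a coordinate line through w, so that smoothness of f yields continuity of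
    [wval]. *)
Lemma wt_nt t : wt *t nt (- t) 0 0 = nt 0 t 0 *t wt :> Gt R.
Proof.
apply: Gt_eq.
  rewrite val_nwt val_gmul /= /wmx /nmx !mul_mx3.
  by congr_mx3; ring.
rewrite [RHS]sign_gmul [LHS]sign_gmul /= sigma_nw.
have -> : wmx = nmx 0 0 0 *m tmx (-1) (-1) 1 *m (walpha1 *m walpha2) :> 'M[R]_3.
  by rewrite nmx0 mul1mx wmxE.
rewrite sigma_cell12 ?det_nmx // ?mulrNN ?mulr1 ?oner_eq0 //.
rewrite /= /nmx walpha2_mx3 walpha1_mx3 !s2_mx3 !s3_mx3.
by rewrite !(oppr0, arith_signs) !sgn3_0 /sgn3 !(eqxx, oner_eq0) /= !ltr10 !andbF.
Qed.

Lemma line_coord t k : (k < 8)%N ->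
  (- t *: delta_mx 0 0 : 'rV[R]_8) 0 (inord k) = if k == 0%N then - t else 0.
Proof.
move=> k8; rewrite !mxE eqxx /= -val_eqE /= inordK //.
by case: eqP; rewrite ?mulr1 ?mulr0.
Qed.

Lemma chart_wt t :
  chart wt (- t *: delta_mx 0 0) =
  nt 0 t 0 *t wt *t mone false *t mone false *t nminus 0 0 0 :> Gt R.
Proof.
rewrite /chart !line_coord //= wt_nt.
have -> : (aSL 0 0, false) = mone false :> Gt R.
  by apply: Gt_eq => //; rewrite /= oppr0 addr0 expR0 mulr1.
congr (_ *t _ *t _); apply: Gt_eq; first by rewrite [RHS]val_gmul val_mone mulmx1.
by rewrite [RHS]sign_gmul val_nwt sigma_wmx_sign ?inE ?eqxx // ltr10 !addbF.
Qed.

Lemma wval_chart mu f j t : Vphi mu f ->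
  wval f j t = f (chart wt (- t *: delta_mx 0 0)) j 0.
Proof.
by move=> Vf; rewrite chart_wt (V_mone _ _ Vf) expr0 scale1r.
Qed.

Lemma continuous_chart_line (F : 'rV[R]_8 -> R) : continuous F ->
  continuous (fun t : R => F (- t *: delta_mx 0 0)).
Proof.
move=> cF t; apply: continuous_comp; last exact: cF.
by apply: cvgZr_tmp; apply: cvgN; exact: cvg_id.
Qed.

Lemma continuous_wval mu f j : Vphi mu f ->
  continuous (fun t => Re (wval f j t)) /\
  continuous (fun t => Im (wval f j t)).
Proof.
move=> Vf; have [sf _] := Vf; have [sr si] := sf wt j.
have [cr _] := sr [::]; have [ci _] := si [::].
split.
  rewrite (_ : (fun t => _) = (fun t => re_chart f wt j (- t *: delta_mx 0 0))).
    exact: continuous_chart_line.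
  by apply/funext => t; rewrite /re_chart -(wval_chart _ _ Vf).
rewrite (_ : (fun t => _) = (fun t => im_chart f wt j (- t *: delta_mx 0 0))).
  exact: continuous_chart_line.
by apply/funext => t; rewrite /im_chart -(wval_chart _ _ Vf).
Qed.

Lemma continuous_bounded (F : R -> R) : continuous F ->
  exists K, forall t, `|t| <= 1 -> `|F t| <= K.
Proof.
move=> cF; have cN : continuous (fun t => `|F t|).
  by move=> t; apply: cvg_norm; exact: cF.
have [c _ cmax] := @EVT_max R (fun t => `|F t|) (-1) 1 ltac:(lra)
  (continuous_subspaceT cN).
exists `|F c| => t t1; apply: cmax; rewrite in_itv /=.
by move: t1; rewrite ler_norml.
Qed.

Lemma det_curve2 (s u : R) : s * s = 1 -> \det (curve2 s u) == 1.
Proof. by move=> ss; rewrite det_mx3 !mxE /= -[X in _ == X]ss; apply/eqP; ring. Qed.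

Lemma chart_bounded mu f (g : Gt R) : Vphi mu f ->
  exists K, forall t j, `|t| <= 1 -> normc (f (chart g (- t *: delta_mx 0 0)) j 0) <= K.
Proof.
move=> [sf _].
have H j : exists K, forall t, `|t| <= 1 -> normc (f (chart g (- t *: delta_mx 0 0)) j 0) <= K.
  have [sr si] := sf g j; have [cr _] := sr [::]; have [ci _] := si [::].
  have [K1 h1] := continuous_bounded (continuous_chart_line cr).
  have [K2 h2] := continuous_bounded (continuous_chart_line ci).
  exists (K1 + K2) => t t1; apply: le_trans (normc_le _) _; apply: lerD.
    exact: h1.
  exact: h2.
have [K0 h0] := H 0; have [K1 h1] := H 1.
exists (Num.max K0 K1) => t j t1; move: j; apply: ord2P.
  by rewrite le_max h0.
by rewrite le_max h1 // orbT.
Qed.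

(** Up to sheets, the arcs are covered by coordinate segments of three charts, at w and at the
    points [curve2 1 0] and [curve2 (-1) 0], and a continuous function on [-1,1] is bounded. *)
Lemma exists_arc_bound mu f : Vphi mu f ->
  exists K, arc_bound f K.
Proof.
move=> Vf.
have s1 : 1 * 1 = 1 :> R by rewrite mulr1.
have s2 : -1 * -1 = 1 :> R by rewrite mulrNN mulr1.
pose gp : Gt R := (Sub (curve2 1 0) (det_curve2 0 s1), false).
pose gm : Gt R := (Sub (curve2 (-1) 0) (det_curve2 0 s2), false).
have [K0 h0] := chart_bounded wt Vf; have [K1 h1] := chart_bounded gp Vf.
have [K2 h2] := chart_bounded gm Vf.
have cv (g : Gt R) t : val (chart g (- t *: delta_mx 0 0)).1 = val g.1 *m nmx (- t) 0 0.
  have -> : chart g (- t *: delta_mx 0 0) =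
      g *t nt (- t) 0 0 *t (aSL 0 0, false) *t nminus 0 0 0 by rewrite /chart !line_coord.
  rewrite 3!val_gmul val_nminus oppr0 lower0 mulmx1 /=.
  by rewrite oppr0 addr0 expR0 tmx1 mulmx1.
exists (Num.max K0 (Num.max K1 K2)) => P j [[t t1 PE]|[s [u [s1' u1 PE]]]].
  rewrite le_max (V_normc j Vf (Q := chart wt (- t *: delta_mx 0 0))) ?h0 //.
  rewrite PE cv /= -[RHS]/(val (wt *t nt (- t) 0 0).1) wt_nt val_nwt //.
have su : s = 1 \/ s = -1.
  by case: (ler0P s) s1' => _ h; [right; lra|left].
case: su PE => -> PE; rewrite !le_max.
  rewrite (V_normc j Vf (Q := chart gp (- (- u) *: delta_mx 0 0))) ?h1 ?normrN ?orbT //.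
  rewrite PE cv /= opprK /curve2 /nmx mul_mx3.
  by congr_mx3; ring.
rewrite (V_normc j Vf (Q := chart gm (- u *: delta_mx 0 0))) ?h2 ?orbT //.
rewrite PE cv /= /curve2 /nmx mul_mx3.
by congr_mx3; ring.
Qed.
End Bounds.

(** * Unconditional sums of real families *)

Section RealSums.
Variable R : realType.
Implicit Types (T : choiceType).

Definition rsummable T (D : set T) (f : T -> R) : Prop :=
  summable D (fun x => (f x)%:E).

Lemma eq_rsum T (D : set T) (f g : T -> R) :
  (forall x, D x -> f x = g x) -> rsum D f = rsum D g.
Proof.
by move=> fg; rewrite /rsum; congr (fine _ - fine _); apply: eq_esum => x /fg ->.
Qed.

Lemma esum_fin_num T (D : set T) (f : T -> R) : (forall x, D x -> 0 <= f x) ->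
  (\esum_(x in D) (f x)%:E < +oo)%E -> \esum_(x in D) (f x)%:E \is a fin_num.
Proof.
by move=> f0 fy; rewrite ge0_fin_numE // esum_ge0 // => x /f0; rewrite lee_fin.
Qed.

Lemma le_rsummable T (D : set T) (f g : T -> R) :
  (forall x, D x -> `|f x| <= g x) -> rsummable D g -> rsummable D f.
Proof.
move=> fg; apply: le_lt_trans; apply: le_esum => x Dx /=.
by rewrite lee_fin (le_trans (fg _ Dx)) // ler_norm.
Qed.

Lemma rsummable_lty T (D : set T) (f : T -> R) : (forall x, D x -> 0 <= f x) ->
  rsummable D f <-> (\esum_(x in D) (f x)%:E < +oo)%E.
Proof.
move=> f0; rewrite /rsummable /summable (_ : \esum_(x in D) _ = \esum_(x in D) (f x)%:E) //.
by apply: eq_esum => x Dx /=; rewrite ger0_norm // f0.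
Qed.

(** Any splitting of f into a difference of nonnegative summable families computes [rsum], not only
    that into positive and negative parts; linearity and Fubini reduce to this. *)
Lemma rsum_pm T (D : set T) (f u v : T -> R) :
  (forall x, D x -> f x = u x - v x) ->
  (forall x, D x -> 0 <= u x) -> (forall x, D x -> 0 <= v x) ->
  rsummable D u -> rsummable D v ->
  rsum D f = fine (\esum_(x in D) (u x)%:E) - fine (\esum_(x in D) (v x)%:E).
Proof.
move=> fE u0 v0 /(rsummable_lty u0) su /(rsummable_lty v0) sv.
have fu := esum_fin_num u0 su; have fv := esum_fin_num v0 sv.
pose p x := Num.max (f x) 0; pose n x := Num.max (- f x) 0.
have p0 x : D x -> 0 <= p x by rewrite le_max lexx orbT.
have n0 x : D x -> 0 <= n x by rewrite le_max lexx orbT.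
have fp : \esum_(x in D) (p x)%:E \is a fin_num.
  apply: esum_fin_num => //; apply: le_lt_trans su; apply: le_esum => x Dx.
  rewrite lee_fin /p fE // ge_max u0 // andbT; have := v0 _ Dx; lra.
have fn : \esum_(x in D) (n x)%:E \is a fin_num.
  apply: esum_fin_num => //; apply: le_lt_trans sv; apply: le_esum => x Dx.
  rewrite lee_fin /n fE // ge_max v0 // andbT; have := u0 _ Dx; lra.
have E : (\esum_(x in D) (p x)%:E + \esum_(x in D) (v x)%:E =
          \esum_(x in D) (n x)%:E + \esum_(x in D) (u x)%:E)%E.
  rewrite -!esumD //; try by move=> x Dx; rewrite lee_fin ?p0 ?n0 ?u0 ?v0.
  apply: eq_esum => x Dx; rewrite -!EFinD; congr EFin; rewrite /p /n fE //.
  by case: (leP (u x - v x) 0) => h; case: (leP (- (u x - v x)) 0) => h'; lra.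
move: E => /(congr1 fine); rewrite !fineD // => E.
rewrite /rsum -/(p _) -/(n _); move: E.
rewrite -[\esum_(x in D) (Num.max (f x) 0)%:E]/(\esum_(x in D) (p x)%:E).
rewrite -[\esum_(x in D) (Num.max (- f x) 0)%:E]/(\esum_(x in D) (n x)%:E).
by move=> E; lra.
Qed.

Definition rpos (f : R) := Num.max f 0.
Definition rneg (f : R) := Num.max (- f) 0.

Lemma rpos_ge0 f : 0 <= rpos f. Proof. by rewrite le_max lexx orbT. Qed.
Lemma rneg_ge0 f : 0 <= rneg f. Proof. by rewrite le_max lexx orbT. Qed.
Lemma rpos_le f : rpos f <= `|f|. Proof. by rewrite ge_max ler_norm normr_ge0. Qed.
Lemma rneg_le f : rneg f <= `|f|.
Proof. by rewrite ge_max -normrN ler_norm normr_ge0. Qed.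
Lemma rposneg f : f = rpos f - rneg f.
Proof. by rewrite /rpos /rneg; case: (leP f 0) => h; case: (leP (- f) 0) => h'; lra. Qed.

Lemma rsummable_pos T (D : set T) f :
  rsummable D f -> rsummable D (fun x => rpos (f x)).
Proof.
apply: le_lt_trans; apply: le_esum => x Dx /=.
by rewrite lee_fin ger0_norm ?rpos_ge0 // rpos_le.
Qed.

Lemma rsummable_neg T (D : set T) f :
  rsummable D f -> rsummable D (fun x => rneg (f x)).
Proof.
apply: le_lt_trans; apply: le_esum => x Dx /=.
by rewrite lee_fin ger0_norm ?rneg_ge0 // rneg_le.
Qed.

Lemma rsummableD T (D : set T) (f g : T -> R) :
  rsummable D f -> rsummable D g -> rsummable D (fun x => f x + g x).
Proof. exact: summableD. Qed.

(** One inequality is proved for every nonnegative factor and then applied to c and to 1/c. *)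
Lemma esumZ T (D : set T) (a : T -> R) (c : R) : 0 <= c ->
  (forall x, D x -> 0 <= a x) ->
  (\esum_(x in D) (c * a x)%:E = c%:E * \esum_(x in D) (a x)%:E)%E.
Proof.
have le k (b : T -> R) : 0 <= k ->
    (\esum_(x in D) (k * b x)%:E <= k%:E * \esum_(x in D) (b x)%:E)%E.
  move=> k0; apply: ge_ereal_sup => _ [X [finX XD] <-].
  rewrite fsbig_finite // sumEFin -mulr_sumr EFinM.
  rewrite lee_wpmul2l // ?lee_fin //; apply: ereal_sup_ubound.
  by exists X => //; rewrite fsbig_finite // sumEFin.
move=> c0 a0; apply/eqP; rewrite eq_le le //=.
have [->|cn0] := eqVneq c 0.
  by rewrite mul0e esum_ge0 // => x _; rewrite mul0r.
have cp : 0 < c by rewrite lt_neqAle eq_sym cn0.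
have h := le c^-1 (fun x => c * a x); rewrite invr_ge0 in h.
have {h} := h c0; rewrite (_ : \esum_(x in D) (c^-1 * (c * a x))%:E = \esum_(x in D) (a x)%:E).
  move/(lee_wpmul2l (x := c%:E)); rewrite lee_fin => /(_ c0).
  by rewrite muleA -EFinM divff // mul1e.
by apply: eq_esum => x _; rewrite mulKf.
Qed.

Lemma rsummableZ T (D : set T) (f : T -> R) c :
  rsummable D f -> rsummable D (fun x => c * f x).
Proof.
move=> sf; rewrite /rsummable /summable.
rewrite (_ : \esum_(x in D) _ = \esum_(x in D) (`|c| * `|f x|)%:E); last first.
  by apply: eq_esum => x _ /=; rewrite normrM.
rewrite esumZ // lte_mul_pinfty // ?lee_fin //.
Qed.

Lemma rsumE T (D : set T) (f : T -> R) : rsum D f =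
  fine (\esum_(x in D) (rpos (f x))%:E) - fine (\esum_(x in D) (rneg (f x))%:E).
Proof. by []. Qed.

Lemma pos_fin_num T (D : set T) (f : T -> R) : rsummable D f ->
  \esum_(x in D) (rpos (f x))%:E \is a fin_num.
Proof.
move=> sf; apply: esum_fin_num => [x _|]; first exact: rpos_ge0.
by apply/rsummable_lty => [x _|]; [exact: rpos_ge0|exact: rsummable_pos].
Qed.

Lemma neg_fin_num T (D : set T) (f : T -> R) : rsummable D f ->
  \esum_(x in D) (rneg (f x))%:E \is a fin_num.
Proof.
move=> sf; apply: esum_fin_num => [x _|]; first exact: rneg_ge0.
by apply/rsummable_lty => [x _|]; [exact: rneg_ge0|exact: rsummable_neg].
Qed.

Lemma rsumD T (D : set T) (f g : T -> R) : rsummable D f -> rsummable D g ->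
  rsum D (fun x => f x + g x) = rsum D f + rsum D g.
Proof.
move=> sf sg; have spf := rsummable_pos sf; have snf := rsummable_neg sf.
have spg := rsummable_pos sg; have sng := rsummable_neg sg.
rewrite (@rsum_pm _ _ _ (fun x => rpos (f x) + rpos (g x))
                     (fun x => rneg (f x) + rneg (g x))).
- rewrite !rsumE.
  have -> : \esum_(x in D) (rpos (f x) + rpos (g x))%:E =
    (\esum_(x in D) (rpos (f x))%:E + \esum_(x in D) (rpos (g x))%:E)%E.
    by rewrite -esumD // => x _; rewrite lee_fin rpos_ge0.
  have -> : \esum_(x in D) (rneg (f x) + rneg (g x))%:E =
    (\esum_(x in D) (rneg (f x))%:E + \esum_(x in D) (rneg (g x))%:E)%E.
    by rewrite -esumD // => x _; rewrite lee_fin rneg_ge0.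
  have p1 := pos_fin_num sf; have p2 := pos_fin_num sg.
  have n1 := neg_fin_num sf; have n2 := neg_fin_num sg.
  by rewrite !fineD // opprD addrACA.
- by move=> x _; rewrite [in LHS](rposneg (f x)) [in LHS](rposneg (g x)); ring.
- by move=> x _; rewrite addr_ge0 ?rpos_ge0.
- by move=> x _; rewrite addr_ge0 ?rneg_ge0.
- exact: rsummableD.
- exact: rsummableD.
Qed.

Lemma rsumZ T (D : set T) (f : T -> R) c : rsummable D f ->
  rsum D (fun x => c * f x) = c * rsum D f.
Proof.
move=> sf; have spf := rsummable_pos sf; have snf := rsummable_neg sf.
have [c0|c0] := leP 0 c.
  rewrite (@rsum_pm _ _ _ (fun x => c * rpos (f x)) (fun x => c * rneg (f x))).
  - rewrite rsumE !esumZ //; try by move=> *; rewrite ?rpos_ge0 ?rneg_ge0.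
    have p1 := pos_fin_num sf; have n1 := neg_fin_num sf.
    by rewrite !fineM //= mulrBr.
  - by move=> x _; rewrite [in LHS](rposneg (f x)); ring.
  - by move=> x _; rewrite mulr_ge0 ?rpos_ge0.
  - by move=> x _; rewrite mulr_ge0 ?rneg_ge0.
  - exact: rsummableZ.
  - exact: rsummableZ.
have c1 : 0 <= - c by rewrite oppr_ge0 ltW.
rewrite (@rsum_pm _ _ _ (fun x => - c * rneg (f x)) (fun x => - c * rpos (f x))).
- rewrite rsumE !esumZ //; try by move=> *; rewrite ?rpos_ge0 ?rneg_ge0.
  have p1 := pos_fin_num sf; have n1 := neg_fin_num sf.
  by rewrite !fineM //= !mulNr opprK addrC mulrBr.
- by move=> x _; rewrite [in LHS](rposneg (f x)); ring.
- by move=> x _; rewrite mulr_ge0 ?rneg_ge0.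
- by move=> x _; rewrite mulr_ge0 ?rpos_ge0.
- exact: rsummableZ.
- exact: rsummableZ.
Qed.

Lemma rsum_norm_le T (D : set T) (f g : T -> R) K :
  (forall x, D x -> `|f x| <= g x) -> (\esum_(x in D) (g x)%:E <= K%:E)%E ->
  `|rsum D f| <= K.
Proof.
move=> fg gK; have g0 x : D x -> 0 <= g x by move=> /fg; exact: le_trans.
have bound (p : R -> R) : (forall x, 0 <= p x) -> (forall x, p x <= `|x|) ->
    0 <= fine (\esum_(x in D) (p (f x))%:E) <= K.
  move=> p0 pn; have le : (\esum_(x in D) (p (f x))%:E <= K%:E)%E.
    apply: le_trans gK; apply: le_esum => x Dx; rewrite lee_fin.
    exact: le_trans (pn _) (fg _ Dx).
  have fn : \esum_(x in D) (p (f x))%:E \is a fin_num.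
    by apply: esum_fin_num => //; apply: le_lt_trans le _; exact: ltry.
  rewrite -!lee_fin fineK // le andbT; apply: esum_ge0 => x _.
  by rewrite lee_fin.
have := bound rpos rpos_ge0 rpos_le; have := bound rneg rneg_ge0 rneg_le.
rewrite /rsum -/(rpos _) -/(rneg _) /rpos /rneg => /andP[a b] /andP[c d].
by rewrite ler_norml; apply/andP; split; lra.
Qed.

Lemma reindex_rsum T T' (P : set T) (Q : set T') (e : T -> T') (a : T' -> R) :
  set_bij P Q e -> rsum Q a = rsum P (fun i => a (e i)).
Proof. by move=> be; rewrite /rsum !(reindex_esum P Q e). Qed.

Lemma rsum_sub T (D E : set T) (f : T -> R) : D `<=` E ->
  (forall x, E x -> ~ D x -> f x = 0) -> rsum E f = rsum D f.
Proof.
move=> DE f0; rewrite /rsum.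
have H (p : R -> R) : p 0 = 0 ->
    \esum_(x in E) (p (f x))%:E = \esum_(x in D) (p (f x))%:E.
  move=> p0; rewrite esum_mkcond [RHS]esum_mkcond; apply: eq_esum => x _.
  case: ifPn => [|]; rewrite ?(inE, notin_setE) => Ex; last first.
    by rewrite ifN // notin_setE => /DE.
  by case: ifPn => //; rewrite notin_setE => Dx; rewrite f0 // p0.
rewrite (H (fun y => Num.max y 0)) ?maxxx // (H (fun y => Num.max (- y) 0)) //.
by rewrite oppr0 maxxx.
Qed.

Lemma rsum_fin (I : finType) (P : pred I) (f : I -> R) :
  rsum [set i | P i] f = \sum_(i | P i) f i.
Proof.
have H (p : R -> R) : (forall x, 0 <= p x) ->
    fine (\esum_(i in [set i | P i]) (p (f i))%:E) = \sum_(i | P i) p (f i).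
  move=> p0; have fs : finite_set [set i | P i] by exact: finite_finset.
  rewrite (esum_fset fs); last by move=> i _; rewrite lee_fin.
  by rewrite -(bigfs _ (index_enum_uniq I)) ?sumEFin // => i _; rewrite mem_index_enum.
rewrite /rsum (H _ rpos_ge0) (H _ rneg_ge0).
by rewrite -sumrB; apply: eq_bigr => i _; rewrite -rposneg.
Qed.

(** Tonelli for the positive and the negative parts, recombined by [rsum_pm]. *)
Lemma rsum_fubini (T1 T2 : choiceType) (D1 : set T1) (D2 : T1 -> set T2)
    (f : T1 -> T2 -> R) : rsummable (D1 `*`` D2) (fun k => f k.1 k.2) ->
  (forall i, D1 i -> rsummable (D2 i) (f i)) /\
  rsummable D1 (fun i => rsum (D2 i) (f i)) /\
  rsum (D1 `*`` D2) (fun k => f k.1 k.2) = rsum D1 (fun i => rsum (D2 i) (f i)).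
Proof.
move=> sf.
have si i : D1 i -> rsummable (D2 i) (f i).
  move=> Di; move: (sf); rewrite /rsummable /summable /=.
  rewrite -(@esum_esum _ _ _ D1 D2 (fun i j => `|f i j|%:E)); last first.
    by move=> *; rewrite lee_fin.
  move=> s; have := @summable_pinfty _ _ D1 (fun i => \esum_(j in D2 i) `|f i j|%:E).
  rewrite /summable (_ : \esum_(i in D1) `|_| = \esum_(i in D1) \esum_(j in D2 i) `|f i j|%:E)%E.
    move=> /(_ s i Di); rewrite gee0_abs // esum_ge0 // => *; rewrite lee_fin //.
  by apply: eq_esum => k _; rewrite gee0_abs // esum_ge0 // => *; rewrite lee_fin.
have H (p : R -> R) : (forall x, 0 <= p x) -> (forall x, p x <= `|x|) ->
    (\esum_(k in D1 `*`` D2) (p (f k.1 k.2))%:E < +oo)%E /\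
    \esum_(i in D1) (fine (\esum_(j in D2 i) (p (f i j))%:E))%:E =
    \esum_(k in D1 `*`` D2) (p (f k.1 k.2))%:E.
  move=> p0 pn; split.
    apply: le_lt_trans sf; apply: le_esum => k _ /=; rewrite lee_fin; exact: pn.
  rewrite -(@esum_esum _ _ _ D1 D2 (fun i j => (p (f i j))%:E)); last first.
    by move=> *; rewrite lee_fin.
  apply: eq_esum => i Di; rewrite fineK // esum_fin_num //.
  by apply: le_lt_trans (si _ Di); apply: le_esum => j _ /=; rewrite lee_fin.
have [Hp1 Hp2] := H _ rpos_ge0 rpos_le; have [Hn1 Hn2] := H _ rneg_ge0 rneg_le.
have up i : D1 i -> 0 <= fine (\esum_(j in D2 i) (rpos (f i j))%:E).
  by move=> _; apply: fine_ge0; apply: esum_ge0 => *; rewrite lee_fin rpos_ge0.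
have un i : D1 i -> 0 <= fine (\esum_(j in D2 i) (rneg (f i j))%:E).
  by move=> _; apply: fine_ge0; apply: esum_ge0 => *; rewrite lee_fin rneg_ge0.
have su : rsummable D1 (fun i => fine (\esum_(j in D2 i) (rpos (f i j))%:E)).
  by apply/rsummable_lty => //; rewrite Hp2.
have sv : rsummable D1 (fun i => fine (\esum_(j in D2 i) (rneg (f i j))%:E)).
  by apply/rsummable_lty => //; rewrite Hn2.
split=> //; split.
  rewrite (_ : (fun i => _) = (fun i => fine (\esum_(j in D2 i) (rpos (f i j))%:E) +
     (-1) * fine (\esum_(j in D2 i) (rneg (f i j))%:E))).
    by apply: rsummableD => //; exact: rsummableZ.
  by apply/funext => i; rewrite rsumE mulN1r.
rewrite (@rsum_pm _ _ (fun i => rsum (D2 i) (f i)) _ _ _ up un su sv) //.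
by rewrite Hp2 Hn2 rsumE.
Qed.
End RealSums.

(** * Unconditional sums of complex families *)

Section ComplexSums.
Variable R : realType.
Local Notation C := R[i].
Implicit Types (T : choiceType).

Lemma csummableP T (D : set T) (f : T -> C) : csummable D f <->
  rsummable D (fun x => Re (f x)) /\ rsummable D (fun x => Im (f x)).
Proof.
split=> [sf|[sr si]].
  by split; apply: le_rsummable sf => x _; [exact: le_Re_normc|exact: le_Im_normc].
apply: (@le_rsummable _ _ D (fun x => normc (f x))
  (fun x => `|Re (f x)| + `|Im (f x)|)).
  by move=> x _; rewrite ger0_norm ?normc_ge0 // normc_le.
apply: rsummableD.
  by apply: le_lt_trans sr; apply: le_esum => x _ /=; rewrite lee_fin normr_id.
by apply: le_lt_trans si; apply: le_esum => x _ /=; rewrite lee_fin normr_id.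
Qed.

Lemma eq_csum T (D : set T) (f g : T -> C) :
  (forall x, D x -> f x = g x) -> csum D f = csum D g.
Proof.
by move=> fg; rewrite /csum; congr (_ +i* _); apply: eq_rsum => x /fg ->.
Qed.

Lemma csummableD T (D : set T) (f g : T -> C) :
  csummable D f -> csummable D g -> csummable D (fun x => f x + g x).
Proof.
move=> /csummableP[fr fi] /csummableP[gr gi]; apply/csummableP; split.
  rewrite (_ : (fun x => _) = (fun x => Re (f x) + Re (g x))).
    exact: rsummableD.
  by apply/funext => x; rewrite raddfD.
rewrite (_ : (fun x => _) = (fun x => Im (f x) + Im (g x))).
  exact: rsummableD.
by apply/funext => x; rewrite raddfD.
Qed.

Lemma csumD T (D : set T) (f g : T -> C) : csummable D f -> csummable D g ->
  csum D (fun x => f x + g x) = csum D f + csum D g.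
Proof.
move=> /csummableP[fr fi] /csummableP[gr gi]; rewrite /csum.
apply/eqP; rewrite eq_complex /= -!rsumD //; apply/andP; split; apply/eqP;
  by apply: eq_rsum => x _; rewrite raddfD.
Qed.

Lemma csummableZ T (D : set T) (a : C) (f : T -> C) :
  csummable D f -> csummable D (fun x => a * f x).
Proof.
move=> /csummableP[fr fi]; apply/csummableP; split.
  rewrite (funext (fun x => Re_mulE a (f x))).
  by apply: rsummableD; exact: rsummableZ.
rewrite (funext (fun x => Im_mulE a (f x))).
by apply: rsummableD; exact: rsummableZ.
Qed.

Lemma csumZ T (D : set T) (a : C) (f : T -> C) : csummable D f ->
  csum D (fun x => a * f x) = a * csum D f.
Proof.
move=> /csummableP[fr fi]; rewrite /csum.
rewrite (funext (fun x => Re_mulE a (f x))) (funext (fun x => Im_mulE a (f x))).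
rewrite !rsumD ?rsumZ //; try exact: rsummableZ.
apply/eqP; rewrite eq_complex Re_mulE Im_mulE /=; apply/andP; split; apply/eqP; ring.
Qed.

Lemma reindex_csum T T' (P : set T) (Q : set T') (e : T -> T') (a : T' -> C) :
  set_bij P Q e -> csum Q a = csum P (fun i => a (e i)).
Proof. by move=> be; rewrite /csum !(reindex_rsum _ be). Qed.

Lemma reindex_csummable T T' (P : set T) (Q : set T') (e : T -> T') (a : T' -> C) :
  set_bij P Q e -> csummable Q a -> csummable P (fun i => a (e i)).
Proof. by move=> be; rewrite /csummable /summable (reindex_esum P Q e). Qed.

Lemma csum_sub T (D E : set T) (f : T -> C) : D `<=` E ->
  (forall x, E x -> ~ D x -> f x = 0) -> csum E f = csum D f.
Proof.
by move=> DE f0; rewrite /csum !(rsum_sub DE) // => x Ex /(f0 _ Ex) ->.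
Qed.

Lemma csum_fin (I : finType) (P : pred I) (f : I -> C) :
  csum [set i | P i] f = \sum_(i | P i) f i.
Proof.
by rewrite /csum !rsum_fin; apply/eqP; rewrite eq_complex /= !raddf_sum !eqxx.
Qed.

Lemma csum_fubini (T1 T2 : choiceType) (D1 : set T1) (D2 : T1 -> set T2)
    (f : T1 -> T2 -> C) : csummable (D1 `*`` D2) (fun k => f k.1 k.2) ->
  (forall i, D1 i -> csummable (D2 i) (f i)) /\
  csummable D1 (fun i => csum (D2 i) (f i)) /\
  csum (D1 `*`` D2) (fun k => f k.1 k.2) = csum D1 (fun i => csum (D2 i) (f i)).
Proof.
move=> /csummableP[fr fi].
have [r1 [r2 r3]] := @rsum_fubini _ _ _ D1 D2 (fun x y => Re (f x y)) fr.
have [i1 [i2 i3]] := @rsum_fubini _ _ _ D1 D2 (fun x y => Im (f x y)) fi.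
split; first by move=> i Di; apply/csummableP; split; [exact: r1|exact: i1].
split; first by apply/csummableP.
by rewrite /csum r3 i3.
Qed.

Lemma csum_norm_le T (D : set T) (f : T -> C) (g : T -> R) K :
  (forall x, D x -> normc (f x) <= g x) -> (\esum_(x in D) (g x)%:E <= K%:E)%E ->
  normc (csum D f) <= K + K.
Proof.
move=> fg gK; apply: le_trans (normc_le _) _; rewrite /csum /=; apply: lerD.
  by apply: rsum_norm_le gK => x Dx; apply: le_trans (le_Re_normc _) (fg _ Dx).
by apply: rsum_norm_le gK => x Dx; apply: le_trans (le_Im_normc _) (fg _ Dx).
Qed.
End ComplexSums.

(** * Translations and reflections of Lebesgue measure *)

Section Affine.
Variable R : realType.
Local Notation mu := (@lebesgue_measure R).
Local Notation mR := (measurableTypeR R).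

Definition shiftR (c : R) : mR -> mR := fun y => y + c.
Definition reflR (c : R) : mR -> mR := fun y => c - y.

Lemma measurable_shiftR c : measurable_fun setT (shiftR c).
Proof. exact: measurable_funD. Qed.

Lemma measurable_reflR c : measurable_fun setT (reflR c).
Proof. exact: measurable_funB. Qed.

HB.instance Definition _ c := isMeasurableFun.Build _ _ _ _ _ (measurable_shiftR c).
HB.instance Definition _ c := isMeasurableFun.Build _ _ _ _ _ (measurable_reflR c).

Lemma pushforward_shiftR c (A : set R) : measurable A ->
  pushforward mu (shiftR c) A = mu A.
Proof.
move=> mA; apply/esym/lebesgue_measure_unique => //= _ [[a b]] _ <-.
rewrite /pushforward (_ : shiftR c @^-1` _ = `]a - c, b - c]%classic); last first.
  by apply/seteqP; split => x /=; rewrite !in_itv /= /shiftR ltrBlDr lerBrDr.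
rewrite !lebesgue_measure_itv /= !lte_fin ltrD2r; case: ifP => // _.
by rewrite -!EFinB; congr EFin; ring.
Qed.

Lemma pushforward_reflR c (A : set R) : measurable A ->
  pushforward mu (reflR c) A = mu A.
Proof.
move=> mA; apply/esym/lebesgue_measure_unique => //= _ [[a b]] _ <-.
rewrite /pushforward (_ : reflR c @^-1` _ = `[c - b, c - a[%classic); last first.
  apply/seteqP; split => x /=; rewrite !in_itv /= /reflR => /andP[h1 h2];
    by apply/andP; split; lra.
rewrite !lebesgue_measure_itv /= !lte_fin ltrD2l ltrN2; case: ifP => // _.
by rewrite -!EFinB; congr EFin; ring.
Qed.

Lemma ge0_integral_shiftR c (D : set R) (f : R -> \bar R) : measurable D ->
  measurable_fun D f -> (forall y, 0 <= f y)%E ->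
  (\int[mu]_(y in D) f y = \int[mu]_(x in shiftR c @^-1` D) f (shiftR c x))%E.
Proof.
move=> mD mf f0; rewrite -(ge0_integral_pushforward (measurable_shiftR c)) //.
apply: eq_measure_integral => A mA _; exact/esym/pushforward_shiftR.
Qed.

Lemma ge0_integral_reflR c (f : R -> \bar R) :
  measurable_fun setT f -> (forall y, 0 <= f y)%E ->
  (\int[mu]_y f y = \int[mu]_x f (reflR c x))%E.
Proof.
move=> mf f0; rewrite -[in RHS](preimage_setT (reflR c)).
rewrite -(ge0_integral_pushforward (measurable_reflR c)) //.
apply: eq_measure_integral => A mA _; exact/esym/pushforward_reflR.
Qed.

Lemma Rintegral_pm d (T : measurableType d) (m : {measure set T -> \bar R})
    (D : set T) (f : T -> R) : measurable_fun D f ->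
  \int[m]_(x in D) f x = fine (\int[m]_(x in D) (rpos (f x))%:E -
                               \int[m]_(x in D) (rneg (f x))%:E)%E.
Proof.
move=> mf; rewrite /Rintegral integralE; congr (fine (_ - _)%E);
  apply: eq_integral => x _.
  by rewrite funeposE /rpos -EFin_max.
by rewrite funenegE /rneg -EFin_max.
Qed.

Lemma Rintegral_reflR c (f : R -> R) : measurable_fun setT f ->
  \int[mu]_y f y = \int[mu]_x f (c - x).
Proof.
move=> mf; have mfr : measurable_fun setT (fun x : R => f (c - x)).
  exact: (measurableT_comp mf (measurable_reflR c)).
rewrite !Rintegral_pm //; congr (fine (_ - _)%E).
  rewrite (ge0_integral_reflR c) // => [|y]; last by rewrite lee_fin rpos_ge0.
  by apply/measurable_EFinP; apply: measurable_maxr.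
rewrite (ge0_integral_reflR c) // => [|y]; last by rewrite lee_fin rneg_ge0.
by apply/measurable_EFinP; apply: measurable_maxr => //; exact: measurable_funN.
Qed.
End Affine.

(** * Sums over countable types as series *)

Section Countable.
Variable R : realType.
Local Open Scope ereal_scope.

(** The term of index n when D is enumerated by codes; codes that decode to nothing, or outside D,
    contribute 0. In this form monotone convergence for series applies. *)
Definition on_code (T : countType) (D : set T) (n : nat) (F : T -> \bar R) : \bar R :=
  if (@pickle_inv T n) is Some x then (if x \in D then F x else 0) else 0.

Lemma on_code_ge0 (T : countType) (D : set T) n (F : T -> \bar R) :
  (forall x, D x -> 0 <= F x) -> 0 <= on_code D n F.
Proof.
move=> F0; rewrite /on_code; case: (@pickle_inv T n) => // x.
by case: ifPn => //; rewrite inE; exact: F0.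
Qed.

Lemma esum_countable (T : countType) (D : set T) (a : T -> \bar R) :
  (forall x, D x -> 0 <= a x) ->
  \esum_(x in D) a x = \sum_(n <oo) on_code D n a.
Proof.
move=> a0; rewrite nneseries_esumT => [|n]; last exact: on_code_ge0.
transitivity (\esum_(n in pickle @` D) on_code D n a).
  rewrite esum_image; last by move=> x y _ _; exact: (pcan_inj pickleK_inv).
  by apply: eq_esum => x Dx; rewrite /on_code pickleK_inv mem_set.
rewrite esum_mkcond; apply: eq_esum => n _; case: ifPn => //.
rewrite notin_setE => nD; rewrite /on_code.
case E : (@pickle_inv T n) => [x|//]; case: ifPn => //; rewrite inE => Dx.
exfalso; apply: nD; exists x => //.
by have := @pickle_invK T n; rewrite E.
Qed.
End Countable.

(** * Exchanging sums and integrals *)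

Section Exchange.
Context d (X : measurableType d) (R : realType) (mu : {measure set X -> \bar R}).
Variables (T : countType) (D : set T) (A : set X).
Hypothesis mA : measurable A.

Lemma ge0_esum_integral (h : T -> X -> R) : (forall i x, 0 <= h i x) ->
  (forall i, D i -> measurable_fun A (h i)) ->
  measurable_fun A (fun x => \esum_(i in D) (h i x)%:E) /\
  (\int[mu]_(x in A) (\esum_(i in D) (h i x)%:E) =
   \esum_(i in D) \int[mu]_(x in A) (h i x)%:E)%E.
Proof.
move=> h0 mh.
have E x : \esum_(i in D) (h i x)%:E =
    (\sum_(n <oo) on_code D n (fun i => (h i x)%:E))%E.
  by apply: esum_countable => i _; rewrite lee_fin.
rewrite (funext E).
have mc n : measurable_fun A (fun x => on_code D n (fun i => (h i x)%:E)).
  rewrite /on_code; case: (@pickle_inv T n) => [i|]; last exact: measurable_cst.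
  case: (boolP (i \in D)) => [|_]; last exact: measurable_cst.
  by rewrite inE => Di; apply/measurable_EFinP; exact: mh.
have c0 n x : (0 <= on_code D n (fun i => (h i x)%:E))%E.
  by apply: on_code_ge0 => i _; rewrite lee_fin.
split.
  have := @ge0_emeasurable_sum _ _ _ A (fun n x => on_code D n (fun i => (h i x)%:E)) xpredT.
  by apply.
rewrite integral_nneseries // esum_countable; last first.
  by move=> i _; apply: integral_ge0 => x _; rewrite lee_fin.
apply: eq_eseriesr => n _; rewrite /on_code; case: (@pickle_inv T n) => [i|]; last first.
  by rewrite integral0.
by case: ifPn => // _; rewrite integral0.
Qed.

(** Domination by a summable family on a set of finite measure makes the sums of positive and of
    negative parts bounded functions, so the nonnegative case applies to each. *)
Lemma rsum_integral (g : T -> X -> R) (M : T -> R) : (mu A < +oo)%E ->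
  (forall i, D i -> measurable_fun A (g i)) ->
  (forall i x, D i -> A x -> `|g i x| <= M i) -> rsummable D M ->
  [/\ mu.-integrable A (fun x => (rsum D (g^~ x))%:E),
      rsummable D (fun i => \int[mu]_(x in A) g i x) &
      \int[mu]_(x in A) rsum D (g^~ x) = rsum D (fun i => \int[mu]_(x in A) g i x)].
Proof.
move=> muA mg gM sM.
have [K MK] : exists K : R, \esum_(i in D) `|(M i)%:E|%E = K%:E.
  by exists (fine (\esum_(i in D) `|(M i)%:E|%E)); rewrite fineK // -summableE.
have H (p : R -> R) : (forall x, 0 <= p x) -> (forall x, p x <= `|x|) ->
    measurable_fun setT p ->
    [/\ forall x, A x -> (\esum_(i in D) (p (g i x))%:E <= K%:E)%E,
     mu.-integrable A (fun x => (fine (\esum_(i in D) (p (g i x))%:E))%:E),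
     forall i, D i -> mu.-integrable A (fun x => (p (g i x))%:E),
     rsummable D (fun i => \int[mu]_(x in A) p (g i x)) &
     (\int[mu]_(x in A) (fine (\esum_(i in D) (p (g i x))%:E))%:E =
      \esum_(i in D) (\int[mu]_(x in A) p (g i x))%:E)%E].
  move=> p0 pn mp.
  have le x : A x -> (\esum_(i in D) (p (g i x))%:E <= K%:E)%E.
    move=> Ax; rewrite -MK; apply: le_esum => i Di; rewrite lee_fin.
    apply: le_trans (pn _) _; apply: le_trans (gM _ _ Di Ax) (ler_norm _).
  have ge x : (0 <= \esum_(i in D) (p (g i x))%:E)%E.
    by apply: esum_ge0 => i _; rewrite lee_fin.
  have fE x : A x -> (fine (\esum_(i in D) (p (g i x))%:E))%:E =
      \esum_(i in D) (p (g i x))%:E.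
    move=> Ax; rewrite fineK // ge0_fin_numE //.
    exact: le_lt_trans (le _ Ax) (ltry _).
  have mpg i : D i -> measurable_fun A (fun x => p (g i x)).
    by move=> Di; exact: (measurableT_comp mp (mg _ Di)).
  have [mS iS] := ge0_esum_integral (fun i x => p0 (g i x)) mpg.
  have mS' : measurable_fun A (fun x => (fine (\esum_(i in D) (p (g i x))%:E))%:E).
    by apply: eq_measurable_fun mS => x; rewrite inE => Ax; rewrite fE.
  have ipg i : D i -> mu.-integrable A (fun x => (p (g i x))%:E).
    move=> Di; apply: measurable_bounded_integrable => //; first exact: mpg.
    exists `|M i|; split; first exact: num_real.
    move=> y My x Ax /=; rewrite ger0_norm //.
    apply: le_trans (pn _) _; apply: le_trans (gM _ _ Di Ax) _.
    exact: le_trans (ler_norm _) (ltW My).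
  have iF : mu.-integrable A (fun x => (fine (\esum_(i in D) (p (g i x))%:E))%:E).
    apply: measurable_bounded_integrable => //; first exact/measurable_EFinP.
    exists `|K|; split; first exact: num_real.
    move=> y Ky x Ax /=; rewrite ger0_norm ?fine_ge0 //.
    rewrite -lee_fin fE // (le_trans (le _ Ax)) // lee_fin.
    exact: le_trans (ler_norm _) (ltW Ky).
  have E : (\int[mu]_(x in A) (fine (\esum_(i in D) (p (g i x))%:E))%:E =
      \esum_(i in D) (\int[mu]_(x in A) p (g i x))%:E)%E.
    transitivity (\int[mu]_(x in A) \esum_(i in D) (p (g i x))%:E)%E.
      by apply: eq_integral => x; rewrite inE => Ax; rewrite fE.
    rewrite iS; apply: eq_esum => i Di; rewrite /Rintegral fineK //.
    exact: integrable_fin_num (ipg _ Di).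
  split=> //; apply/rsummable_lty.
    by move=> i Di; apply: Rintegral_ge0 => x _.
  rewrite -E; have := integrable_fin_num mA iF.
  by rewrite ge0_fin_numE // integral_ge0 // => x Ax; rewrite lee_fin fine_ge0.
have mpos : measurable_fun setT (@rpos R) by apply: measurable_maxr.
have mneg : measurable_fun setT (@rneg R).
  by apply: measurable_maxr => //; exact: measurable_funN.
have [pl pi pj ps pE] := H _ (@rpos_ge0 R) (@rpos_le R) mpos.
have [nl ni nj ns nE] := H _ (@rneg_ge0 R) (@rneg_le R) mneg.
have gE i : D i -> \int[mu]_(x in A) g i x =
    \int[mu]_(x in A) rpos (g i x) - \int[mu]_(x in A) rneg (g i x).
  move=> Di; rewrite -RintegralB //; [|exact: pj|exact: nj].
  by apply: eq_Rintegral => x _; exact: rposneg.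
have u0 i : D i -> 0 <= \int[mu]_(x in A) rpos (g i x).
  by move=> _; apply: Rintegral_ge0 => x _; exact: rpos_ge0.
have v0 i : D i -> 0 <= \int[mu]_(x in A) rneg (g i x).
  by move=> _; apply: Rintegral_ge0 => x _; exact: rneg_ge0.
split.
- by rewrite (_ : (fun x => _) = (fun x => (fine (\esum_(i in D) (rpos (g i x))%:E))%:E -
    (fine (\esum_(i in D) (rneg (g i x))%:E))%:E)%E) //; exact: integrableB.
- have : rsummable D (fun i => \int[mu]_(x in A) rpos (g i x) +
      (-1) * \int[mu]_(x in A) rneg (g i x)).
    by apply: rsummableD => //; exact: rsummableZ.
  apply: le_lt_trans; apply: le_esum => i Di /=.
  by rewrite gE // mulN1r.
- rewrite (rsum_pm gE u0 v0 ps ns) -pE -nE -RintegralB //.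
Qed.
End Exchange.

(** * Unfolding to the line, and integrals over the unit cube *)

Section Cube.
Variable R : realType.
Local Notation mu := (@lebesgue_measure R).
Local Notation I01 := (`[(0:R), (1:R)[%classic).

Lemma floor_translate (k : int) (x : R) :
  (- k%:~R <= x < 1 - k%:~R) = (Num.floor x == - k).
Proof.
have e : (- k + 1)%:~R = 1 - k%:~R :> R by rewrite intrD mulrNz addrC.
apply/idP/eqP => [h|h].
  by apply: floor_def; rewrite e mulrNz.
by have := floor_itv x; rewrite h e mulrNz.
Qed.

Lemma ge0_esum_unfold (h : R -> R) : measurable_fun setT h -> (forall x, 0 <= h x) ->
  \esum_(k in [set: int]) (\int[mu]_(y in I01) (h (y - k%:~R))%:E)%E =
  (\int[mu]_y (h y)%:E)%E.
Proof.
move=> mh h0.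
have mEh (D : set R) : measurable_fun D (fun y => (h y)%:E).
  by apply/measurable_EFinP; exact: measurable_funTS.
pose J (k : int) : set R := `[- k%:~R, 1 - k%:~R[%classic.
pose F (n : nat) : set R := if @pickle_inv int n is Some k then J k else set0.
have FJ n x : F n x -> @pickle_inv int n = Some (- Num.floor x).
  rewrite /F; case: (@pickle_inv int n) => [k|//]; rewrite /J /= in_itv /= => Fx.
  by move: Fx; rewrite floor_translate => /eqP ->; rewrite opprK.
have cov : \bigcup_n F n = setT.
  rewrite -subTset => x _; exists (pickle (- Num.floor x)); first exact: I.
  by rewrite /F pickleK_inv /J /= in_itv /= floor_translate opprK.
have tF : trivIset setT F.
  move=> n m _ _ [x [/FJ en /FJ em]].
  have := @pickle_invK int n; have := @pickle_invK int m.
  by rewrite en em /= => <- <-.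
have mF n : measurable (F n).
  by rewrite /F; case: (@pickle_inv int n) => [k|]; [exact: measurable_itv|exact: measurable0].
rewrite -cov (ge0_integral_bigcup mu mF (mEh _) _ tF); last first.
  by move=> x _; rewrite lee_fin.
rewrite esum_countable; last first.
  by move=> k _; apply: integral_ge0 => x _; rewrite lee_fin.
apply: eq_eseriesr => n _; rewrite /on_code /F.
case: (@pickle_inv int n) => [k|]; last by rewrite integral_set0.
rewrite in_setT (ge0_integral_shiftR (- k%:~R) _ (mEh _)) //; last first.
  exact: measurable_itv.
rewrite (_ : shiftR (- k%:~R) @^-1` J k = I01) //.
by apply/seteqP; split => x; rewrite /J /shiftR /= !in_itv /=; move=> /andP[a b];
  apply/andP; split; lra.
Qed.

Lemma rsum_unfold (h : R -> R) : measurable_fun setT h ->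
  mu.-integrable setT (EFin \o h) ->
  rsummable [set: int] (fun k => \int[mu]_(y in I01) h (y - k%:~R)) /\
  rsum [set: int] (fun k => \int[mu]_(y in I01) h (y - k%:~R)) = \int[mu]_y h y.
Proof.
move=> mh ih.
have mshift (g : R -> R) (k : int) : measurable_fun setT g ->
    measurable_fun setT (fun y : R => g (y - k%:~R)).
  by move=> mg; exact: (measurableT_comp mg (measurable_shiftR (- k%:~R))).
have mpos : measurable_fun setT (@rpos R) by apply: measurable_maxr.
have mneg : measurable_fun setT (@rneg R).
  by apply: measurable_maxr => //; exact: measurable_funN.
have H (p : R -> R) : (forall x, 0 <= p x) -> (forall x, p x <= `|x|) ->
    measurable_fun setT p ->
    [/\ mu.-integrable setT (fun y => (p (h y))%:E),
        forall k : int, mu.-integrable I01 (fun y => (p (h (y - k%:~R)))%:E),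
        rsummable [set: int] (fun k => \int[mu]_(y in I01) p (h (y - k%:~R))) &
        \esum_(k in [set: int]) (\int[mu]_(y in I01) p (h (y - k%:~R)))%:E =
        (\int[mu]_y (p (h y))%:E)%E].
  move=> p0 pn mp.
  have mph : measurable_fun setT (fun y => p (h y)) by exact: measurableT_comp.
  have E := ge0_esum_unfold mph (fun y => p0 (h y)).
  have iph : mu.-integrable setT (fun y => (p (h y))%:E).
    apply: le_integrable ih => //; first exact/measurable_EFinP.
    by move=> y _; rewrite lee_fin /= ger0_norm // pn.
  have fin : (\int[mu]_y (p (h y))%:E < +oo)%E.
    by have := integrable_fin_num measurableT iph; rewrite ge0_fin_numE // integral_ge0 // => y _; rewrite lee_fin.
  have k0 k : (0 <= \int[mu]_(y in I01) (p (h (y - k%:~R)))%:E)%E.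
    by apply: integral_ge0 => y _; rewrite lee_fin.
  have sk : summable [set: int] (fun k => \int[mu]_(y in I01) (p (h (y - k%:~R)))%:E)%E.
    rewrite /summable (_ : \esum_(k in setT) _ = \esum_(k in [set: int]) (\int[mu]_(y in I01) (p (h (y - k%:~R)))%:E)%E).
      by rewrite E.
    by apply: eq_esum => k _; rewrite gee0_abs.
  have finK (k : int) : (\int[mu]_(y in I01) (p (h (y - k%:~R)))%:E < +oo)%E.
    by have := summable_pinfty sk (I : [set: int] k); rewrite gee0_abs.
  have rE (k : int) : (\int[mu]_(y in I01) p (h (y - k%:~R)))%:E =
      (\int[mu]_(y in I01) (p (h (y - k%:~R)))%:E)%E.
    by rewrite /Rintegral fineK // ge0_fin_numE.
  have E' : \esum_(k in [set: int]) (\int[mu]_(y in I01) p (h (y - k%:~R)))%:E =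
      (\int[mu]_y (p (h y))%:E)%E.
    by rewrite -E; apply: eq_esum => k _; rewrite rE.
  split=> //.
    move=> k; apply/integrableP; split.
      by apply/measurable_EFinP; apply: measurable_funTS; exact: (mshift _ k mph).
    rewrite (_ : \int[mu]_(y in I01) _ = \int[mu]_(y in I01) (p (h (y - k%:~R)))%:E)%E //.
    by apply: eq_integral => y _; rewrite gee0_abs ?lee_fin.
  apply/rsummable_lty; last by rewrite E'.
  by move=> k _; apply: Rintegral_ge0 => y _.
have [pi pk ps pE] := H _ (@rpos_ge0 R) (@rpos_le R) mpos.
have [ni nk ns nE] := H _ (@rneg_ge0 R) (@rneg_le R) mneg.
have gE (k : int) : [set: int] k -> \int[mu]_(y in I01) h (y - k%:~R) =
    \int[mu]_(y in I01) rpos (h (y - k%:~R)) - \int[mu]_(y in I01) rneg (h (y - k%:~R)).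
  move=> _; rewrite -RintegralB; [|exact: measurable_itv|exact: pk|exact: nk].
  by apply: eq_Rintegral => y _; exact: rposneg.
have u0 (k : int) : [set: int] k -> 0 <= \int[mu]_(y in I01) rpos (h (y - k%:~R)).
  by move=> _; apply: Rintegral_ge0 => x _; exact: rpos_ge0.
have v0 (k : int) : [set: int] k -> 0 <= \int[mu]_(y in I01) rneg (h (y - k%:~R)).
  by move=> _; apply: Rintegral_ge0 => x _; exact: rneg_ge0.
split.
  have : rsummable [set: int] (fun k => \int[mu]_(y in I01) rpos (h (y - k%:~R)) +
      (-1) * \int[mu]_(y in I01) rneg (h (y - k%:~R))).
    by apply: rsummableD => //; exact: rsummableZ.
  apply: le_lt_trans; apply: le_esum => k Dk /=.
  by rewrite gE // mulN1r.
rewrite (rsum_pm gE u0 v0 ps ns) pE nE -RintegralB //.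
by apply: eq_Rintegral => y _; rewrite -rposneg.
Qed.
Local Notation mu3 := ((mu \x mu) \x mu)%E.

Lemma unit_cubeE : @unit_cube R = (I01 `*` I01) `*` I01.
Proof.
apply/seteqP; split=> -[[x y] z]; rewrite /unit_cube /= !in_itv /=.
  by move=> [-> -> ->].
by move=> [[-> ->] ->].
Qed.

Lemma measurable_I01 : measurable I01. Proof. exact: measurable_itv. Qed.

Lemma measurable_cube : measurable (@unit_cube R).
Proof. by rewrite unit_cubeE; do 2 (apply: measurableX => //). Qed.

Lemma mu_I01 : mu I01 = 1%E.
Proof. by rewrite lebesgue_measure_itv /= lte_fin ltr01 oppr0 adde0. Qed.

Lemma mu_cube : mu3 (@unit_cube R) = 1%E.
Proof.
have mI := measurable_I01.
have h2 : (mu \x mu)%E (I01 `*` I01) = 1%E.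
  transitivity (mu I01 * mu I01)%E; first exact: product_measure1E.
  by rewrite mu_I01 mule1.
transitivity ((mu \x mu)%E (I01 `*` I01) * mu I01)%E; last by rewrite h2 mu_I01 mule1.
by rewrite unit_cubeE; apply: product_measure1E => //; exact: measurableX.
Qed.

Lemma mu_cube_lty : (mu3 (@unit_cube R) < +oo)%E.
Proof. by rewrite mu_cube ltry. Qed.

Lemma measurable_prod3 (a b : R -> R) : measurable_fun setT a -> measurable_fun setT b ->
  measurable_fun setT (fun v : R * R * R => a v.1.1 * b v.1.2).
Proof.
move=> ma mb; apply: measurable_funM.
  apply: measurableT_comp ma _; apply: measurableT_comp; [exact: measurable_fst|exact: measurable_fst].
apply: measurableT_comp mb _; apply: measurableT_comp; [exact: measurable_snd|exact: measurable_fst].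
Qed.

(* The canonical sigma-finite structure on a product measure is only declared
   for products of subprobabilities. *)
Definition mu2 := product_measure1 mu mu.
HB.instance Definition _ := Measure.on mu2.

Lemma mu2_sigma_finite : sigma_finite setT mu2.
Proof.
have /sigma_finiteP[F [TF ndF Foo]] := sigma_finiteT mu.
exists (fun n => F n `*` F n).
  rewrite -setXTT TF predeqE => -[x y]; split.
    move=> [/= [n _ Fnx] [k _ Gky]]; exists (maxn n k) => //; split.
    - by move: x Fnx; exact/subsetPset/ndF/leq_maxl.
    - by move: y Gky; exact/subsetPset/ndF/leq_maxr.
  by move=> [n _ []/= ? ?]; split; exists n.
move=> k; have [? ?] := Foo k.
split; first exact: measurableX.
by rewrite /mu2 product_measure1E // lte_mul_pinfty // ge0_fin_numE.
Qed.
HB.instance Definition _ := Measure_isSigmaFinite.Build _ _ _ mu2 mu2_sigma_finite.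

(** Fubini twice, after extension by 0 to the whole space: the z-integral is 1 and the remaining
    double integral factors. *)
Lemma cube_integral (a b : R -> R) K : measurable_fun setT a -> measurable_fun setT b ->
  (forall x, `|a x| <= 1) -> (forall x, `|b x| <= K) ->
  mu3.-integrable (@unit_cube R) (fun v => (a v.1.1 * b v.1.2)%:E) /\
  \int[mu3]_(v in @unit_cube R) (a v.1.1 * b v.1.2) =
  (\int[mu]_(x in I01) a x) * (\int[mu]_(x in I01) b x).
Proof.
move=> ma mb a1 bK.
have i1 : mu3.-integrable (@unit_cube R) (fun v => (a v.1.1 * b v.1.2)%:E).
  apply: measurable_bounded_integrable.
  - exact: measurable_cube.
  - exact: mu_cube_lty.
  - by apply: measurable_funTS; exact: measurable_prod3.
  exists K; split; first exact: num_real.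
  move=> y Ky v _ /=; rewrite normrM -[y]mul1r.
  by apply: ler_pM => //; apply: le_trans (bK _) (ltW Ky).
split=> //.
have mI := measurable_I01.
have muI : (mu I01 < +oo)%E by rewrite mu_I01 ltry.
pose aI := a \_ I01; pose bI := b \_ I01.
have iI (c : R -> R) L : measurable_fun setT c -> (forall x, `|c x| <= L) ->
    mu.-integrable setT (fun x => ((c \_ I01) x)%:E).
  move=> mc cL; have : mu.-integrable I01 (EFin \o c).
    apply: measurable_bounded_integrable => //; first exact: measurable_funTS.
    exists L; split; first exact: num_real.
    by move=> y Ly x _ /=; apply: le_trans (cL _) (ltW Ly).
  move=> ic; have := (@integrable_mkcond _ _ _ mu I01 (EFin \o c) (measurable_itv _)).1 ic; apply: eq_integrable => // x _.
  by rewrite restrict_EFin.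
have iaI := iI a 1 ma a1; have ibI := iI b K mb bK.
pose F (v : R * R * R) : \bar R := ((aI v.1.1 * bI v.1.2)%:E * (\1_I01 v.2)%:E)%E.
have FE : (fun v : R * R * R => (a v.1.1 * b v.1.2)%:E) \_ (@unit_cube R) = F.
  apply/funext => -[[x y] z]; rewrite unit_cubeE /F /aI /bI /patch /= indicE !in_setX /=.
  case: (x \in I01); case: (y \in I01); case: (z \in I01);
    by rewrite /= ?mul0r ?mulr0 ?mule0 ?mul0e ?mule1.
have iF : mu3.-integrable setT F.
  by rewrite -FE; exact: (@integrable_mkcond _ _ _ mu3 (@unit_cube R) _ measurable_cube).1 i1.
have inner p : fubini_F mu F p = (aI p.1 * bI p.2)%:E.
  rewrite /fubini_F /F /= integralZl //; last exact: integrable_indic_itv.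
  by rewrite integral_indic // setIT; transitivity ((aI p.1 * bI p.2)%:E * 1)%E; [congr (_ * _)%E; exact: mu_I01|rewrite mule1].
have i2 : (mu \x mu)%E.-integrable setT (fun p => (aI p.1 * bI p.2)%:E).
  have h := @integrable_fubini_F _ _ _ _ R mu2 mu F iF.
  by rewrite -(funext inner).
have fA : (\int[mu]_x (aI x)%:E)%E = (\int[mu]_(x in I01) a x)%:E.
  rewrite -(fineK (integrable_fin_num measurableT iaI)); congr EFin.
  by rewrite -/(Rintegral mu setT aI) -Rintegral_mkcond.
have fB : (\int[mu]_x (bI x)%:E)%E = (\int[mu]_(x in I01) b x)%:E.
  rewrite -(fineK (integrable_fin_num measurableT ibI)); congr EFin.
  by rewrite -/(Rintegral mu setT bI) -Rintegral_mkcond.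
have e1 : (\int[mu3]_v F v = \int[mu \x mu]_p (aI p.1 * bI p.2)%:E)%E.
  rewrite -(@integral12_prod_meas1 _ _ _ _ R mu2 mu F iF).
  by apply: eq_integral => p _; exact: inner.
have e2 : (\int[mu \x mu]_p (aI p.1 * bI p.2)%:E =
    \int[mu]_x ((aI x)%:E * (\int[mu]_(x in I01) b x)%:E))%E.
  rewrite -(integral12_prod_meas1 i2).
  apply: eq_integral => x _; rewrite -fB -integralZl //.
have e3 : (\int[mu3]_(v in @unit_cube R) (a v.1.1 * b v.1.2)%:E)%E = (\int[mu3]_v F v)%E.
  by rewrite integral_mkcond; congr (integral _ _ _); exact: FE.
rewrite /Rintegral; move: e3 => ->; rewrite e1 e2 integralZr // fA.
by [].
Qed.
End Cube.

(** * Characters of the circle and summable weights *)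

Section Weights.
Variable R : realType.
Local Notation mu := (@lebesgue_measure R).
Local Notation I01 := (`[(0:R), (1:R)[%classic).

Lemma bounded_integrable_I01 (f : R -> R) K : measurable_fun setT f ->
  (forall x, `|f x| <= K) -> mu.-integrable I01 (EFin \o f).
Proof.
move=> mf fK; apply: measurable_bounded_integrable.
- exact: measurable_itv.
- by apply: le_lt_trans (ltry 1); rewrite -(mu_I01 R).
- exact: measurable_funTS.
exists K; split; first exact: num_real.
by move=> y Ky x _ /=; apply: le_trans (fK _) (ltW Ky).
Qed.

Lemma integral_I01_derive (f F : R -> R) K : continuous f -> (forall x, `|f x| <= K) ->
  (forall x : R, is_derive x 1 F (f x)) -> F 1 = F 0 -> \int[mu]_(x in I01) f x = 0.
Proof.
move=> cf fK dF F01.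
have mf : measurable_fun setT f by exact: continuous_measurable_fun.
have cF : continuous F.
  by move=> x; apply: differentiable_continuous; apply/derivable1_diffP; case: (dF x).
rewrite (Rintegral_itv_bndo_bndc (bounded_integrable_I01 mf fK)).
rewrite /Rintegral (@continuous_FTC2 _ f F) //.
- by rewrite F01 -EFinB subrr.
- exact: continuous_subspaceT.
- split.
  + by move=> x _; case: (dF x).
  + by apply: cvg_at_right_filter; exact: cF.
  + by apply: cvg_at_left_filter; exact: cF.
- by move=> x _; rewrite derive1E; case: (dF x) => _ ->.
Qed.

Lemma e2piD (x y : R) : e2pi (x + y) = e2pi x * e2pi y.
Proof. by rewrite /e2pi mulrDr cisD. Qed.

Lemma e2piN (x : R) : e2pi (- x) = (e2pi x)^-1.
Proof. by rewrite /e2pi mulrN cisN. Qed.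

Lemma e2pi_int (m : int) : e2pi (m%:~R : R) = 1.
Proof.
have H n : e2pi (n%:R : R) = 1.
  elim: n => [|n IH]; first by rewrite /e2pi mulr0 cis0.
  rewrite -addn1 natrD e2piD IH mul1r /e2pi mulr1 /cis mulr_natl cos2pi sin2pi.
  by [].
case: m => n; first exact: H.
by rewrite NegzE mulrNz e2piN H invr1.
Qed.

Lemma continuous_cos_scale (c : R) : continuous (fun x => cos (c * x)).
Proof.
move=> x; apply: (continuous_comp (g := cos)); last exact: continuous_cos.
by apply: cvgM; [exact: cvg_cst|exact: cvg_id].
Qed.

Lemma continuous_sin_scale (c : R) : continuous (fun x => sin (c * x)).
Proof.
move=> x; apply: (continuous_comp (g := sin)); last exact: continuous_sin.
by apply: cvgM; [exact: cvg_cst|exact: cvg_id].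
Qed.

Lemma integral_e2pi_period (m : int) : m != 0 ->
  \int[mu]_(x in I01) Re (e2pi (m%:~R * x)) = 0 /\
  \int[mu]_(x in I01) Im (e2pi (m%:~R * x)) = 0.
Proof.
move=> m0; pose c : R := 2 * pi * m%:~R.
have c0 : c != 0 by rewrite /c !mulf_neq0 ?intr_eq0 // gt_eqF // pi_gt0.
have E x : e2pi (m%:~R * x) = cis (c * x) by rewrite /e2pi /c !mulrA.
have c1 : cis c = 1 by have := e2pi_int m; rewrite /e2pi -/c.
have [c1r c1i] : cos c = 1 /\ sin c = 0 by move: c1 => [-> ->].
split.
  under eq_Rintegral => x _ do rewrite E /=.
  apply: (@integral_I01_derive _ (fun x => c^-1 * sin (c * x)) 1).
  - exact: continuous_cos_scale.
  - by move=> x; rewrite ler_norml cos_geN1 cos_le1.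
  - by move=> x; apply: is_derive_eq; rewrite /GRing.scale /=; field; exact: c0.
  - by rewrite mulr1 mulr0 sin0 c1i.
under eq_Rintegral => x _ do rewrite E /=.
apply: (@integral_I01_derive _ (fun x => - c^-1 * cos (c * x)) 1).
- exact: continuous_sin_scale.
- by move=> x; rewrite ler_norml sin_geN1 sin_le1.
- by move=> x; apply: is_derive_eq; rewrite /GRing.scale /=; field; exact: c0.
- by rewrite mulr1 mulr0 cos0 c1r.
Qed.

Lemma integral_I01_cst (a : R) : \int[mu]_(x in I01) a = a.
Proof.
rewrite Rintegral_cst; last exact: measurable_itv.
transitivity (a * fine 1%E); last by rewrite /= mulr1.
by congr (_ * fine _); exact: mu_I01.
Qed.
Definition qweight (n : nat) : R := (n.+1%:R ^+ 2)^-1.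

Lemma qweight_ge0 n : 0 <= qweight n.
Proof. by rewrite invr_ge0 sqr_ge0. Qed.

Lemma esum_qweight : (\esum_(n in [set: nat]) (qweight n)%:E <= 2%:E)%E.
Proof.
rewrite -nneseries_esumT; last by move=> n; rewrite lee_fin qweight_ge0.
apply: lime_le.
  by apply: is_cvg_nneseries => n _ _; rewrite lee_fin qweight_ge0.
apply: nearW => n; rewrite sumEFin lee_fin.
(* Induction works because 2/(x+1) - 2/(x+2) - 1/(x+1)^2 is the nonnegative fraction x / ((x+1)^2
   (x+2)). *)
suff : \sum_(0 <= i < n) qweight i <= 2 - 2 / n.+1%:R.
  by move/le_trans; apply; rewrite lerBlDr lerDl divr_ge0.
elim: n => [|n IH]; first by rewrite big_nil divr1 subrr.
rewrite big_nat_recr //=; apply: le_trans (lerD IH (lexx _)) _.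
rewrite /qweight -!natr1; have n0 : 0 <= n%:R :> R by [].
move: (n%:R) n0 => x x0.
rewrite -subr_ge0 (_ : _ - _ = x / ((x + 1) ^+ 2 * (x + 1 + 1))).
  by apply: divr_ge0 => //; apply: mulr_ge0; [exact: sqr_ge0|lra].
by field; rewrite !gt_eqF //; lra.
Qed.

Lemma esum_qweight_int : (\esum_(j in [set: int]) (qweight `|j|%N)%:E <= 4%:E)%E.
Proof.
have q0 n : (0 <= (qweight n)%:E)%E by rewrite lee_fin qweight_ge0.
rewrite (esumID [set j : int | 0 <= j]) // !setTI.
have -> : 4%:E = (2%:E + 2%:E)%E :> \bar R by rewrite -EFinD; congr EFin; lra.
apply: leeD.
  rewrite (reindex_esum [set: nat] _ Posz) ?esum_qweight //.
  split; first by move=> n _.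
    by move=> n m _ _ [].
  by move=> [n|n] //= _; exists n.
(* [Negz n] has absolute value n + 1, so its weight is at most that of n. *)
rewrite (reindex_esum [set: nat] _ Negz).
  apply: le_trans esum_qweight; apply: le_esum => n _ /=.
  rewrite lee_fin /qweight lef_pV2 ?posrE ?exprn_gt0 // ler_sqr ?nnegrE // ler_nat.
  by rewrite ltnS leqnSn.
split; first by move=> n _.
  by move=> n m _ _ [].
by move=> [n|n] //= _; exists n.
Qed.

(** As 0 <= y < 1, |k| + 1 <= |y - k| + 2 <= 3 t, which explains the 9; two of the four powers of t
    are given away. *)
Lemma max1_dist_bound (y : R) (k : int) : 0 <= y < 1 ->
  Num.max 1 `|y - k%:~R| ^- 4 <= 9 * qweight `|k|%N.
Proof.
move=> /andP[y0 y1]; set t := Num.max _ _.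
have t1 : 1 <= t by rewrite le_max lexx.
have kt : `|k|%N.+1%:R <= 3 * t.
  have kR : (`|k|%N%:R : R) <= t + 1.
    rewrite natr_absz intr_norm.
    have -> : k%:~R = y - (y - k%:~R) :> R by ring.
    have := ler_normB y (y - k%:~R); rewrite (ger0_norm y0).
    have : `|y - k%:~R| <= t by rewrite le_max lexx orbT.
    lra.
  by rewrite -natr1; lra.
have k1 : 0 < `|k|%N.+1%:R :> R by [].
rewrite /qweight; move: (`|k|%N.+1%:R) k1 kt => x x0 xt.
have x20 : 0 < x ^+ 2 by rewrite exprn_gt0.
have t40 : 0 < t ^+ 4 by rewrite exprn_gt0 // (lt_le_trans ltr01).
rewrite ler_pdivlMr // mulrC ler_pdivrMr //.
apply: (@le_trans _ _ (9 * t ^+ 2)).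
  rewrite (_ : 9 * t ^+ 2 = (3 * t) ^+ 2); last by ring.
  by rewrite ler_sqr ?nnegrE //; lra.
by apply: ler_wpM2l => //; apply: ler_weXn2l.
Qed.

(** After cutting the line into unit intervals, the integrand is at most 9 K / (|k| + 1)^2 on the
    interval of index k. *)
Lemma decay_integrable (u : R -> R) K : measurable_fun setT u ->
  (forall t, `|u t| <= K * Num.max 1 `|t| ^- 4) ->
  mu.-integrable setT (EFin \o u).
Proof.
move=> mcu uK; have K0 : 0 <= K.
  by have := le_trans (normr_ge0 _) (uK 0); rewrite normr0 (max_l ler01) expr1n invr1 mulr1.
apply/integrableP; split; first exact/measurable_EFinP.
have mn : measurable_fun setT (fun t => `|u t|) by exact: measurableT_comp.
rewrite (_ : (\int[mu]_x _)%E = (\int[mu]_x (`|u x|)%:E)%E) //.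
rewrite -(ge0_esum_unfold mn) //.
apply: (@le_lt_trans _ _ (\esum_(k in [set: int]) ((9 * K) * qweight `|k|%N)%:E)%E).
  apply: le_esum => k _.
  apply: (@le_trans _ _ (\int[mu]_(y in I01) ((9 * K) * qweight `|k|%N)%:E)%E).
    apply: ge0_le_integral => //.
    - by apply/measurable_EFinP; apply: measurable_funTS; exact: (measurableT_comp mn (measurable_shiftR (- k%:~R))).
    move=> y; rewrite /= in_itv /= => yI; rewrite lee_fin.
    apply: le_trans (uK _) _; rewrite -mulrA mulrCA; apply: ler_wpM2l => //.
    exact: (@max1_dist_bound y k yI).
  rewrite integral_cst //= -[leRHS]mule1; apply: lee_wpmul2l.
    by rewrite lee_fin !mulr_ge0 // qweight_ge0.
  by have -> : mu I01 = 1%E := mu_I01 R.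
rewrite esumZ; [|by rewrite mulr_ge0|by move=> j _; exact: qweight_ge0].
apply: (@le_lt_trans _ _ ((9 * K)%:E * 4%:E)%E).
  by apply: lee_wpmul2l; [rewrite lee_fin mulr_ge0|exact: esum_qweight_int].
by rewrite -EFinM ltry.
Qed.
End Weights.

(** * Summation over the index set *)

Section Index.
Variable R : realType.
Local Notation C := R[i].

Lemma inv_sq_qweight (n : nat) : (0 < n)%N -> (n%:R ^+ 2)^-1 <= 4 * qweight R n.
Proof.
move=> n0; rewrite /qweight -[n.+1%:R]natr1.
have : 1 <= n%:R :> R by rewrite ler1n.
move: (n%:R) => x x1.
have x0 : 0 < x ^+ 2 by rewrite exprn_gt0 //; lra.
have y0 : 0 < (x + 1) ^+ 2 by rewrite exprn_gt0 //; lra.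
rewrite ler_pdivlMr // mulrC ler_pdivrMr //.
rewrite (_ : 4 * x ^+ 2 = (2 * x) ^+ 2); last by ring.
by rewrite ler_sqr ?nnegrE; lra.
Qed.

Lemma eis_weight_ge0 p : 0 <= eis_weight R p.
Proof. by rewrite invr_ge0 mulr_ge0 // sqr_ge0. Qed.

(** 128 = 16 * 4 * 2: replacing 1/n^2 by 4/(n+1)^2 in both variables costs 16, and the sums over j
    and B are at most 4 and 2. *)
Lemma esum_eis_weight : (\esum_(p in index_set) (eis_weight R p)%:E <= 128%:E)%E.
Proof.
have q0 n : 0 <= qweight R n by exact: qweight_ge0.
rewrite esum_mkcond.
apply: (@le_trans _ _ (\esum_(p in [set: nat * int])
    (16 * qweight R p.1 * qweight R `|p.2|%N)%:E)%E).
  apply: le_esum => -[B j] _; case: ifPn => [|_]; last first.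
    by rewrite lee_fin !mulr_ge0.
  rewrite inE => -[/= B0 oj _]; rewrite lee_fin /eis_weight /= invfM.
  rewrite (_ : 16 * _ * _ = (4 * qweight R B) * (4 * qweight R `|j|%N)); last by ring.
  apply: ler_pM; rewrite ?invr_ge0 ?sqr_ge0 ?inv_sq_qweight //.
  rewrite -[j%:~R ^+ 2]real_normK ?num_real // -intr_norm -natr_absz.
  by apply: inv_sq_qweight; lia.
have -> : [set: nat * int] = [set: nat] `*`` (fun=> [set: int]) by apply/seteqP; split.
rewrite -(@esum_esum R nat int _ _ (fun n j => (16 * qweight R n * qweight R `|j|%N)%:E)); last first.
  by move=> n j _ _; rewrite lee_fin !mulr_ge0.
apply: (@le_trans _ _ (\esum_(n in [set: nat]) (64 * qweight R n)%:E)%E).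
  apply: le_esum => n _; rewrite esumZ //; last by rewrite mulr_ge0.
  rewrite (_ : (64 * _)%:E = (16 * qweight R n)%:E * 4%:E)%E; last first.
    by rewrite -EFinM; congr EFin; ring.
  by apply: lee_wpmul2l; [rewrite lee_fin mulr_ge0|exact: esum_qweight_int].
rewrite esumZ // (_ : 128%:E = 64%:E * 2%:E)%E; last first.
  by rewrite -EFinM; congr EFin; ring.
by apply: lee_wpmul2l; [rewrite lee_fin|exact: esum_qweight].
Qed.

Lemma rsummable_eis_weight c : rsummable index_set (fun p => c * eis_weight R p).
Proof.
apply: rsummableZ; apply/rsummable_lty.
  by move=> p _; exact: eis_weight_ge0.
by apply: le_lt_trans esum_eis_weight _; rewrite ltry.
Qed.

(** As n is even, an integer is odd exactly when its residue is, so residue and quotient enumerate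
    the odd integers. *)
Lemma csum_residues (n : nat) (u : int -> C) : (0 < n)%N -> ~~ odd n ->
  csummable [set j : int | odd `|j|%N] u ->
  csum [set j : int | odd `|j|%N] u =
  \sum_(d < n | odd d) csum [set: int] (fun k => u (d%:Z + n%:Z * k)).
Proof.
move=> n0 en su.
pose D2 (d : 'I_n) := [set: int].
have odd_shift (x k : int) : odd `|(x + n%:Z * k)%R|%N = odd `|x|%N.
  have [m nm] : exists m, n = m.*2 by exists n./2; rewrite even_halfK.
  have -> : n%:Z * k = 2 * (m%:Z * k) by rewrite nm -muln2; lia.
  by move: (m%:Z * k) => q; lia.
have be : set_bij ([set d : 'I_n | odd d] `*`` D2) [set j : int | odd `|j|%N]
    (fun p : 'I_n * int => p.1%:Z + n%:Z * p.2).
  split.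
  - by move=> [d k] [/= od _]; rewrite odd_shift.
  - move=> [d k] [d' k'] _ _ /= e.
    have dd : nat_of_ord d = d' :> nat.
      have := congr1 (fun x => (x %% n%:Z)%Z) e.
      by rewrite /= ![(_ + n%:Z * _)]addrC ![n%:Z * _]mulrC !modzMDl !modz_nat !modn_small // => -[].
    have dd' : d = d' by exact: val_inj.
    have nz : n%:Z != 0 by rewrite eqz_nat -lt0n.
    by move: e; rewrite dd' => /addrI /(mulfI nz) ->.
  - move=> j /= oj.
    have nz : n%:Z != 0 by rewrite eqz_nat -lt0n.
    have r0 := modz_ge0 j nz; have rn : (j %% n%:Z)%Z < n%:Z by rewrite ltz_pmod.
    have jE : j = (j %% n%:Z)%Z + n%:Z * (j %/ n%:Z)%Z.
      by rewrite addrC mulrC -divz_eq.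
    have jn : (`|(j %% n%:Z)%Z|%N < n)%N by lia.
    exists (Ordinal jn, (j %/ n%:Z)%Z); last by rewrite /= gez0_abs.
    by split => //=; rewrite -(odd_shift _ (j %/ n%:Z)%Z) -jE.
rewrite (reindex_csum _ be).
have sp := reindex_csummable be su.
have [_ [_ ->]] := csum_fubini (D2 := D2) (f := fun (d : 'I_n) k => u (d%:Z + n%:Z * k)) sp.
exact: csum_fin.
Qed.
End Index.

(** * The Eisenstein series as a distribution vector *)

Section EisensteinSum.
Variable R : realType.
Local Notation C := R[i].
Implicit Types (f : vfun R) (lambda : 'rV[C]_3).

Lemma eq_csummable (T : choiceType) (D : set T) (f g : T -> C) :
  (forall x, D x -> f x = g x) -> csummable D f -> csummable D g.
Proof.
move=> fg; rewrite /csummable /summable => h; apply: le_lt_trans h.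
by apply: le_esum => x Dx; rewrite fg.
Qed.

Lemma csummable_eis_term lambda f y : V lambda f -> converges lambda -> `|y| <= 1 ->
  csummable index_set (fun p => eis_term lambda f p y).
Proof.
move=> Vf l3 y1; have [K fK] := exists_arc_bound Vf.
apply/csummableP; split;
  apply: le_rsummable (rsummable_eis_weight (4 * K)) => p Dp.
  by apply: le_trans (le_Re_normc _) _; exact: eis_term_bound.
by apply: le_trans (le_Im_normc _) _; exact: eis_term_bound.
Qed.

Lemma csum_eis_term_bound lambda f b y : V lambda f -> converges lambda -> seminorm_le 2 0 f b -> `|y| <= 1 ->
  normc (csum index_set (fun p => eis_term lambda f p y)) <= 2048 * b.
Proof.
move=> Vf l3 sb y1; have fK := seminorm_arc_bound Vf sb.
have b0 := seminorm_ge0 sb.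
rewrite (_ : 2048 * b = 1024 * b + 1024 * b); last by ring.
apply: (@csum_norm_le _ _ index_set _ (fun p => (8 * b) * eis_weight R p)).
  move=> p Dp; rewrite (_ : 8 * b = 4 * (2 * b)); last by ring.
  exact: eis_term_bound.
rewrite esumZ; [|by rewrite mulr_ge0|by move=> p _; exact: eis_weight_ge0].
rewrite (_ : (1024 * b)%:E = (8 * b)%:E * 128%:E)%E; last first.
  by rewrite -EFinM; congr EFin; ring.
by apply: lee_wpmul2l; [rewrite lee_fin mulr_ge0|exact: esum_eis_weight].
Qed.

Local Notation coset_term X :=
  (pi_dist (ginv (splitting2 (xget (nSL 0 0 0) X))) tau).

(** The termwise sum is shown to be a distribution vector with the required values, so that [xget]
    does not fall back on its default 0. *)
Lemma Eisenstein2P lambda : converges lambda ->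
  Vdist lambda phi (Eisenstein2 lambda) /\
  forall f, V lambda f ->
    csummable cosets2 (fun X => coset_term X f) /\
    Eisenstein2 lambda f = csum cosets2 (fun X => coset_term X f).
Proof.
move=> l3.
have sum_f f : V lambda f -> csummable cosets2 (fun X => coset_term X f).
  move=> Vf; have se := csummable_eis_term (y := 0) Vf l3.
  have := reindex_csummable (@coset_key_bij R) (se _); rewrite normr0 ler01 => /(_ isT).
  by apply: eq_csummable => X cX; rewrite -tau_coset.
suff H : [set T | Vdist lambda phi T /\ forall f, V lambda f ->
      csummable cosets2 (fun X => pairing f (coset_term X)) /\
      pairing f T = csum cosets2 (fun X => pairing f (coset_term X))]
    (fun f => csum cosets2 (fun X => coset_term X f)).
  exact: (xgetPex (fun=> 0) (ex_intro _ _ H)).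
split; last by move=> f Vf; split => //; exact: sum_f.
split.
  move=> a f h Vf Vh; rewrite -csumZ; last exact: sum_f.
  rewrite -csumD; [|by apply: csummableZ; exact: sum_f|exact: sum_f].
  by apply: eq_csum => X _; rewrite /pi_dist /tau /pi_fun !mxE.
(* Radius 2 and order 0 suffice. The constant is 2 * 8 * 128: the arc bound 2 b enters
   [eis_term_bound] with factor 4, the weights sum to at most 128, and real and imaginary parts give
   the 2. *)
exists 2, 0%N, 2048 => f b Vf sb.
rewrite (_ : csum _ _ = csum index_set (fun p => eis_term lambda f p 0)).
  by apply: csum_eis_term_bound => //; rewrite normr0.
rewrite (reindex_csum _ (@coset_key_bij R)).
by apply: eq_csum => X cX; rewrite -tau_coset.
Qed.

(** In every term x and z disappear by [wval_nt], which leaves a function of y alone. *)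
Lemma Eisenstein2_translate lambda f (x y z : R) :
  converges lambda -> V lambda f ->
  pi_dist (ginv (nt x y z)) (Eisenstein2 lambda) f =
  csum index_set (fun p => eis_term lambda f p (- y)).
Proof.
move=> l3 Vf; rewrite /pi_dist ginvK_nt.
have Vt := Vsmooth_translate x y z Vf.
have [_ /(_ _ Vt)[_ ->]] := Eisenstein2P l3.
rewrite (reindex_csum _ (@coset_key_bij R)).
by apply: eq_csum => X cX; rewrite -(tau_coset_translate x y z cX Vf).
Qed.
End EisensteinSum.

(** * Complex-valued integrals *)

Section ComplexIntegral.
Variables (R : realType) (d : measure_display) (X : measurableType d).
Variable m : {measure set X -> \bar R}.
Variables (D : set X) (mD : measurable D).
Local Notation C := R[i].
Implicit Types f g : X -> C.

Definition cmeasurable f : Prop :=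
  measurable_fun D (fun x => Re (f x)) /\
  measurable_fun D (fun x => Im (f x)).

Lemma eq_cintegral f g : (forall x, D x -> f x = g x) ->
  cintegral m D f = cintegral m D g.
Proof.
by move=> fg; rewrite /cintegral; congr (_ +i* _);
  apply: eq_Rintegral => x; rewrite inE => /fg ->.
Qed.

Lemma eq_cintegrable f g : (forall x, D x -> f x = g x) ->
  cintegrable m D f -> cintegrable m D g.
Proof.
by move=> fg [fr fi]; split; [apply: eq_integrable fr|apply: eq_integrable fi] => //= x;
  rewrite inE => /fg ->.
Qed.

Lemma cintegralD f g : cintegrable m D f -> cintegrable m D g ->
  cintegral m D (fun x => f x + g x) = cintegral m D f + cintegral m D g.
Proof.
move=> [fr fi] [gr gi]; apply/eqP; rewrite eq_complex /=; apply/andP; split; apply/eqP.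
  by rewrite -RintegralD //; apply: eq_Rintegral => x _; rewrite raddfD.
by rewrite -RintegralD //; apply: eq_Rintegral => x _; rewrite raddfD.
Qed.

Lemma integrableZ_EFin (k : R) (u : X -> R) : m.-integrable D (EFin \o u) ->
  m.-integrable D (EFin \o (fun x => k * u x)).
Proof.
move=> iu; have := integrableZl mD k iu.
by apply: eq_integrable => // x _ /=; rewrite EFinM.
Qed.

Lemma integrableD_EFin (u v : X -> R) : m.-integrable D (EFin \o u) ->
  m.-integrable D (EFin \o v) -> m.-integrable D (EFin \o (fun x => u x + v x)).
Proof.
move=> iu iv; have := integrableD mD iu iv.
by apply: eq_integrable => // x _ /=; rewrite EFinD.
Qed.

Lemma cintegrableZ a f : cintegrable m D f -> cintegrable m D (fun x => a * f x).
Proof.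
move=> [fr fi]; split.
  rewrite (_ : (fun x => _) = EFin \o (fun x => Re a * Re (f x) +
    (- Im a) * Im (f x))); last by apply/funext => x; rewrite Re_mulE.
  by apply: integrableD_EFin; apply: integrableZ_EFin.
rewrite (_ : (fun x => _) = EFin \o (fun x => Re a * Im (f x) +
  Im a * Re (f x))); last by apply/funext => x; rewrite Im_mulE.
by apply: integrableD_EFin; apply: integrableZ_EFin.
Qed.

Lemma cintegralZ a f : cintegrable m D f ->
  cintegral m D (fun x => a * f x) = a * cintegral m D f.
Proof.
move=> [fr fi]; apply/eqP; rewrite eq_complex Re_mulE Im_mulE; apply/andP; split; apply/eqP.
  rewrite /cintegral /= -!RintegralZl // -RintegralD; [|by []|exact: integrableZ_EFin|exact: integrableZ_EFin].
  by apply: eq_Rintegral => x _; rewrite Re_mulE.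
rewrite /cintegral /= -!RintegralZl // -RintegralD; [|by []|exact: integrableZ_EFin|exact: integrableZ_EFin].
by apply: eq_Rintegral => x _; rewrite Im_mulE.
Qed.

Lemma cintegral_norm_le f B : m D = 1%E -> cintegrable m D f ->
  (forall x, D x -> normc (f x) <= B) -> normc (cintegral m D f) <= B + B.
Proof.
move=> mD1 [fr fi] fB.
have H (u : X -> R) : m.-integrable D (EFin \o u) -> (forall x, D x -> `|u x| <= B) ->
    `|\int[m]_(x in D) u x| <= B.
  move=> iu uB; apply: le_trans (le_normr_Rintegral mD iu) _.
  apply: (@le_trans _ _ (\int[m]_(x in D) B)); last first.
    by rewrite Rintegral_cst // mD1 mulr1.
  apply: le_Rintegral => //; first exact: integrable_norm.
  apply: measurable_bounded_integrable => //; first by rewrite mD1 ltry.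
  exists B; split; first exact: num_real.
  by move=> y By x Dx /=; apply: le_trans (ltW By); rewrite ger0_norm // (le_trans _ (uB x Dx)).
apply: le_trans (normc_le _) _; apply: lerD; apply: H => // x Dx;
  apply: le_trans (fB _ Dx); [exact: le_Re_normc|exact: le_Im_normc].
Qed.
End ComplexIntegral.

Section CsumIntegral.
Variables (R : realType) (d : measure_display) (X : measurableType d).
Variable m : {measure set X -> \bar R}.
Variables (D : set X) (mD : measurable D).
Variables (T : countType) (I : set T).
Local Notation C := R[i].

Lemma csum_integral (g : T -> X -> C) (M : T -> R) : (m D < +oo)%E ->
  (forall i, I i -> cmeasurable D (g i)) ->
  (forall i x, I i -> D x -> normc (g i x) <= M i) -> rsummable I M ->
  [/\ cintegrable m D (fun x => csum I (g^~ x)),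
      csummable I (fun i => cintegral m D (g i)) &
      cintegral m D (fun x => csum I (g^~ x)) = csum I (fun i => cintegral m D (g i))].
Proof.
move=> mDoo mg gM sM.
have [r1 r2 r3] := @rsum_integral _ X R m T I D mD (fun i x => Re (g i x)) M mDoo
  (fun i Ii => (mg i Ii).1) (fun i x Ii Dx => le_trans (le_Re_normc _) (gM i x Ii Dx)) sM.
have [i1 i2 i3] := @rsum_integral _ X R m T I D mD (fun i x => Im (g i x)) M mDoo
  (fun i Ii => (mg i Ii).2) (fun i x Ii Dx => le_trans (le_Im_normc _) (gM i x Ii Dx)) sM.
split; first by split.
  by apply/csummableP; split.
by rewrite /cintegral /csum /= r3 i3.
Qed.
End CsumIntegral.

Section CubeLine.
Variable R : realType.
Local Notation C := R[i].
Local Notation mu := (@lebesgue_measure R).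
Local Notation I01 := (`[(0:R), (1:R)[%classic).
Local Notation mu3 := ((mu \x mu) \x mu)%E.
Implicit Types a b h : R -> C.

Lemma ccube_integral a b K : cmeasurable setT a -> cmeasurable setT b ->
  (forall x, normc (a x) <= 1) -> (forall x, normc (b x) <= K) ->
  cintegral mu3 (@unit_cube R) (fun v => a v.1.1 * b v.1.2) =
  cintegral mu I01 a * cintegral mu I01 b.
Proof.
move=> [mar mai] [mbr mbi] a1 bK.
have ar x : `|Re (a x)| <= 1 := le_trans (le_Re_normc _) (a1 x).
have ai x : `|Im (a x)| <= 1 := le_trans (le_Im_normc _) (a1 x).
have br x : `|Re (b x)| <= K := le_trans (le_Re_normc _) (bK x).
have bi x : `|Im (b x)| <= K := le_trans (le_Im_normc _) (bK x).
have mC := @measurable_cube R.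
have [irr err] := cube_integral mar mbr ar br.
have [iri eri] := cube_integral mar mbi ar bi.
have [iir eir] := cube_integral mai mbr ai br.
have [iii eii] := cube_integral mai mbi ai bi.
apply/eqP; rewrite eq_complex Re_mulE Im_mulE; apply/andP; split; apply/eqP; rewrite /cintegral /=.
  rewrite mulNr -err -eii -RintegralB //.
  by apply: eq_Rintegral => v _; rewrite Re_mulE mulNr.
rewrite -eri -eir -RintegralD //.
by apply: eq_Rintegral => v _; rewrite Im_mulE.
Qed.

Lemma csum_unfold h : cmeasurable setT h -> cintegrable mu setT h ->
  csummable [set: int] (fun k => cintegral mu I01 (fun y => h (y - k%:~R))) /\
  csum [set: int] (fun k => cintegral mu I01 (fun y => h (y - k%:~R))) =
  cintegral mu setT h.
Proof.
move=> [mr mi] [ir ii].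
have [sr er] := rsum_unfold mr ir; have [si ei] := rsum_unfold mi ii.
split; first by apply/csummableP; split.
by rewrite /csum /cintegral /= er ei.
Qed.

Lemma cintegral_reflR (c : R) h : cmeasurable setT h ->
  cintegral mu setT h = cintegral mu setT (fun x => h (c - x)).
Proof.
by move=> [mr mi]; rewrite /cintegral (Rintegral_reflR c mr) (Rintegral_reflR c mi).
Qed.
End CubeLine.

Section CMeasurable.
Variable R : realType.
Local Notation C := R[i].
Variables (d : measure_display) (X : measurableType d) (D : set X).
Implicit Types f g : X -> C.

Lemma cmeasurable_cst (a : C) : cmeasurable D (fun=> a).
Proof. by split; exact: measurable_cst. Qed.

Lemma cmeasurableM f g : cmeasurable D f -> cmeasurable D g ->
  cmeasurable D (fun x => f x * g x).
Proof.
move=> [fr fi] [gr gi]; split.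
  rewrite (_ : (fun x => _) = fun x => Re (f x) * Re (g x) -
    Im (f x) * Im (g x)); last first.
    by apply/funext => x; rewrite -mulNr; exact: Re_mulE.
  by apply: measurable_funB; apply: measurable_funM.
rewrite (_ : (fun x => _) = fun x => Re (f x) * Im (g x) +
  Im (f x) * Re (g x)); last first.
  by apply/funext => x; exact: Im_mulE.
by apply: measurable_funD; apply: measurable_funM.
Qed.
End CMeasurable.

(** * Integration against the character and unfolding *)

Section Line.
Variable R : realType.
Local Notation C := R[i].
Local Notation mu := (@lebesgue_measure R).
Local Notation I01 := (`[(0:R), (1:R)[%classic).
Local Notation mu3 := ((mu \x mu) \x mu)%E.
Implicit Types (f : vfun R) (lambda : 'rV[C]_3).

Lemma cmeasurable_comp d (X : measurableType d) (h : R -> C) (p : X -> R) :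
  cmeasurable setT h -> measurable_fun setT p -> cmeasurable setT (fun x => h (p x)).
Proof.
by move=> [hr hi] mp; split; [exact: (measurableT_comp hr mp)|exact: (measurableT_comp hi mp)].
Qed.

Lemma cmeasurable_e2pi (c : R) : cmeasurable setT (fun y : R => e2pi (c * y)).
Proof.
have E y : e2pi (c * y) = cis ((2 * pi * c) * y) by rewrite /e2pi mulrA.
split; apply: continuous_measurable_fun.
  by under eq_fun do rewrite E /=; exact: continuous_cos_scale.
by under eq_fun do rewrite E /=; exact: continuous_sin_scale.
Qed.

Lemma normc_e2pi (t : R) : normc (e2pi t) = 1.
Proof. exact: normc_cis. Qed.

Lemma cmeasurable_wval lambda f j : V lambda f -> cmeasurable setT (wval f j).
Proof.
move=> Vf; have [cr ci] := continuous_wval j Vf.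
by split; exact: continuous_measurable_fun.
Qed.

Lemma cmeasurable_twist lambda f j : V lambda f -> cmeasurable setT (twist f j).
Proof.
move=> Vf; case: (boolP ((j %% 4)%Z == 1)) => [/eqP jE|/negbTE jE].
  rewrite (_ : twist f j = fun t => 'i * wval f 0 t).
    by apply: cmeasurableM (cmeasurable_wval _ Vf); exact: cmeasurable_cst.
  by apply/funext => t; rewrite /twist jE.
rewrite (_ : twist f j = fun t => (-1) * wval f 1 t).
  by apply: cmeasurableM (cmeasurable_wval _ Vf); exact: cmeasurable_cst.
by apply/funext => t; rewrite /twist jE mulN1r.
Qed.

Definition line_term lambda f (m : int) (p : nat * int) (y : R) : C :=
  e2pi (m%:~R * y) * eis_term lambda f p (- y).

Lemma cmeasurable_line_term lambda f m p : V lambda f ->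
  cmeasurable setT (line_term lambda f m p).
Proof.
move=> Vf; apply: cmeasurableM; first exact: cmeasurable_e2pi.
apply: cmeasurableM; first exact: cmeasurable_cst.
apply: (cmeasurable_comp (h := twist f p.2)); first exact: cmeasurable_twist Vf.
exact: (@measurable_reflR R).
Qed.

(** Uniform in y on the whole line, as [ccube_integral] demands, but without decay in j; the bound
    that can be summed over p is [line_term_weight], for y in [0,1). *)
Lemma line_term_bound lambda f m p K : V lambda f -> converges lambda -> arc_bound f K ->
  forall y, normc (line_term lambda f m p y) <= normc (eis_coef lambda p) * K.
Proof.
move=> Vf l3 fK y; rewrite /line_term /eis_term Normc.normcM Normc.normcM normc_e2pi mul1r.
apply: ler_wpM2l; first exact: normc_ge0.
apply: le_trans (twist_bound _ _ Vf l3 fK) _.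
rewrite -[leRHS]mulr1; apply: ler_wpM2l; first exact: arc_bound_ge0 fK.
by rewrite invf_le1 ?exprn_gt0 ?lt_max ?ltr01 // exprn_ege1 // le_max lexx.
Qed.

Lemma line_term_weight lambda f m p K : V lambda f -> converges lambda -> arc_bound f K -> index_set p ->
  forall y, 0 <= y < 1 -> normc (line_term lambda f m p y) <= 4 * K * eis_weight R p.
Proof.
move=> Vf l3 fK Dp y /andP[y0 y1]; rewrite /line_term Normc.normcM normc_e2pi mul1r.
by apply: eis_term_bound => //; rewrite normrN ger0_norm // ltW.
Qed.

Lemma psi_nSL m1 m2 (x y z : R) :
  psi m1 m2 (nSL x y z) = e2pi (m1%:~R * x) * e2pi (m2%:~R * y).
Proof. by rewrite /psi e2piD /= !mxE. Qed.

Definition whittaker_integrand lambda m1 m2 f (v : R * R * R) : C :=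
  psi m1 m2 (nSL v.1.1 v.1.2 v.2) *
  pi_dist (ginv (nSL v.1.1 v.1.2 v.2, false)) (Eisenstein2 lambda) f.

Lemma whittaker_integrandE lambda m1 m2 f v : V lambda f -> converges lambda -> unit_cube v ->
  whittaker_integrand lambda m1 m2 f v =
  csum index_set (fun p => e2pi (m1%:~R * v.1.1) * line_term lambda f m2 p v.1.2).
Proof.
move=> Vf l3 [_ /andP[y0 y1] _].
rewrite /whittaker_integrand psi_nSL (Eisenstein2_translate _ _ _ l3 Vf) -csumZ.
  by apply: eq_csum => p _; rewrite /line_term mulrA.
by apply: csummable_eis_term => //; rewrite normrN ger0_norm // ltW.
Qed.

(** [eis_weight] dominates the terms on the cube, so they may be integrated one by one; each splits
    into the same function of x and a function of y. *)
Lemma whittaker_integral lambda m1 m2 f : V lambda f -> converges lambda -> [/\ cintegrable mu3 unit_cube (whittaker_integrand lambda m1 m2 f),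
      csummable index_set (fun p => cintegral mu I01 (line_term lambda f m2 p)) &
      cintegral mu3 unit_cube (whittaker_integrand lambda m1 m2 f) =
      cintegral mu I01 (fun x => e2pi (m1%:~R * x)) *
      csum index_set (fun p => cintegral mu I01 (line_term lambda f m2 p))].
Proof.
move=> Vf l3; have [K fK] := exists_arc_bound Vf.
have mline p := cmeasurable_line_term m2 p Vf.
have I01oo : (mu I01 < +oo)%E.
  by have -> : mu I01 = 1%E := mu_I01 R; rewrite ltry.
have [_ s1 _] := @csum_integral R _ _ mu I01 (measurable_itv _) _ index_set
  (line_term lambda f m2) (fun p => 4 * K * eis_weight R p) I01oo
  (fun p _ => conj (measurable_funTS (mline p).1) (measurable_funTS (mline p).2))
  (fun p y Dp Dy => line_term_weight m2 Vf l3 fK Dp Dy)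
  (@rsummable_eis_weight R (4 * K)).
pose g (p : nat * int) (v : R * R * R) : C :=
  e2pi (m1%:~R * v.1.1) * line_term lambda f m2 p v.1.2.
have mg p : cmeasurable (@unit_cube R) (g p).
  suff [gr gi] : cmeasurable setT (g p) by split; exact: measurable_funTS.
  apply: cmeasurableM.
    apply: (cmeasurable_comp (h := fun x => e2pi (m1%:~R * x))); first exact: cmeasurable_e2pi.
    by apply: measurableT_comp; [exact: measurable_fst|exact: measurable_fst].
  apply: (cmeasurable_comp (h := line_term lambda f m2 p)); first exact: mline.
  by apply: measurableT_comp; [exact: measurable_snd|exact: measurable_fst].
have gM p v : index_set p -> unit_cube v -> normc (g p v) <= 4 * K * eis_weight R p.
  move=> Dp [_ Dy _]; rewrite /g Normc.normcM normc_e2pi mul1r.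
  exact: line_term_weight.
have [i2 s2 e2] := @csum_integral R _ _ mu3 _ (@measurable_cube R) _ index_set
  g (fun p => 4 * K * eis_weight R p) (mu_cube_lty R) (fun p _ => mg p) gM
  (@rsummable_eis_weight R (4 * K)).
have GE v : unit_cube v -> csum index_set (g^~ v) = whittaker_integrand lambda m1 m2 f v.
  by move=> Dv; rewrite whittaker_integrandE.
split => //; first exact: (@eq_cintegrable R _ _ mu3 _ (@measurable_cube R) _ _ GE i2).
apply: etrans (esym (@eq_cintegral R _ _ mu3 _ _ _ GE)) _; rewrite e2 -csumZ //.
apply: eq_csum => p _.
apply: (ccube_integral (K := normc (eis_coef lambda p) * K)).
- exact: cmeasurable_e2pi.
- exact: mline.
- by move=> x; rewrite normc_e2pi.
- exact: line_term_bound.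
Qed.
Lemma whittaker_integrand_linear lambda m1 m2 (a : C) f h v :
  converges lambda -> V lambda f -> V lambda h ->
  whittaker_integrand lambda m1 m2 (fun g => a *: f g + h g) v =
  a * whittaker_integrand lambda m1 m2 f v + whittaker_integrand lambda m1 m2 h v.
Proof.
move=> l3 Vf Vh; have [[Elin _] _] := Eisenstein2P l3.
rewrite /whittaker_integrand mulrCA -mulrDr; congr (_ * _).
rewrite /pi_dist ginvK_nt.
exact: (Elin a _ _ (Vsmooth_translate v.1.1 v.1.2 v.2 Vf) (Vsmooth_translate v.1.1 v.1.2 v.2 Vh)).
Qed.

Lemma whittaker_integrand_bound lambda m1 m2 f b v :
  converges lambda -> V lambda f -> seminorm_le 2 0 f b ->
  unit_cube v -> normc (whittaker_integrand lambda m1 m2 f v) <= 2048 * b.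
Proof.
move=> l3 Vf sb [_ /andP[y0 y1] _].
rewrite /whittaker_integrand psi_nSL !Normc.normcM !normc_e2pi !mul1r.
rewrite (Eisenstein2_translate _ _ _ l3 Vf).
by apply: csum_eis_term_bound => //; rewrite normrN ger0_norm // ltW.
Qed.

(** As for [Eisenstein2], the integral must be seen to be a distribution vector before [xget] can be
    evaluated; linearity and continuity pass from the integrand to the integral over a cube of
    measure 1. *)
Lemma whittaker2E lambda m1 m2 f : converges lambda ->
  V lambda f ->
  pairing f (whittaker2 lambda m1 m2) =
  cintegral mu3 unit_cube (whittaker_integrand lambda m1 m2 f).
Proof.
move=> l3 Vf.
pose F (n : SL3 R) : dvec R := fun f =>
  psi m1 m2 n * pi_dist (ginv (n, false)) (Eisenstein2 lambda) f.
suff H : [set T | Vdist lambda phi T /\ forall f, V lambda f ->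
      cintegrable mu3 unit_cube (fun v => pairing f (F (nSL v.1.1 v.1.2 v.2))) /\
      pairing f T = cintegral mu3 unit_cube (fun v => pairing f (F (nSL v.1.1 v.1.2 v.2)))]
    (fun f => cintegral mu3 unit_cube (whittaker_integrand lambda m1 m2 f)).
  have [_ /(_ f Vf)[_]] := xgetPex (fun=> 0) (ex_intro _ _ H).
  exact.
split; last by move=> h Vh; have [] := whittaker_integral m1 m2 Vh l3.
split.
  move=> a h k Vh Vk.
  have [ih _ _] := whittaker_integral m1 m2 Vh l3.
  have [ik _ _] := whittaker_integral m1 m2 Vk l3.
  have iah := @cintegrableZ R _ _ mu3 _ (@measurable_cube R) a _ ih.
  rewrite -(@cintegralZ R _ _ mu3 _ (@measurable_cube R) a _ ih).
  rewrite -(@cintegralD R _ _ mu3 _ (@measurable_cube R) _ _ iah ik).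
  apply: eq_cintegral => v _; exact: whittaker_integrand_linear.
(* Twice the 2048 of the integrand, for real and imaginary parts. *)
exists 2, 0%N, 4096 => h b Vh sb.
have [ih _ _] := whittaker_integral m1 m2 Vh l3.
rewrite (_ : 4096 * b = 2048 * b + 2048 * b); last by ring.
apply: (@cintegral_norm_le R _ _ mu3 _ (@measurable_cube R) _ _ (mu_cube R) ih) => v Dv.
exact: whittaker_integrand_bound.
Qed.
(** Moving the centre of decay from c to 0 costs (1 + |c|)^4, since max(1,|t|) <= (1 + |c|) max(1,|c
    - t|). *)
Lemma cdecay_integrable (h : R -> C) (c K : R) : cmeasurable setT h ->
  (forall t, normc (h t) <= K * Num.max 1 `|c - t| ^- 4) -> cintegrable mu setT h.
Proof.
move=> [mr mi] hK.
have K0 : 0 <= K.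
  have := le_trans (normc_ge0 _) (hK c).
  by rewrite subrr normr0 (max_l ler01) expr1n invr1 mulr1.
have hK' t : normc (h t) <= (K * (1 + `|c|) ^+ 4) * Num.max 1 `|t| ^- 4.
  apply: le_trans (hK t) _; rewrite -mulrA; apply: ler_wpM2l => //.
  have c0 : 0 <= `|c| by [].
  have t1 : 1 <= Num.max 1 `|t| by rewrite le_max lexx.
  have m1 : 1 <= Num.max 1 `|c - t| by rewrite le_max lexx.
  have ct : `|c - t| <= Num.max 1 `|c - t| by rewrite le_max lexx orbT.
  have tm : Num.max 1 `|t| <= (1 + `|c|) * Num.max 1 `|c - t|.
    rewrite ge_max; apply/andP; split; first by nra.
    have : `|t| <= `|c| + `|c - t| by rewrite -{1}(subKr c t); exact: ler_normB.
    nra.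
  move: (Num.max 1 `|t|) (Num.max 1 `|c - t|) t1 m1 tm {ct} => s u s1 u1 su.
  have s40 : 0 < s ^+ 4 by rewrite exprn_gt0 // (lt_le_trans ltr01).
  have u40 : 0 < u ^+ 4 by rewrite exprn_gt0 // (lt_le_trans ltr01).
  rewrite ler_pdivlMr // mulrC ler_pdivrMr // -exprMn.
  apply: lerXn2r => //; rewrite nnegrE; first exact: le_trans s1.
  by apply: le_trans su; exact: le_trans s1.
split; apply: (decay_integrable (K := K * (1 + `|c|) ^+ 4)) => // t;
  apply: le_trans (hK' t); [exact: le_Re_normc|exact: le_Im_normc].
Qed.

Definition fourier f (m : int) (j : 'I_2) : C :=
  cintegral mu setT (fun y => f (nt 0 y 0 *t wt) j 0 * (psi 0 m (nSL 0 y 0))^-1).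

Lemma psi0V (m : int) (y : R) : (psi 0 m (nSL 0 y 0))^-1 = e2pi ((- m)%:~R * y).
Proof. by rewrite psi_nSL mulr0 mulrNz mulNr e2piN (e2pi_int R 0) mul1r. Qed.

Lemma fourier_integrable lambda f m j : V lambda f -> converges lambda ->
  cintegrable mu setT (fun y => wval f j y * (psi 0 m (nSL 0 y 0))^-1).
Proof.
move=> Vf l3; have [K fK] := exists_arc_bound Vf.
apply: (@cdecay_integrable _ 0 K).
  apply: cmeasurableM; first exact: cmeasurable_wval Vf.
  by under eq_fun do rewrite psi0V; exact: cmeasurable_e2pi.
move=> t; rewrite psi0V Normc.normcM normc_e2pi mulr1 sub0r normrN.
exact: wval_bound Vf l3 fK.
Qed.

Lemma fourier_twist lambda f (m j : int) : V lambda f -> converges lambda ->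
  cintegral mu setT (fun t => e2pi ((- m)%:~R * t) * twist f j t) =
  if (j %% 4)%Z == 1 then 'i * fourier f m 0 else - fourier f m 1.
Proof.
move=> Vf l3; have i0 := fourier_integrable m 0 Vf l3; have i1 := fourier_integrable m 1 Vf l3.
rewrite /twist; case: (boolP ((j %% 4)%Z == 1)) => _.
  rewrite -(cintegralZ measurableT _ i0); apply: eq_cintegral => t _.
  by rewrite psi0V mulrCA [e2pi _ * _]mulrC.
rewrite -[- fourier _ _ _]mulN1r -(cintegralZ measurableT _ i1); apply: eq_cintegral => t _.
by rewrite psi0V mulN1r mulrN mulrC.
Qed.

(** On a residue class mod 4B neither the symbol nor [twist] depends on k, which enters only as the
    translation y - k, invisible to the character. After unfolding, the substitution t = c - y with
    c = d/4B splits off e(m c). *)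
Lemma residue_sum lambda f (m : int) (B d : nat) : (0 < B)%N -> odd d ->
  V lambda f -> converges lambda ->
  csum [set: int] (fun k => cintegral mu I01
    (line_term lambda f m (B, d%:Z + (4 * B)%N%:Z * k))) =
  cpow (4 * B)%:R (- 1 - lambda 0 0 + lambda 0 1) * (kronecker B d)%:~R *
  e2pi (m%:~R * d%:R / (4 * B)%:R) *
  (if (d %% 4 == 1)%N then 'i * fourier f m 0 else - fourier f m 1).
Proof.
move=> B0 od Vf l3; have [K fK] := exists_arc_bound Vf.
pose c : R := d%:R / (4 * B)%:R.
set A := cpow _ _ * _.
pose h (y : R) : C := A * (e2pi (m%:~R * y) * twist f d (c - y)).
have mtw : cmeasurable setT (fun y : R => e2pi (m%:~R * y) * twist f d (c - y)).
  apply: cmeasurableM; first exact: cmeasurable_e2pi.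
  apply: (cmeasurable_comp (h := twist f d)); first exact: cmeasurable_twist Vf.
  exact: (@measurable_reflR R c).
have mh : cmeasurable setT h by apply: cmeasurableM mtw; exact: cmeasurable_cst.
have itw : cintegrable mu setT (fun y : R => e2pi (m%:~R * y) * twist f d (c - y)).
  apply: (@cdecay_integrable _ c K) => // t; rewrite Normc.normcM normc_e2pi mul1r.
  exact: twist_bound Vf l3 fK.
have ih : cintegrable mu setT h by exact: (cintegrableZ measurableT A itw).
have B40 : (4 * B)%:R != 0 :> R by rewrite pnatr_eq0; lia.
transitivity (csum [set: int] (fun k => cintegral mu I01 (fun y => h (y - k%:~R)))); last first.
  have [_ ->] := csum_unfold mh ih.
  rewrite (cintegralZ measurableT _ itw) -[RHS]mulrA; congr (_ * _).
  rewrite (cintegral_reflR c mtw).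
  have -> : (if (d %% 4 == 1)%N then 'i * fourier f m 0 else - fourier f m 1) =
      cintegral mu setT (fun t => e2pi ((- m)%:~R * t) * twist f d t).
    by rewrite (fourier_twist _ _ Vf l3) modz_nat.
  rewrite -(@cintegralZ R _ _ mu _ measurableT); last first.
    apply: (@cdecay_integrable _ 0 K).
      by apply: cmeasurableM; [exact: cmeasurable_e2pi|exact: cmeasurable_twist Vf].
    move=> t; rewrite Normc.normcM normc_e2pi mul1r sub0r normrN.
    exact: twist_bound Vf l3 fK.
  apply: eq_cintegral => t _; rewrite subKr mulrA; congr (_ * _).
  by rewrite -e2piD; congr e2pi; rewrite /c mulrNz; ring.
apply: eq_csum => k _; apply: eq_cintegral => y _.
rewrite /line_term /eis_term /eis_coef /h /=.
rewrite kronecker_period // -/A mulrCA; congr (_ * (_ * _)).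
  by rewrite mulrBr -intrM e2piD e2piN e2pi_int invr1 mulr1.
have -> : twist f (d%:Z + (4 * B)%N%:Z * k) = twist f d.
  apply/funext => t; rewrite /twist (_ : ((_ + _) %% 4)%Z = (d%:Z %% 4)%Z) //.
  by rewrite PoszM -mulrA [4%:Z * _]mulrC addrC modzMDl.
congr (twist f d _); rewrite /c intrD intrM -!pmulrn.
by field; rewrite pnatr_eq0 -lt0n.
Qed.
Lemma csummable_sub (T : choiceType) (D E : set T) (u : T -> C) : D `<=` E ->
  (forall x, E x -> ~ D x -> u x = 0) -> csummable D u -> csummable E u.
Proof.
move=> DE u0; rewrite /csummable /summable esum_mkcond => sD.
rewrite esum_mkcond; apply: le_lt_trans sD; apply: le_esum => x _.
case: ifPn => [|_]; last by case: ifPn.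
rewrite inE => Ex; case: ifPn => //; rewrite notin_setE => Dx.
by rewrite u0 // Normc.normc0 abse0.
Qed.

(** Coprimality is dropped, the symbol being 0 on the added pairs; then j runs over all odd integers
    and [csum_residues] applies. *)
Lemma line_sum lambda f m : V lambda f -> converges lambda ->
  csum index_set (fun p => cintegral mu I01 (line_term lambda f m p)) =
  csum [set B : nat | (0 < B)%N] (fun B => \sum_(d < 4 * B | odd d)
    cpow (4 * B)%:R (- 1 - lambda 0 0 + lambda 0 1) * (kronecker B d)%:~R *
    e2pi (m%:~R * d%:R / (4 * B)%:R) *
    (if (d %% 4 == 1)%N then 'i * fourier f m 0 else - fourier f m 1)).
Proof.
move=> Vf l3; have [_ sJ _] := whittaker_integral 0 m Vf l3.
pose J p := cintegral mu I01 (line_term lambda f m p).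
pose D2 (B : nat) := [set j : int | odd `|j|%N].
pose D := [set B : nat | (0 < B)%N] `*`` D2.
have sub : index_set `<=` D by move=> p [].
have J0 p : D p -> ~ index_set p -> J p = 0.
  move=> [p0 op] np; have cop : ~~ coprime p.1 `|p.2|%N by apply/negP => cop; exact: np.
  rewrite /J (@eq_cintegral R _ _ mu I01 _ (fun=> 0)).
    by rewrite /cintegral /= /Rintegral integral0.
  by move=> y _; rewrite /line_term /eis_term /eis_coef kronecker_eq0 // !(mulr0, mul0r).
have sD := csummable_sub sub J0 sJ.
rewrite -(csum_sub sub J0).
have sD' : csummable D (fun k => J (k.1, k.2)) by apply: eq_csummable sD => -[].
rewrite (@eq_csum R _ D _ (fun k => J (k.1, k.2))); last by case.
have [s2 [_ ->]] := csum_fubini (f := fun B j => J (B, j)) sD'.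
apply: eq_csum => B /= B0.
rewrite (@csum_residues R (4 * B)%N (fun j => J (B, j))) ?muln_gt0 ?oddM //; last exact: s2.
by apply: eq_bigr => d od; exact: residue_sum.
Qed.

(** For d = 1 mod 4, eps^-1 + eps is 2 and eps^-1 - eps is 0. For d = 3 mod 4 the sum is 0 and the
    difference is -2i, which with the outer -i and the division by 2 gives -1. The symbol (4B/d)
    equals (B/d) for odd d. *)
Lemma kloosterman_twist (m : int) (B : nat) (a W0 W1 : C) :
  \sum_(d < 4 * B | odd d)
    a * (kronecker B d)%:~R * e2pi (m%:~R * d%:R / (4 * B)%:R : R) *
    (if (d %% 4 == 1)%N then 'i * W0 else - W1) =
  'i * (a * ((kloosterman 1 m B + kloosterman (-1) m B) / 2)) * W0 +
  (- 'i) * (a * ((kloosterman 1 m B - kloosterman (-1) m B) / 2)) * W1.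
Proof.
have ii : 'i * 'i = -1 :> C by apply/eqP; rewrite eq_complex /=; apply/andP; split; apply/eqP; ring.
have i0 : 'i != 0 :> C by rewrite eq_complex /= oner_eq0 andbF.
rewrite /kloosterman -sumrB -big_split /=.
rewrite !(mulr_suml, mulr_sumr) -big_split /=.
apply: eq_bigr => d od; rewrite /eps complexiE kronecker_4M // opprK expr1z exprN1.
set k := (kronecker B d)%:~R; set e := e2pi _.
case: ifP => _.
  by rewrite invr1; field.
have -> : ('i : C)^-1 = - 'i by apply: (mulfI i0); rewrite mulfV // mulrN ii opprK.
have -> : (- 'i) * (a * ((- 'i * k * e - 'i * k * e) / 2)) * W1 = ('i * 'i) * (a * k * e) * W1.
  by field.
by rewrite ii; field.
Qed.

Lemma kloosterman_bound (kappa m : int) (B : nat) : kappa \in [:: 1; -1] ->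
  normc (kloosterman kappa m B : C) <= (4 * B)%:R.
Proof.
move=> k1; apply: le_trans (normc_sum_le _ _ _) _.
apply: (@le_trans _ _ (\sum_(d < 4 * B) 1)); last by rewrite sumr_const card_ord.
rewrite big_mkcond; apply: ler_sum => d _; case: ifP => // od.
rewrite Normc.normcM normc_e2pi mulr1 Normc.normcM.
have -> : normc (eps d ^ (- kappa) : C) = 1.
  have e1 : normc (eps d : C) = 1.
    rewrite /eps; case: ifP => _; first exact: Normc.normc1.
    by rewrite /normc expr0n expr1n add0r sqrtr1.
  move: k1; rewrite !inE => /orP[/eqP->|/eqP->]; last by rewrite opprK expr1z.
  by rewrite exprN1 Normc.normcV e1 invr1.
by rewrite mul1r normc_kronecker.
Qed.

(** The power contributes (4B)^-4 and the trivial bound on the Kloosterman sum 4B, which leaves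
    (4B)^-3. *)
Lemma csummable_kloosterman lambda (kappa m : int) :
  converges lambda -> kappa \in [:: 1; -1] ->
  csummable [set B : nat | (0 < B)%N] (fun B =>
    cpow (4 * B)%:R (- 1 - lambda 0 0 + lambda 0 1) * kloosterman kappa m B).
Proof.
move=> l3 k1.
have sq : rsummable [set B : nat | (0 < B)%N] (@qweight R).
  apply/rsummable_lty; first by move=> B _; exact: qweight_ge0.
  apply: le_lt_trans (ltry 2); apply: le_trans (esum_qweight R).
  rewrite esum_mkcond; apply: le_esum => B _; case: ifP => // _.
  by rewrite lee_fin qweight_ge0.
have H B : (0 < B)%N -> normc (cpow (4 * B)%:R (- 1 - lambda 0 0 + lambda 0 1) *
    kloosterman kappa m B) <= qweight R B.
  move=> B0; rewrite Normc.normcM.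
  (* At j = 1 the symbol is 1, so the bound on the coefficient is one on the power alone. *)
  have := @eis_coef_bound R lambda (B, 1) B0 isT l3.
  rewrite /eis_coef (_ : kronecker _ _ = 1); last by rewrite /kronecker /= big_nil mulr1.
  rewrite mulr1 /= => cB.
  apply: (@le_trans _ _ ((4 * B)%:R ^- 4 * (4 * B)%:R)).
    by apply: ler_pM; rewrite ?normc_ge0 // kloosterman_bound.
  rewrite /qweight -[B.+1%:R]natr1 natrM.
  have : 1 <= B%:R :> R by rewrite ler1n.
  move: (B%:R : R) => x x1.
  have x0 : x != 0 by rewrite gt_eqF // (lt_le_trans ltr01).
  rewrite (_ : (4 * x) ^- 4 * (4 * x) = ((4 * x) ^+ 3)^-1); last by field.
  rewrite lef_pV2 ?posrE; [|by apply: exprn_gt0; lra|by apply: exprn_gt0; lra].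
  apply: (@le_trans _ _ ((4 * x) ^+ 2)); first by rewrite ler_sqr ?nnegrE; lra.
  by apply: ler_weXn2l => //; lra.
apply/csummableP; split; apply: le_rsummable sq => B B0.
  by apply: le_trans (le_Re_normc _) _; exact: H.
by apply: le_trans (le_Im_normc _) _; exact: H.
Qed.
End Line.

Theorem proposition38 (R : realType) :
  exists c : R, forall lambda : 'rV[R[i]]_3,
    \sum_(i < 3) lambda 0 i = 0 ->
    c < complex.Re (lambda 0 0 - lambda 0 1) ->
    c < complex.Re (lambda 0 1 - lambda 0 2) ->
  forall (m1 m2 : int) (f : vfun R),
    Vsmooth (- lambda) (contragredient phi) f ->
    (m1 <> 0 -> pairing f (whittaker2 lambda m1 m2) = 0) /\
    (m1 = 0 ->
      pairing f (whittaker2 lambda m1 m2) =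
        (0 +i* 1) *
        csum [set B : nat | (0 < B)%N] (fun B =>
          cpow (4 * B)%:R (- 1 - lambda 0 0 + lambda 0 1) *
          ((kloosterman 1 m2 B + kloosterman (-1) m2 B) / 2)) *
        cintegral lebesgue_measure [set: R] (fun y =>
          f (nt 0 y 0 *t wt) 0 0 * (psi m1 m2 (nSL 0 y 0))^-1)
        + (- (0 +i* 1)) *
        csum [set B : nat | (0 < B)%N] (fun B =>
          cpow (4 * B)%:R (- 1 - lambda 0 0 + lambda 0 1) *
          ((kloosterman 1 m2 B - kloosterman (-1) m2 B) / 2)) *
        cintegral lebesgue_measure [set: R] (fun y =>
          f (nt 0 y 0 *t wt) 1 0 * (psi m1 m2 (nSL 0 y 0))^-1)).
Proof.
exists 3 => lambda _ /ltW l3 _ m1 m2 f Vf.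
rewrite (whittaker2E _ _ l3 Vf); have [_ _ ->] := whittaker_integral m1 m2 Vf l3.
split=> [/eqP m10|->].
  rewrite (_ : cintegral _ _ _ = 0) ?mul0r // /cintegral.
  by have [-> ->] := integral_e2pi_period R m10.
have e0 (x : R) : e2pi ((0 : int)%:~R * x) = 1.
  by rewrite mul0r; exact: (e2pi_int R 0).
rewrite (_ : cintegral _ _ _ = 1); last first.
  by rewrite (funext e0) /cintegral /= !integral_I01_cst.
rewrite mul1r line_sum //.
pose c (B : nat) : R[i] := cpow (4 * B)%:R (- 1 - lambda 0 0 + lambda 0 1).
have s1 := csummable_kloosterman m2 l3 (kappa := 1) isT.
have s2 := csummable_kloosterman m2 l3 (kappa := -1) isT.
pose Tp B := c B * ((kloosterman 1 m2 B + kloosterman (-1) m2 B) / 2).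
pose Tm B := c B * ((kloosterman 1 m2 B - kloosterman (-1) m2 B) / 2).
have sp : csummable [set B : nat | (0 < B)%N] Tp.
  apply: eq_csummable (csummableZ (2^-1) (csummableD s1 s2)) => B _ /=.
  by rewrite /Tp /c; field.
have sm : csummable [set B : nat | (0 < B)%N] Tm.
  apply: eq_csummable (csummableZ (2^-1) (csummableD s1 (csummableZ (-1) s2))) => B _ /=.
  by rewrite /Tm /c; field.
(* By [kloosterman_twist] the term of B combines two Kloosterman averages with coefficients free of
   B, which can therefore leave the sum. *)
transitivity (csum [set B : nat | (0 < B)%N] (fun B =>
    ('i * fourier f m2 0) * Tp B + (- 'i * fourier f m2 1) * Tm B)).
  apply: eq_csum => B _; rewrite kloosterman_twist.
  by congr (_ + _); rewrite mulrAC.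
rewrite csumD ?csumZ //; [|exact: csummableZ|exact: csummableZ].
by rewrite complexiE; congr (_ + _); rewrite mulrAC.
Qed.
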